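(* Let $\varphi:\mathbb{D}\to\mathbb{D}$ be an analytic function with $\varphi(0)=0$ whose counting function $n_\varphi$ is essentially bounded on $\mathbb{D}$. Then the set $\{\varphi^n : n=0,1,2,\dots\}$ is orthogonal in the Dirichlet space $\mathcal{D}$ (that is, $\langle \varphi^n,\varphi^m\rangle_{\mathcal{D}}=0$ for all nonnegative integers $n\neq m$) if and only if there is a function $g:[0,1)\to[0,\infty)$ such that for almost every $r\in[0,1)$, $n_\varphi(re^{i\theta})=g(r)$ for almost every $\theta\in[0,2\pi]$ (that is, $n_\varphi$ is essentially radial).
   Context: $\mathbb{D}$ is the open unit disk in $\mathbb{C}$ and $dA=\frac1\pi\,dx\,dy$ is normalized area measure on $\mathbb{D}$. The Dirichlet space $\mathcal{D}$ is the Hilbert space of analytic functions $f$ on $\mathbb{D}$ with $\int_{\mathbb{D}}|f'|^2\,dA<\infty$, with norm $\|f\|_{\mathcal{D}}^2=|f(0)|^2+\int_{\mathbb{D}}|f'(z)|^2\,dA(z)$ and inner product $\langle f,h\rangle_{\mathcal{D}}=f(0)\overline{h(0)}+\int_{\mathbb{D}}f'(z)\overline{h'(z)}\,dA(z)$. Here $\varphi^n$ denotes the $n$-th pointwise power of $\varphi$ ($\varphi^0=1$). The counting function $n_\varphi(w)$, $w\in\mathbb{D}$, is the cardinality of $\{z\in\mathbb{D}:\varphi(z)=w\}$ when this set is finite, and $\infty$ otherwise. It is essentially bounded if there is a constant $C$ such that $n_\varphi(w)\le C$ for all $w\in\mathbb{D}$ outside a set of area zero; when this holds, $\varphi$ and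 all its powers belong to $\mathcal{D}$. *)

(* Defs.v *)
From mathcomp Require Import all_boot all_order all_algebra.
From mathcomp Require Import all_classical all_reals all_analysis.
From mathcomp Require Export complex.

Set Implicit Arguments.
Unset Strict Implicit.
Unset Printing Implicit Defensive.
Import Order.TTheory GRing.Theory Num.Theory.
Import numFieldNormedType.Exports.

Local Open Scope classical_set_scope.
Local Open Scope complex_scope.
Local Open Scope ring_scope.

Definition unit_disk (R : realType) : set R[i] := [set z | `|z| < 1].

(* Complex differentiability: the scalar field of [R[i]^o] is [R[i]]. *)
Definition analytic_on_disk (R : realType) (f : R[i] -> R[i]) : Prop :=
  forall z, unit_disk z -> derivable (f : R[i]^o -> R[i]^o) z 1.

Definition cderive (R : realType) (f : R[i] -> R[i]) : R[i] -> R[i] :=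
  derive1 (f : R[i] -> R[i]^o).

(* Planar measure theory takes place on [R * R], identified with [R[i]]. *)
Definition cplx (R : realType) (p : R * R) : R[i] := p.1 +i* p.2.

Definition plane_disk (R : realType) : set (R * R) :=
  [set p | unit_disk (cplx p)].

Lemma pi_inv_ge0 (R : realType) : 0 <= (pi : R)^-1.
Proof. by rewrite invr_ge0 pi_ge0. Qed.

Definition area (R : realType) :
    {measure set (measurableTypeR R * measurableTypeR R) -> \bar R} :=
  mscale (NngNum (pi_inv_ge0 R)) (lebesgue_measure \x lebesgue_measure)%E.

Definition disk_integral (R : realType) (F : R[i] -> R[i]) : R[i] :=
  (\int[@area R]_(p in @plane_disk R) complex.Re (F (cplx p)))%R
  +i* (\int[@area R]_(p in @plane_disk R) complex.Im (F (cplx p)))%R.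

Definition dirichlet_space (R : realType) : set (R[i] -> R[i]) :=
  [set f | analytic_on_disk f /\
    (\int[@area R]_(p in @plane_disk R)
       ((Normc.normc (cderive f (cplx p))) ^+ 2)%:E < +oo)%E].

Definition dirichlet_inner (R : realType) (f h : R[i] -> R[i]) : R[i] :=
  f 0 * (h 0)^* + disk_integral (fun z => cderive f z * (cderive h z)^*).

Definition dirichlet_orthogonal (R : realType) (u : nat -> R[i] -> R[i]) :
    Prop :=
  (forall n, dirichlet_space (u n)) /\
  (forall n m, n <> m -> dirichlet_inner (u n) (u m) = 0).

(* [counting A] is the cardinality of [A] if [A] is finite, [+oo] otherwise. *)
Definition counting_fun (R : realType) (phi : R[i] -> R[i]) (w : R[i]) :
    \bar R :=
  counting [set z | unit_disk z /\ phi z = w].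

Definition ess_bounded_on_disk (R : realType) (N : R[i] -> \bar R) : Prop :=
  exists C : R, {ae @area R, forall p, plane_disk p -> (N (cplx p) <= C%:E)%E}.

Definition ess_radial (R : realType) (N : R[i] -> \bar R) : Prop :=
  exists g : R -> R,
    (forall r, 0 <= r < 1 -> 0 <= g r) /\
    {ae @lebesgue_measure R, forall r, 0 <= r < 1 ->
      {ae @lebesgue_measure R, forall theta, 0 <= theta <= 2 * pi ->
        N ((r * cos theta) +i* (r * sin theta)) = (g r)%:E}}.

(* Main.v *)
From HB Require Import structures.
Require Import Defs.
From mathcomp Require Import all_boot all_order all_algebra.
From mathcomp Require Import all_classical all_reals all_analysis.
From mathcomp Require Import measurable_realfun.
From mathcomp Require Import ring lra.

Set Implicit Arguments.
Unset Strict Implicit.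
Unset Printing Implicit Defensive.
Import Order.TTheory GRing.Theory Num.Theory.
Import numFieldNormedType.Exports.

Local Open Scope classical_set_scope.
Local Open Scope ring_scope.

(** Let [n_phi] be the counting function and [J = |phi'| ^ 2] the Jacobian
determinant of [phi] as a map of the real plane.  For [n, k > 0] the change of
variables [w = phi z] turns the inner product of [phi ^ n] and [phi ^ k] into

  [n k / pi] times the integral over the disk of
  [w ^ (n - 1) * conj w ^ (k - 1) * n_phi w].

So orthogonality of the powers says exactly that the moments of [n_phi] of
unequal orders [(a, b)] are zero.

If [n_phi] is radial, these moments vanish in polar coordinates, because on each
circle [w ^ a * conj w ^ b] is a multiple of the exponential of [i (a - b) t]
([radial_moment0]).  Conversely, subtract from [n_phi] the radial function [g]
of its means over circles.  If the moments of unequal orders of [n_phi] are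
zero, then all moments of [n_phi - g] are zero, and a bounded function on the
disk all of whose moments vanish is zero almost everywhere
([moments_determine], [moments0_radial]).  The last fact uses explicit
polynomials: [(1 - v ^ n) ^ (2 ^ n)] tends to a step function on [[0, 1]], and
products of two of them in the coordinates tend to the indicator of a quadrant.

The change of variables is the area formula ([area_formula]), proved here for
a map [f] with a differential [A] at every point of an open set, when the
number of preimages has finite integral: integrating [G (f z)] against
[|det A|] is integrating [G] against the number of preimages at which [det A] is not
zero.  Where the differential is invertible, the domain is a countable union
of pieces on which [S \o f], for a rational matrix [S], differs from the
identity by a map of Lipschitz constant [e].  There it is injective and
changes areas and distances by factors close to [1], and [|det S|] is close to
[1 / |det A|] ([area_pieces]); adding up the pieces and letting [e] tend to
[0] gives the formula on closed sets, hence for all Borel functions.  Where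
the derivative of [phi] is zero, the differential vanishes altogether, and the
image of these points is a null set ([sard_zero]).  Images of Borel sets need
not be Borel, so the pieces are countable unions of compact sets throughout.
Polar coordinates are another instance of the same formula
([polar_integral]). *)

Local Notation lam R := (@lebesgue_measure R \x @lebesgue_measure R)%E.

Notation plane R := (measurableTypeR R * measurableTypeR R)%type.

(** * Topology and Borel sets of the plane *)

Section plane_topology.
Context {R : realType}.
Implicit Types (A B K U : set (plane R)) (p q x y : plane R).

Lemma plane_norm_le x (e : R) : (`|x| <= e) = (`|x.1| <= e) && (`|x.2| <= e).
Proof. by rewrite {1}/Num.norm/= ge_max. Qed.

Lemma plane_norm_lt x (e : R) : (`|x| < e) = (`|x.1| < e) && (`|x.2| < e).
Proof. by rewrite {1}/Num.norm/= gt_max. Qed.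

Lemma plane_hausdorff : hausdorff_space (plane R).
Proof. exact: (@norm_hausdorff R (R * R)%type). Qed.

Lemma plane_openP U :
  open U <-> forall p, U p -> exists2 e : R, 0 < e & forall q, `|q - p| < e -> U q.
Proof.
split=> [oU p Up|h].
  have /nbhs_ballP[e e0 eU] : nbhs p U by exact: open_nbhs_nbhs.
  exists e => // q qp; apply: eU.
  by rewrite -ball_normE /ball_/= -normrN opprB.
rewrite openE => p Up; have [e e0 eU] := h p Up.
apply/nbhs_ballP; exists e => // q.
by rewrite -ball_normE /ball_/= -normrN opprB => /eU.
Qed.

(** Images of compact sets under continuous maps are compact, whereas images
of Borel sets need not be Borel.  Every set to be mapped below is therefore
kept a countable union of compact sets. *)
Definition sigma_compact A :=
  exists K : nat -> set (plane R),
    (forall n, compact (K n)) /\ A = \bigcup_n K n.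

Lemma compact_sigma_compact K : compact K -> sigma_compact K.
Proof. by move=> cK; exists (fun=> K); rewrite bigcup_const. Qed.

Lemma sigma_compact0 : sigma_compact set0.
Proof. exact/compact_sigma_compact/compact0. Qed.

Lemma sigma_compact_bigcup (T : countType) (F : T -> set (plane R)) :
  (forall t, sigma_compact (F t)) -> sigma_compact (\bigcup_t F t).
Proof.
move=> /(_ _)/cid-/all_sig[K hK].
exists (fun n => if unpickle n is Some (t, m) then K t m else set0); split.
  move=> n; case: unpickle => [[t m]|]; last exact: compact0.
  exact: (hK t).1.
apply/seteqP; split => [x [t _]|x [n _]].
  rewrite (hK t).2 => -[m _ Kx]; exists (pickle (t, m)) => //.
  by rewrite pickleK.
case: unpickle => [[t m]|//] Kx; exists t => //.
by rewrite (hK t).2; exists m.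
Qed.

Lemma sigma_compactI A B :
  sigma_compact A -> sigma_compact B -> sigma_compact (A `&` B).
Proof.
move=> [K [cK ->]] [L [cL ->]].
have -> : (\bigcup_n K n) `&` (\bigcup_n L n) =
    \bigcup_(t : nat * nat) (K t.1 `&` L t.2).
  apply/seteqP; split => [x [[n _ Kx] [m _ Lx]]|x [[n m] _ /= [Kx Lx]]].
    by exists (n, m).
  by split; [exists n|exists m].
apply: sigma_compact_bigcup => -[n m] /=; apply: compact_sigma_compact.
have := @compact_closedI _ (K n) (L m) (cK n).
by apply; apply: compact_closed => //; exact: plane_hausdorff.
Qed.

Definition box p (e : R) : set (plane R) := [set q | `|q - p| <= e].

Lemma boxE p e :
  box p e = `[p.1 - e, p.1 + e] `*` `[p.2 - e, p.2 + e].
Proof.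
by apply/seteqP; split=> q; rewrite /box/= plane_norm_le !in_itv/= -!ler_distl
  => /andP.
Qed.

Lemma compact_box p e : compact (box p e).
Proof. by rewrite boxE; apply: compact_setX; exact: segment_compact. Qed.

Lemma measurable_box p e : measurable (box p e).
Proof. by rewrite boxE; apply: measurableX. Qed.

Lemma ratr_near (a e : R) : 0 < e -> exists q : rat, `|ratr q - a| < e.
Proof.
move=> e0; have [|q] := @rat_in_itvoo R (a - e) (a + e); first by lra.
rewrite in_itv/= => /andP[h1 h2]; exists q; rewrite ltr_distl; lra.
Qed.

Definition ratpt (t : rat * rat) : plane R := (ratr t.1, ratr t.2).

Lemma ratpt_near p (e : R) : 0 < e -> exists t : rat * rat, `|p - ratpt t| < e.
Proof.
move=> e0; have [q1 h1] := ratr_near p.1 e0; have [q2 h2] := ratr_near p.2 e0.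
exists (q1, q2); rewrite plane_norm_lt/= -normrN opprB h1/=.
by rewrite -normrN opprB.
Qed.

Lemma natinv_lt (e : R) : 0 < e -> exists n, n.+1%:R^-1 < e.
Proof.
move=> e0; exists (Num.truncn e^-1).
by rewrite invf_plt ?posrE//; exact: truncnS_gt.
Qed.

Lemma natinv_gt0 n : 0 < n.+1%:R^-1 :> R.
Proof. by rewrite invr_gt0 ltr0n. Qed.

Lemma open_boxes U : open U ->
  U = \bigcup_(t : rat * rat * nat)
        [set q | box (ratpt t.1) t.2.+1%:R^-1 q /\
                 box (ratpt t.1) t.2.+1%:R^-1 `<=` U].
Proof.
move=> /plane_openP oU; apply/seteqP; split => [p Up|p [t _ [bp]] bU]; last exact: bU.
have [e e0 eU] := oU p Up; have [n ne] := natinv_lt (divr_gt0 e0 (ltr0n _ 2)).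
have [q pq] := ratpt_near p (natinv_gt0 n).
exists (q, n) => //=; split; first exact: ltW.
move=> x qx; apply: eU; move: qx; rewrite /box /= => qx.
have -> : x - p = (x - ratpt q) - (p - ratpt q) by rewrite opprB addrA subrK.
rewrite (le_lt_trans (ler_normB _ _))// [ltRHS]splitr ltrD//.
  exact: le_lt_trans qx ne.
exact: lt_trans pq ne.
Qed.

Lemma open_sigma_compact U : open U -> sigma_compact U.
Proof.
move=> /open_boxes ->; apply: sigma_compact_bigcup => t.
have [bU|bU] := pselect (box (ratpt t.1) t.2.+1%:R^-1 `<=` U).
  apply: compact_sigma_compact.
  rewrite (_ : [set _ | _] = box (ratpt t.1) t.2.+1%:R^-1).
    exact: compact_box.
  by apply/seteqP; split=> // q [].
rewrite (_ : [set _ | _] = set0); first exact: sigma_compact0.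
by apply/seteqP; split=> // q [].
Qed.

Lemma open_measurable2 U : open U -> measurable U.
Proof.
move=> /open_boxes ->; apply: countable_bigcupT_measurable; first exact: countableP.
move=> t; have [bU|bU] := pselect (box (ratpt t.1) t.2.+1%:R^-1 `<=` U).
  rewrite (_ : [set _ | _] = box (ratpt t.1) t.2.+1%:R^-1).
    exact: measurable_box.
  by apply/seteqP; split=> // q [].
rewrite (_ : [set _ | _] = set0); first exact: measurable0.
by apply/seteqP; split=> // q [].
Qed.

Lemma closed_measurable2 A : closed A -> measurable A.
Proof.
move=> cA; rewrite -(setCK A); apply: measurableC.
by apply: open_measurable2; exact: closed_openC.
Qed.

Lemma compact_measurable2 K : compact K -> measurable K.
Proof.
by move=> cK; apply: closed_measurable2; apply: compact_closed => //; exact: plane_hausdorff.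
Qed.

Lemma sigma_compact_measurable A : sigma_compact A -> measurable A.
Proof.
move=> [K [cK ->]]; apply: bigcupT_measurable => n; exact: compact_measurable2.
Qed.

Lemma sigma_compactT : sigma_compact setT.
Proof. by apply: open_sigma_compact; exact: openT. Qed.

Lemma closed_sigma_compact A : closed A -> sigma_compact A.
Proof.
move=> cA; have [K [cK KT]] := sigma_compactT.
rewrite -(setTI A) KT setI_bigcupl; apply: sigma_compact_bigcup => n.
apply: compact_sigma_compact; exact: compact_closedI.
Qed.

Lemma sigma_compact_image A (f : plane R -> plane R) :
  {within A, continuous f} -> sigma_compact A -> sigma_compact (f @` A).
Proof.
move=> cf [K [cK AK]]; exists (fun n => f @` K n); split.
  move=> n; apply: continuous_compact (cK n).
  by apply: continuous_subspaceW cf; rewrite AK; exact: bigcup_sup.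
by rewrite AK image_bigcup.
Qed.

End plane_topology.

(** * Area under linear maps *)

Lemma ae_imply d (T : semiRingOfSetsType d) (R : realType)
    (mu : {measure set T -> \bar R}) (P Q : T -> Prop) :
  (forall x, P x -> Q x) -> {ae mu, forall x, P x} -> {ae mu, forall x, Q x}.
Proof.
move=> PQ [Z [mZ Z0 PZ]]; exists Z; split => // x /= nQ; apply: PZ => /= Px.
by apply: nQ; exact: PQ.
Qed.

Lemma ae_imply2 d (T : measurableType d) (R : realType)
    (mu : {measure set T -> \bar R}) (P Q S : T -> Prop) :
  (forall x, P x -> Q x -> S x) ->
  {ae mu, forall x, P x} -> {ae mu, forall x, Q x} -> {ae mu, forall x, S x}.
Proof.
move=> PQS [Y [mY Y0 PY]] [Z [mZ Z0 QZ]]; exists (Y `|` Z); split.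
- exact: measurableU.
- by rewrite measureU0.
move=> x /= nS; have [Px|nPx] := pselect (P x); last by left; apply: PY.
by right; apply: QZ => /= Qx; apply: nS; exact: PQS.
Qed.

Section plane_measure.
Context {R : realType}.
Local Notation leb := (@lebesgue_measure R).
Implicit Types (A B K U : set (plane R)) (p q : plane R).

(** Both sides are measures in [M]; they agree on half-open intervals. *)
Lemma lebesgue_affine (a t : R) (M : set (measurableTypeR R)) : a != 0 ->
  measurable M -> leb M = (`|a|%:E * leb [set x | M (a * x + t)%R])%E.
Proof.
move=> a0 mM; pose f (x : measurableTypeR R) : measurableTypeR R := a * x + t.
have mf : measurable_fun setT f.
  by apply: measurable_funD => //; apply: measurable_funM.
pose c : {nonneg R} := NngNum (normr_ge0 a).
pose m : {measure set (measurableTypeR R) -> \bar R} :=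
  measure_function_pushforward__canonical__measure_function_Measure leb mf.
transitivity (mscale c m M); last by [].
apply: lebesgue_measure_unique mM => X [[u v] _ <-].
rewrite -[RHS]/(`|a|%:E * leb (f @^-1` `]u, v]))%E.
have [ap|an|] := ltrgt0P a; last by move=> /eqP; rewrite (negbTE a0).
  rewrite (_ : f @^-1` _ = `](u - t) / a, (v - t) / a]%classic); last first.
    apply/seteqP; split => z; rewrite /f/= !in_itv/= ltr_pdivrMr// ler_pdivlMr//;
    by rewrite ltrBlDr lerBrDr mulrC.
  rewrite !lebesgue_measure_itv/= !lte_fin ltr_pM2r ?invr_gt0// ltrD2r.
  case: ifPn => _; last by rewrite mule0.
  by rewrite -EFinM; congr EFin; field.
rewrite (_ : f @^-1` _ = `[(v - t) / a, (u - t) / a[%classic); last first.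
  apply/seteqP; split => z; rewrite /f/= !in_itv/= ltr_ndivlMr// ler_ndivrMr//;
  by rewrite ltrBlDr lerBrDr mulrC andbC.
rewrite !lebesgue_measure_itv/= !lte_fin ltr_nM2r ?invr_lt0// ltrD2r.
case: ifPn => _; last by rewrite mule0.
by rewrite -EFinM; congr EFin; field.
Qed.

Lemma ae_fst_neq (s : R) : {ae lam R, forall w, w.1 != s}.
Proof.
exists ([set s] `*` setT); split; first exact: measurableX.
  rewrite product_measure1E//; transitivity (0 * @lebesgue_measure R setT)%E; last exact: mul0e.
  by congr (_ * _)%E; exact: lebesgue_measure_set1.
by move=> w /= /negP; rewrite negbK => /eqP.
Qed.

Lemma ae_snd_neq (t : R) : {ae lam R, forall w, w.2 != t}.
Proof.
exists (setT `*` [set t]); split; first exact: measurableX.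
  rewrite product_measure1E//; transitivity (@lebesgue_measure R setT * 0)%E; last exact: mule0.
  by congr (_ * _)%E; exact: lebesgue_measure_set1.
by move=> w /= /negP; rewrite negbK => /eqP.
Qed.

Lemma lamE A : measurable A -> lam R A = (\int[leb]_y leb (ysection A y))%E.
Proof.
move=> mA; pose m : {measure set (plane R) -> \bar R} := (leb \x^ leb)%E.
by rewrite -[RHS]/(m A); apply: product_measure_unique => // *; exact: product_measure2E.
Qed.

Definition lin (a b c d : R) p : plane R := (a * p.1 + b * p.2, c * p.1 + d * p.2).

Lemma measurable_lin a b c d : measurable_fun setT (lin a b c d).
Proof.
apply/measurable_fun_pairP; split => /=;
  by apply: measurable_funD; apply: measurable_funM.
Qed.

(** As [a] is not zero, the map is [lin 1 0 (c / a) d'] after [lin a b 0 1].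
Each factor is affine in one coordinate and fixes the other, so that Fubini
reduces it to the real line. *)
Lemma lam_lin a b c d A : a != 0 -> a * d - b * c != 0 -> measurable A ->
  lam R A = (`|a * d - b * c|%:E * lam R (lin a b c d @^-1` A))%E.
Proof.
move=> a0 D0 mA.
pose d' := (d - b * c / a); have d'0 : d' != 0.
  have -> : d' = (a * d - b * c) / a by rewrite /d'; field.
  by rewrite mulf_neq0// invr_eq0.
have mpre (f : plane R -> plane R) B : measurable_fun setT f ->
    measurable B -> measurable (f @^-1` B).
  by move=> mf mB; rewrite -[X in measurable X]setTI; exact: mf.
pose B := lin 1 0 (c / a) d' @^-1` A.
have mB : measurable B by apply: mpre => //; exact: measurable_lin.
have -> : lin a b c d @^-1` A = lin a b 0 1 @^-1` B.
  apply/seteqP; split=> p; rewrite /B /lin/=; set q := (X in A X -> _);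
    set q' := (X in _ -> A X); suff -> : q = q' by [].
    by rewrite /q/q' /d'; congr pair; field.
  by rewrite /q/q' /d'; congr pair; field.
have -> : `|a * d - b * c| = `|d'| * `|a|.
  by rewrite -normrM; congr (`|_|); rewrite /d'; field.
rewrite EFinM -muleA.
transitivity (`|d'|%:E * lam R B)%E.
  rewrite /product_measure1 -ge0_integralZl//; last exact: measurable_fun_xsection.
  apply: eq_integral => x _ /=; rewrite (@lebesgue_affine d' (c / a * x))//; last first.
    exact: measurable_xsection.
  congr (_ * leb _)%E; apply/seteqP; split => y; rewrite /= /xsection/= !inE /B /lin/=.
    by rewrite mul1r mul0r addr0 addrC.
  by rewrite mul1r mul0r addr0 addrC.
congr (_ * _)%E; rewrite !lamE//; last by apply: mpre => //; exact: measurable_lin.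
rewrite -ge0_integralZl//; last first.
  by apply: measurable_fun_ysection; apply: mpre => //; exact: measurable_lin.
apply: eq_integral => y _ /=; rewrite (@lebesgue_affine a (b * y))//; last first.
  exact: measurable_ysection.
congr (_ * leb _)%E; apply/seteqP; split => x; rewrite /= /ysection/= !inE /lin/=.
  by rewrite mul1r mul0r add0r.
by rewrite mul1r mul0r add0r.
Qed.

Lemma lam_square (a b d : R) : 0 <= d ->
  lam R (`[a, a + d] `*` `[b, b + d]) = (d ^+ 2)%:E.
Proof.
move=> d0; have lebI (c : R) : leb `[c, c + d]%classic = d%:E.
  rewrite lebesgue_measure_itv/= lte_fin ltrDl; case: ltP => dd.
    by rewrite -EFinD; congr EFin; ring.
  by have -> : d = 0 by apply/eqP; rewrite eq_le d0 dd.
rewrite product_measure1E//; transitivity (d%:E * d%:E)%E.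
  by congr (_ * _)%E; exact: lebI.
by rewrite -EFinM expr2.
Qed.

(** The distance is the supremum distance, whose balls are squares: the diameter
of a set bounds its area without any loss in the constant. *)
Lemma enclosing_square A (d : R) : 0 <= d ->
  (forall p q, A p -> A q -> `|p - q| <= d) ->
  exists B, [/\ measurable B, A `<=` B & (lam R B <= (d ^+ 2)%:E)%E].
Proof.
move=> d0 Ad; have [->|/set0P[p0 Ap0]] := eqVneq A set0.
  by exists set0; split; rewrite ?measure0 ?lee_fin ?sqr_ge0.
have h (f : plane R -> R) : (forall p q, A p -> A q -> `|f p - f q| <= d) ->
    exists a, forall p, A p -> f p \in `[a, a + d].
  move=> fd; have hi : has_inf [set f p | p in A].
    split; first by exists (f p0), p0.
    exists (f p0 - d) => _ [p Ap <-]; have := fd p p0 Ap Ap0.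
    by rewrite ler_norml => /andP[h _]; lra.
  exists (inf [set f p | p in A]) => p Ap; rewrite in_itv/=; apply/andP; split.
    by apply: ge_inf; [case: hi|exists p].
  rewrite -lerBlDr; apply: lb_le_inf; first by exists (f p0), p0.
  move=> _ [q Aq <-]; have := fd p q Ap Aq.
  by rewrite ler_norml => /andP[_ h]; lra.
have [|a ha] := h fst.
  by move=> p q Ap Aq; have := Ad p q Ap Aq; rewrite plane_norm_le => /andP[].
have [|b hb] := h snd.
  by move=> p q Ap Aq; have := Ad p q Ap Aq; rewrite plane_norm_le => /andP[].
exists (`[a, a + d] `*` `[b, b + d]); split; last by rewrite lam_square.
  exact: measurableX.
by move=> p Ap; split; [exact: ha|exact: hb].
Qed.

(** A compact set is the intersection of its open neighbourhoods, so one of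
them has almost the same area. *)
Lemma compact_neighborhood K (e : R) : compact K -> 0 < e ->
  exists2 V, measurable V /\ (lam R V <= lam R K + e%:E)%E &
    exists2 d : R, 0 < d & forall p q, K p -> `|q - p| < d -> V q.
Proof.
move=> cK e0.
pose V n : set (plane R) := \bigcup_(p in K) [set q | `|q - p| < n.+1%:R^-1].
have oV n : open (V n).
  apply/plane_openP => q [p Kp qp]; exists (n.+1%:R^-1 - `|q - p|).
    by rewrite subr_gt0.
  move=> r rq; exists p => //=; have -> : r - p = (r - q) + (q - p).
    by rewrite addrA subrK.
  by rewrite (le_lt_trans (ler_normD _ _))// -ltrBrDr.
have mV n : measurable (V n) by exact: open_measurable2.
have VK : \bigcap_n V n = K.
  apply/seteqP; split => [q Vq|q Kq n _]; last first.
    by exists q => //=; rewrite subrr normr0 natinv_gt0.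
  apply: contrapT => nKq.
  have /plane_openP/(_ q nKq)[d d0 dK] : open (~` K).
    by apply: closed_openC; apply: compact_closed => //; exact: plane_hausdorff.
  have [n nd] := natinv_lt d0; have [p Kp qp] := Vq n I.
  by apply: (dK p) Kp; rewrite -normrN opprB; exact: lt_trans nd.
have [M [_ KM]] := compact_bounded cK.
have {}KM p : K p -> `|p| <= M + 1 by apply: KM; rewrite ltrDl.
have V0 : (lam R (V 0%N) < +oo)%E.
  have [B [mB AB lB]] : exists B, [/\ measurable B, V 0%N `<=` B &
      (lam R B <= ((2 * (`|M| + 2)) ^+ 2)%:E)%E].
    apply: enclosing_square => [|p q [p' Kp' /= pp'] [q' Kq' /= qq']].
      by rewrite mulr_ge0// addr_ge0.
    have nb r r' : K r' -> `|r - r'| < 1%:R^-1 :> R -> `|r| <= `|M| + 2.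
      move=> Kr' rr'; have -> : r = (r - r') + r' by rewrite subrK.
      rewrite (le_trans (ler_normD _ _))//; have := KM _ Kr'.
      move: rr'; rewrite invr1 => /ltW rr' h; rewrite [_ + 2]addrC.
      have -> : 2 + `|M| = 1 + (`|M| + 1) by ring.
      by rewrite lerD// (le_trans h)// lerD2r ler_norm.
    rewrite (le_trans (ler_normB _ _))// mulr2n mulrDl mul1r lerD//.
      exact: nb pp'.
    exact: nb qq'.
  apply: le_lt_trans (le_lt_trans lB (ltry _)).
  by apply: le_measure => //; rewrite inE.
have Vd : {homo V : n m / (n <= m)%N >-> (m <= n)%O}.
  move=> n m nm; apply/subsetPset => q [p Kp /= qp]; exists p => //=.
  by rewrite (lt_le_trans qp)// lef_pV2 ?posrE ?ltr0n// ler_nat.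
have := nonincreasing_cvg_mu V0 mV _ Vd; rewrite VK => /(_ (compact_measurable2 cK)) cvgV.
have Kfin : lam R K \is a fin_num.
  rewrite ge0_fin_numE//; apply: le_lt_trans V0; apply: le_measure; rewrite ?inE//.
    exact: compact_measurable2.
  by rewrite -VK; exact: bigcap_inf.
have /fine_cvgP[_ /cvgrPdist_lt/(_ e e0)[n0 _ hn]] :
    (lam R \o V) n @[n --> \oo] --> (fine (lam R K))%:E by rewrite fineK.
have {}hn := hn n0 (leqnn _).
exists (V n0); [split=> //|].
  have Vfin : lam R (V n0) \is a fin_num.
    rewrite ge0_fin_numE//; apply: le_lt_trans V0.
    by apply: le_measure; rewrite ?inE//; exact/subsetPset/Vd.
  rewrite -(fineK Vfin) -(fineK Kfin) -EFinD lee_fin.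
  by move: hn => /=; rewrite ltr_norml => /andP[h _]; apply: ltW; move: h; rewrite /=; lra.
exists n0.+1%:R^-1; first exact: natinv_gt0.
by move=> p q Kp qp; exists p.
Qed.

End plane_measure.

(** * Area under Lipschitz maps *)

Section lipschitz.
Context {R : realType}.
Implicit Types (A B E K U : set (plane R)) (p q : plane R).

Definition cell (s : R) (t : int * int) : set (plane R) :=
  `[t.1%:~R * s, t.1%:~R * s + s[ `*` `[t.2%:~R * s, t.2%:~R * s + s[.

Lemma cell_coord (s a : R) (i : int) : 0 < s ->
  a \in `[i%:~R * s, i%:~R * s + s[ -> i = Num.floor (a / s).
Proof.
move=> s0; rewrite in_itv/= => /andP[h1 h2]; apply/esym/floor_def.
by rewrite ler_pdivlMr// ltr_pdivrMr// intrD mulrDl mul1r h1 h2.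
Qed.

Lemma cell_inj (s : R) t t' p : 0 < s -> cell s t p -> cell s t' p -> t = t'.
Proof.
move=> s0; case: t => i j; case: t' => i' j' [/= h1 h2] [/= h3 h4].
by rewrite (cell_coord s0 h1) (cell_coord s0 h2) (cell_coord s0 h3) (cell_coord s0 h4).
Qed.

Lemma cell_cover (s : R) p : 0 < s -> exists t, cell s t p.
Proof.
move=> s0; exists (Num.floor (p.1 / s), Num.floor (p.2 / s)).
have h (a : R) : a \in `[(Num.floor (a / s))%:~R * s, (Num.floor (a / s))%:~R * s + s[.
  have /andP[h1 h2] := floor_itv (a / s).
  move: h1 h2; rewrite ler_pdivlMr// ltr_pdivrMr// intrD mulrDl mul1r => h1 h2.
  by rewrite in_itv/= h1 h2.
by split; exact: h.
Qed.

Lemma cell_diam (s : R) t p q : 0 < s -> cell s t p -> cell s t q -> `|p - q| < s.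
Proof.
move=> s0 [/=]; rewrite !in_itv/= => /andP[h1 h2] /andP[h3 h4].
move=> [/=]; rewrite !in_itv/= => /andP[h5 h6] /andP[h7 h8].
by rewrite plane_norm_lt/= !ltr_norml; lra.
Qed.

Lemma measurable_cell (s : R) t : measurable (cell s t).
Proof. exact: measurableX. Qed.

Lemma lam_cell (s : R) t : 0 < s -> lam R (cell s t) = (s ^+ 2)%:E.
Proof.
move=> s0; have lebI (c : R) : lebesgue_measure `[c, c + s[%classic = s%:E.
  by rewrite lebesgue_measure_itv/= lte_fin ltrDl s0 -EFinD; congr EFin; ring.
rewrite product_measure1E//; transitivity (s%:E * s%:E)%E.
  by congr (_ * _)%E; exact: lebI.
by rewrite -EFinM expr2.
Qed.

(** Cut [v @` E] by a fine grid.  The part of [u @` E] over a cell of side [s]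
has diameter at most [L * s], hence lies in a square of area [L ^+ 2] times that
of the cell, and the cells used fill up little more than [v @` E].  Stating
this for a pair of maps treats a map and its inverse alike. *)
Lemma lam_lipschitz_compact (T : Type) (E : set T) (u v : T -> plane R) (L : R) :
  0 <= L -> measurable (u @` E) -> compact (v @` E) ->
  (forall x y, E x -> E y -> `|u x - u y| <= L * `|v x - v y|) ->
  (lam R (u @` E) <= (L ^+ 2)%:E * lam R (v @` E))%E.
Proof.
move=> L0 muE cvE uv; apply/lee_addgt0Pr => e e0.
pose eta := e / (L ^+ 2 + 1).
have L1 : 0 < L ^+ 2 + 1 by rewrite ltr_wpDl// sqr_ge0.
have eta0 : 0 < eta by rewrite divr_gt0.
have [V [mV lV] [d d0 VE]] := compact_neighborhood cvE eta0.
pose s := d / 2; have s0 : 0 < s by rewrite divr_gt0.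
have sd : s < d by rewrite /s; lra.
pose F n : set (plane R) := if pickle_inv n is Some t then
  [set q | cell s t q /\ exists2 x, E x & cell s t (v x)] else set0.
have mF n : measurable (F n).
  rewrite /F; case: pickle_inv => [t|]; last exact: measurable0.
  have [[x Ex tx]|h] := pselect (exists2 x, E x & cell s t (v x)).
    rewrite (_ : [set _ | _] = cell s t); first exact: measurable_cell.
    by apply/seteqP; split => q; [case|split=> //; exists x].
  rewrite (_ : [set _ | _] = set0); first exact: measurable0.
  by apply/seteqP; split => q // [].
have tF : trivIset setT F.
  apply/trivIsetP => i j _ _ /eqP ij; apply/seteqP; split => // q [].
  rewrite /F; case Ei: pickle_inv => [t|//]; case Ej: pickle_inv => [t'|//].
  move=> [/= tq _] [/= t'q _]; apply: ij.
  have := @pickle_invK (int * int)%type i; rewrite Ei/= => <-.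
  by have := @pickle_invK (int * int)%type j; rewrite Ej/= => <-; rewrite (cell_inj s0 tq t'q).
have /choice[H hH] : forall n, exists B, [/\ measurable B,
    forall t, pickle_inv n = Some t -> [set u x | x in E `&` [set x | cell s t (v x)]] `<=` B &
    (lam R B <= (L ^+ 2)%:E * lam R (F n))%E].
  move=> n; rewrite /F; case: pickle_inv => [t|]; last first.
    by exists set0; split; rewrite ?measure0 ?mule0.
  have [[x Ex tx]|h] := pselect (exists2 x, E x & cell s t (v x)).
    have [|_ _ [y [Ey ty] <-] [z [Ez tz] <-]|B [mB AB lB]] :=
        @enclosing_square _ [set u x | x in E `&` [set x | cell s t (v x)]] (L * s).
    - by rewrite mulr_ge0// ltW.
    - rewrite (le_trans (uv _ _ Ey Ez))// ler_wpM2l// ltW//.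
      exact: cell_diam ty tz.
    exists B; split=> // [t' [<-]//|].
    rewrite (_ : [set _ | _] = cell s t); last first.
      by apply/seteqP; split => q; [case|split=> //; exists x].
    by rewrite lam_cell// -EFinM -exprMn.
  exists set0; split; rewrite ?measure0 ?mule_ge0 ?lee_fin ?sqr_ge0//.
  by move=> t' [tt'] q [x [Ex tx] _]; case: h; exists x => //; rewrite tt'.
have uH : u @` E `<=` \bigcup_n H n.
  move=> _ [x Ex <-]; have [t tx] := cell_cover (v x) s0.
  exists (pickle t) => //; have [_ + _] := hH (pickle t).
  by apply; [exact: pickleK_inv|exists x].
have FV : \bigcup_n F n `<=` V.
  move=> q [n _]; rewrite /F; case: pickle_inv => [t|//] [tq [x Ex tx]].
  apply: (VE (v x)); first by exists x.
  exact: lt_trans (cell_diam s0 tq tx) sd.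
have mH n : measurable (H n) by have [] := hH n.
apply: (@le_trans _ _ (\sum_(0 <= n <oo) lam R (H n))%E).
  exact: measure_sigma_subadditive.
apply: (@le_trans _ _ (\sum_(0 <= n <oo) (L ^+ 2)%:E * lam R (F n))%E).
  by apply: lee_nneseries => // n _; have [] := hH n.
rewrite nneseriesZl//.
have -> : (\sum_(0 <= n <oo) lam R (F n) = lam R (\bigcup_n F n))%E.
  rewrite measure_bigcup//; apply: eq_eseriesl => n; by rewrite in_setT.
apply: (@le_trans _ _ ((L ^+ 2)%:E * lam R V)%E).
  rewrite lee_wpmul2l ?lee_fin ?sqr_ge0// le_measure ?inE//.
  exact: bigcupT_measurable.
apply: (@le_trans _ _ ((L ^+ 2)%:E * (lam R (v @` E) + eta%:E))%E).
  by rewrite lee_wpmul2l ?lee_fin ?sqr_ge0.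
rewrite ge0_muleDr//; last by rewrite lee_fin ltW.
rewrite leeD2l// -EFinM lee_fin /eta mulrA ler_pdivrMr// mulrC.
by rewrite ler_pM2l// lerDl.
Qed.

(** The finite unions of the compact pieces of [E] increase to [E]. *)
Lemma lam_lipschitz E (u v : plane R -> plane R) (L : R) :
  0 <= L -> sigma_compact E ->
  {within E, continuous u} -> {within E, continuous v} ->
  (forall p q, E p -> E q -> `|u p - u q| <= L * `|v p - v q|) ->
  (lam R (u @` E) <= (L ^+ 2)%:E * lam R (v @` E))%E.
Proof.
move=> L0 [K [cK EK]] cu cv uv.
pose K' n := \big[setU/set0]_(i < n.+1) K i.
have cK' n : compact (K' n) by apply: bigsetU_compact.
have EK' : E = \bigcup_n K' n by rewrite EK bigcup_bigsetU_bigcup.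
have K'E n : K' n `<=` E by rewrite EK'; exact: bigcup_sup.
have cim (f : plane R -> plane R) n : {within E, continuous f} -> compact (f @` K' n).
  by move=> cf; apply: continuous_compact (cK' n); exact: continuous_subspaceW cf.
have K'd : {homo (fun n => u @` K' n) : n m / (n <= m)%N >-> (n <= m)%O}.
  move=> n m nm; apply/subsetPset; apply: image_subset.
  by apply: subset_bigsetU.
have mv : measurable (v @` E).
  by apply: sigma_compact_measurable; apply: sigma_compact_image => //; exists K.
have muK n : measurable (u @` K' n) by apply: compact_measurable2; exact: cim.
have -> : u @` E = \bigcup_n (u @` K' n) by rewrite {1}EK' image_bigcup.
have := nondecreasing_cvg_mu (mu := lam R) muK (bigcupT_measurable _ muK) K'd.
move=> /cvg_lim <-//; apply: lime_le.
  apply: ereal_nondecreasing_is_cvgn => n m nm; apply: le_measure; rewrite ?inE//.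
  exact/subsetPset/K'd.
apply: nearW => n /=.
have uvK p q : K' n p -> K' n q -> `|u p - u q| <= L * `|v p - v q|.
  by move=> Kp Kq; apply: uv; apply: (K'E n).
apply: le_trans (lam_lipschitz_compact L0 (muK n) (cim _ n cv) uvK) _.
rewrite lee_wpmul2l ?lee_fin ?sqr_ge0// le_measure ?inE//.
  by apply: compact_measurable2; exact: cim.
exact: image_subset.
Qed.

End lipschitz.

(** * Differentiable maps and sets where they are nearly linear *)

Lemma subrACA (V : zmodType) (a b c d : V) : a - b - (c - d) = (a - c) - (b - d).
Proof. by rewrite opprD addrACA -opprD. Qed.

Section pieces.
Context {R : realType}.
Implicit Types (B E U : set (plane R)) (p q z h : plane R) (f u : plane R -> plane R).

(** Pairs of rows rather than ['M[R]_2], so that determinants, products and images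
of points are ring expressions in the entries. *)
Definition mat : Type := ((R * R) * (R * R))%type.
Implicit Types A S : mat.

Definition linm A := lin A.1.1 A.1.2 A.2.1 A.2.2.
Definition detm A := A.1.1 * A.2.2 - A.1.2 * A.2.1.
Definition normm A := `|A.1.1| + `|A.1.2| + `|A.2.1| + `|A.2.2|.

Lemma normm_ge0 A : 0 <= normm A.
Proof. by rewrite !addr_ge0. Qed.

Lemma linmB A p q : linm A (p - q) = linm A p - linm A q.
Proof. by rewrite /linm /lin; congr pair => /=; ring. Qed.

Lemma plane_norm1 p : `|p.1| <= `|p|.
Proof. by have := lexx `|p|; rewrite plane_norm_le => /andP[]. Qed.

Lemma plane_norm2 p : `|p.2| <= `|p|.
Proof. by have := lexx `|p|; rewrite plane_norm_le => /andP[]. Qed.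

(** [normm A] is a crude bound for the operator norm. *)
Lemma linm_norm A p : `|linm A p| <= normm A * `|p|.
Proof.
have h1 := plane_norm1 p; have h2 := plane_norm2 p.
rewrite plane_norm_le /linm /lin /normm/=; apply/andP; split;
  rewrite (le_trans (ler_normD _ _))// !normrM !mulrDl.
  have := ler_wpM2l (normr_ge0 A.1.1) h1; have := ler_wpM2l (normr_ge0 A.1.2) h2.
  have := mulr_ge0 (normr_ge0 A.2.1) (normr_ge0 p).
  have := mulr_ge0 (normr_ge0 A.2.2) (normr_ge0 p); lra.
have := ler_wpM2l (normr_ge0 A.2.1) h1; have := ler_wpM2l (normr_ge0 A.2.2) h2.
have := mulr_ge0 (normr_ge0 A.1.1) (normr_ge0 p).
have := mulr_ge0 (normr_ge0 A.1.2) (normr_ge0 p); lra.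
Qed.

Definition has_diff f z A := forall e, 0 < e -> exists2 d, 0 < d &
  forall q, `|q - z| < d -> `|f q - f z - linm A (q - z)| <= e * `|q - z|.

Lemma has_diff_continuous f z A : has_diff f z A -> forall e, 0 < e ->
  exists2 d, 0 < d & forall q, `|q - z| < d -> `|f q - f z| < e.
Proof.
move=> /(_ 1 ltr01)[d d0 fd] e e0.
have M0 : 0 < 1 + normm A by rewrite ltr_pwDl// normm_ge0.
exists (Num.min d (e / (1 + normm A))); first by rewrite lt_min d0 divr_gt0.
move=> q; rewrite lt_min => /andP[qd qe].
have -> : f q - f z = (f q - f z - linm A (q - z)) + linm A (q - z) by rewrite subrK.
rewrite (le_lt_trans (ler_normD _ _))//.
rewrite (le_lt_trans (lerD (fd q qd) (linm_norm A (q - z))))//.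
by rewrite -mulrDl mulrC -ltr_pdivlMr.
Qed.

Definition cont_on U f := forall z, U z -> forall e, 0 < e ->
  exists2 d, 0 < d & forall q, `|q - z| < d -> `|f q - f z| < e.

Lemma cont_on_within U E f : E `<=` U -> cont_on U f -> {within E, continuous f}.
Proof.
move=> EU cf; apply/subspace_continuousP => z Ez; apply/cvgrPdist_lt => e e0.
have [d d0 fd] := cf z (EU _ Ez) e e0.
rewrite /within/=; apply/nbhs_ballP; exists d => // q.
rewrite -ball_normE /ball_/= -normrN opprB => /fd.
by rewrite -normrN opprB.
Qed.

Lemma cont_on_lin U f S : cont_on U f -> cont_on U (fun p => linm S (f p)).
Proof.
move=> cf z Uz e e0; have M0 : 0 < normm S + 1 by rewrite ltr_wpDl// normm_ge0.
have [d d0 fd] := cf z Uz (e / (normm S + 1)) (divr_gt0 e0 M0).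
exists d => // q /fd; rewrite ltr_pdivlMr// -linmB => h.
rewrite (le_lt_trans (linm_norm _ _))//; apply: le_lt_trans h.
by rewrite mulrC ler_wpM2l// lerDl.
Qed.

Lemma cont_onB U f u : cont_on U f -> cont_on U u -> cont_on U (fun p => f p - u p).
Proof.
move=> cf cu z Uz e e0.
have [d d0 fd] := cf z Uz _ (divr_gt0 e0 (ltr0n _ 2)).
have [d' d'0 ud] := cu z Uz _ (divr_gt0 e0 (ltr0n _ 2)).
exists (Num.min d d'); first by rewrite lt_min d0.
move=> q; rewrite lt_min => /andP[qd qd'].
rewrite subrACA.
rewrite (le_lt_trans (ler_normB _ _))// [ltRHS]splitr ltrD//; [exact: fd|exact: ud].
Qed.

Lemma cont_on_id U : cont_on U id.
Proof. by move=> z _ e e0; exists e. Qed.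

Lemma has_diff_cont U f (A : plane R -> mat) :
  (forall z, U z -> has_diff f z (A z)) -> cont_on U f.
Proof. by move=> fA z /fA /has_diff_continuous. Qed.

(** Pieces of an open domain [U] are defined by non-strict inequalities, so they
are closed in [U] but not in the plane. *)
Definition rel_closed U E := E `<=` U /\ open (U `\` E).

Lemma rel_closed0 U : open U -> rel_closed U set0.
Proof. by split; rewrite ?setD0. Qed.

Lemma rel_closed_preimage U f B : open U -> cont_on U f -> closed B ->
  rel_closed U (U `&` f @^-1` B).
Proof.
move=> /plane_openP oU cf cB; split; first exact: subIsetl.
apply/plane_openP => p [Up nBp].
have /plane_openP/(_ (f p))[|e e0 eB] : open (~` B) by exact: closed_openC.
  by move=> Bp; apply: nBp.
have [d d0 dU] := oU p Up; have [d' d'0 d'e] := cf p Up e e0.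
exists (Num.min d d'); first by rewrite lt_min d0.
move=> q; rewrite lt_min => /andP[qd qd']; split; first exact: dU.
by move=> [_ Bq]; apply: (eB (f q)) Bq; exact: d'e.
Qed.

Lemma sigma_compact_rel U (F : nat -> set (plane R)) n E : open U ->
  (forall i, rel_closed U (F i)) -> rel_closed U E ->
  sigma_compact (seqDU F n `&` E).
Proof.
move=> oU rF rE.
have rel_cl G : rel_closed U G -> G = U `&` ~` (U `\` G).
  move=> [GU _]; apply/seteqP; split=> [p Gp|p [Up h]].
    by split; [exact: GU|move=> []].
  by apply: contrapT => nG; apply: h.
have clo G : rel_closed U G -> sigma_compact (~` (U `\` G)).
  by move=> [_ oG]; apply: closed_sigma_compact; exact: open_closedC.
have -> : seqDU F n `&` E = (U `&` \bigcap_(i in `I_n) (U `\` F i)) `&`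
    (~` (U `\` F n) `&` ~` (U `\` E)).
  rewrite /seqDU -bigcup_mkord; apply/seteqP; split => p.
    move=> [[Fp nFp] Ep]; split; [split|split].
    - exact: (rE.1).
    - by move=> i ni; split; [exact: (rE.1)|move=> Fi; apply: nFp; exists i].
    - by move=> [].
    - by move=> [].
  move=> [[Up hp] [hF hE]]; split.
    split; first by apply: contrapT => nF; apply: hF.
    by move=> [i ni Fi]; have [_] := hp i ni; apply.
  by apply: contrapT => nE; apply: hE.
apply: sigma_compactI; last by apply: sigma_compactI; exact: clo.
apply: sigma_compactI; first exact: open_sigma_compact.
apply: open_sigma_compact; elim: n => [|n IHn].
  by rewrite II0 bigcap_set0; exact: openT.
rewrite IIS bigcap_setU bigcap_set1; apply: openI => //; exact: (rF n).2.
Qed.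

(** Points near the centre [z] at which [u] has local Lipschitz constant [e] at
scale [1 / k.+1].  Two of them are closer than [1 / k.+1], which is what the
radius of a third of it is for; so [u] is [e]-Lipschitz on this set, which is
also relatively closed. *)
Definition lip_points U u (e : R) (k : nat) z : set (plane R) :=
  [set p | [/\ U p, `|p - z| <= k.+1%:R^-1 / 3 &
    forall q, U q -> `|q - p| < k.+1%:R^-1 -> `|u q - u p| <= e * `|q - p|]].

Lemma lip_pointsP U u e k z p q : lip_points U u e k z p -> lip_points U u e k z q ->
  `|u p - u q| <= e * `|p - q|.
Proof.
move=> [Up pz _] [_ qz h]; apply: h => //.
have -> : p - q = (p - z) - (q - z) by rewrite opprB addrA subrK.
rewrite (le_lt_trans (ler_normB _ _))// (le_lt_trans (lerD pz qz))//.
by move: (@natinv_gt0 R k); set r := k.+1%:R^-1 => r0; lra.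
Qed.

Lemma rel_closed_lip_points U u e k z : 0 <= e -> open U -> cont_on U u ->
  rel_closed U (lip_points U u e k z).
Proof.
move=> e0 /plane_openP oU cu; split => [p []//|].
apply/plane_openP => p [Up np].
have [d d0 dU] := oU p Up.
have [pz|pz] := ltP (k.+1%:R^-1 / 3) `|p - z|.
  exists (Num.min d (`|p - z| - k.+1%:R^-1 / 3)); first by rewrite lt_min d0 subr_gt0.
  move=> q; rewrite lt_min => /andP[qd qp]; split; first exact: dU.
  move=> [_ qz _].
  have : `|p - z| <= `|q - p| + `|q - z|.
    have -> : p - z = (q - z) - (q - p).
      by rewrite opprB [RHS]addrC addrA subrK.
    by rewrite [leRHS]addrC ler_normB.
  by move: qz qp; set r := k.+1%:R^-1 => qz qp; lra.
have [q [Uq qp uqp]] : exists q, [/\ U q, `|q - p| < k.+1%:R^-1 &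
    e * `|q - p| < `|u q - u p|].
  apply: contrapT => h; apply: np; split => // q Uq qp.
  by rewrite leNgt; apply/negP => uqp; apply: h; exists q.
set gap := `|u q - u p| - e * `|q - p|.
have gap0 : 0 < gap by rewrite subr_gt0.
have [d' d'0 d'u] := cu p Up _ (divr_gt0 gap0 (ltr0n _ 2)).
have e1 : 0 < e + 1 by rewrite ltr_wpDl.
exists (Num.min (Num.min d d') (Num.min (k.+1%:R^-1 - `|q - p|) (gap / 2 / (e + 1)))).
  by rewrite !lt_min d0 d'0 subr_gt0 qp !divr_gt0.
move=> r; rewrite !lt_min => /andP[/andP[rd rd'] /andP[rk rg]].
split; first exact: dU.
move=> [_ _ /(_ q Uq)].
have tri : `|q - r| <= `|q - p| + `|r - p|.
  have -> : q - r = (q - p) - (r - p) by rewrite opprB addrA subrK.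
  exact: ler_normB.
have -> : `|q - r| < k.+1%:R^-1 by move: rk; set s := k.+1%:R^-1 => rk; lra.
move=> /(_ isT); apply/negP; rewrite -ltNge.
have ur := d'u r rd'.
have utri : `|u q - u p| <= `|u q - u r| + `|u r - u p|.
  have -> : u q - u p = (u q - u r) + (u r - u p) by rewrite addrA subrK.
  exact: ler_normD.
have h1 : e * `|q - r| <= e * `|q - p| + e * `|r - p|.
  by rewrite -mulrDr ler_wpM2l.
have h2 : e * `|r - p| < gap / 2.
  move: rg; rewrite ltr_pdivlMr// mulrDr mulr1 [_ * e]mulrC.
  by have := normr_ge0 (r - p); lra.
by rewrite /gap in h2 ur *; lra.
Qed.

Lemma lip_points_mem U u e d p : U p -> 0 < d ->
  (forall q, `|q - p| < d -> `|u q - u p| <= e * `|q - p|) ->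
  exists k t, lip_points U u e k (ratpt t) p.
Proof.
move=> Up d0 ud; have [k kd] := natinv_lt d0.
have [t pt] := @ratpt_near R p (k.+1%:R^-1 / 3) (divr_gt0 (natinv_gt0 k) (ltr0n _ 3)).
exists k, t; split => //; first exact: ltW.
by move=> q _ qp; apply: ud; exact: lt_trans kd.
Qed.

End pieces.

(** * Determinants on nearly linear pieces *)

Section area_pieces.
Context {R : realType}.
Implicit Types (B E U : set (plane R)) (p q z h : plane R) (f u : plane R -> plane R).
Implicit Types A S : @mat R.

Definition mulm S A : @mat R :=
  ((S.1.1 * A.1.1 + S.1.2 * A.2.1, S.1.1 * A.1.2 + S.1.2 * A.2.2),
   (S.2.1 * A.1.1 + S.2.2 * A.2.1, S.2.1 * A.1.2 + S.2.2 * A.2.2)).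

Lemma detm_mul S A : detm (mulm S A) = detm S * detm A.
Proof. by rewrite /detm /mulm/=; ring. Qed.

Lemma linmM S A p : linm (mulm S A) p = linm S (linm A p).
Proof. by rewrite /linm /lin /mulm/=; congr pair; ring. Qed.

Lemma linmZ A (t : R) p : linm A (t *: p) = t *: linm A p.
Proof. by rewrite /linm /lin /=; congr pair; rewrite /= /GRing.scale/=; ring. Qed.

Lemma linm_inj S : detm S != 0 -> injective (linm S).
Proof.
move=> D0 [a b] [a' b'] [] /= h1 h2; congr pair; apply: (mulfI D0); rewrite /detm.
  transitivity (S.2.2 * (S.1.1 * a + S.1.2 * b) - S.1.2 * (S.2.1 * a + S.2.2 * b)).
    by ring.
  by rewrite h1 h2; ring.
transitivity (S.1.1 * (S.2.1 * a + S.2.2 * b) - S.2.1 * (S.1.1 * a + S.1.2 * b)).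
  by ring.
by rewrite h1 h2; ring.
Qed.

(** At the two basis vectors the hypothesis bounds all entries of [A - 1] by
[e], and so [det A - 1] by [2 * e + 2 * e ^ 2]. *)
Lemma det_near_id A (e : R) : 0 <= e <= 8^-1 ->
  (forall h, `|linm A h - h| <= e * `|h|) -> `|detm A - 1| <= 3 * e.
Proof.
move=> e8 Ae; have nrm (x y : R) : `|x| = 1 -> `|y| = 0 -> `|((x, y) : plane R)| = 1.
  move=> x1 y0; transitivity (Num.max `|x| `|y|); first by [].
  by rewrite x1 y0; apply/max_idPl; exact: ler01.
have nrm' (x y : R) : `|x| = 0 -> `|y| = 1 -> `|((x, y) : plane R)| = 1.
  move=> x1 y0; transitivity (Num.max `|x| `|y|); first by [].
  by rewrite x1 y0; apply/max_idPr; exact: ler01.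
have := Ae (1, 0); rewrite (nrm 1 0) ?normr1 ?normr0// mulr1 plane_norm_le/= => /andP[].
have := Ae (0, 1); rewrite (nrm' 0 1) ?normr1 ?normr0// mulr1 plane_norm_le/= => /andP[].
rewrite /linm /lin/= !mulr1 !mulr0 !addr0 !add0r !subr0 => h1 h2 h3 h4.
have -> : detm A - 1 = (A.1.1 - 1) * (A.2.2 - 1) + (A.1.1 - 1) + (A.2.2 - 1) - A.1.2 * A.2.1.
  by rewrite /detm; ring.
rewrite (le_trans (ler_normB _ _))//.
have := ler_pM (normr_ge0 _) (normr_ge0 _) h1 h4.
have := ler_pM (normr_ge0 _) (normr_ge0 _) h3 h2.
have := ler_normD ((A.1.1 - 1) * (A.2.2 - 1) + (A.1.1 - 1)) (A.2.2 - 1).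
have := ler_normD ((A.1.1 - 1) * (A.2.2 - 1)) (A.1.1 - 1).
rewrite !normrM; move: h1 h2 h3 h4 e8.
set x1 := `|A.1.1 - 1|; set x2 := `|A.2.2 - 1|; set x3 := `|A.1.2|; set x4 := `|A.2.1|.
by move=> ? ? ? ? /andP[? ?] ? ? ? ?; nra.
Qed.

(** The difference quotients of [linm S \o f - id] at [p] in the direction [h]
tend to [linm (mulm S A) h - h], so they pass their Lipschitz bound on to it.
This is why the Jacobian of [f] is almost constant on a piece. *)
Lemma lip_points_diff U f S A (e : R) k z p : open U -> has_diff f p A ->
  lip_points U (fun q => linm S (f q) - q) e k z p ->
  forall h, `|linm (mulm S A) h - h| <= e * `|h|.
Proof.
move=> /plane_openP oU fA [Up _ lip] h; apply/ler_addgt0Pr => eta eta0.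
have M0 : 0 < normm S * `|h| + 1 by rewrite ltr_wpDl// mulr_ge0// normm_ge0.
have [d d0 fd] := fA _ (divr_gt0 eta0 M0).
have [d' d'0 dU] := oU p Up.
have h1 : 0 < `|h| + 1 by rewrite ltr_wpDl.
pose m := Num.min (Num.min d d') k.+1%:R^-1.
have m0 : 0 < m by rewrite !lt_min d0 d'0 natinv_gt0.
pose t := m / (`|h| + 1); have t0 : 0 < t by rewrite divr_gt0.
pose q := p + t *: h; have qp : q - p = t *: h by rewrite /q addrC addKr.
have nqp : `|q - p| = t * `|h| by rewrite qp normrZ gtr0_norm.
have qpm : `|q - p| < m.
  by rewrite nqp /t mulrAC ltr_pdivrMr// ltr_pM2l// ltrDl.
move: (qpm); rewrite !lt_min => /andP[/andP[qd qd'] qk].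
rewrite -(ler_pM2l t0).
have -> : t * `|linm (mulm S A) h - h| = `|linm S (linm A (q - p)) - (q - p)|.
  by rewrite -linmM qp linmZ -scalerBr normrZ gtr0_norm.
have -> : linm S (linm A (q - p)) - (q - p) =
    (linm S (f q) - q - (linm S (f p) - p)) - linm S (f q - f p - linm A (q - p)).
  rewrite [linm S (_ - linm A _)]linmB [linm S (f q - _)]linmB.
  set a := linm S (linm A _); set b := linm S (f q); set c := linm S (f p).
  by rewrite (subrACA b q c p) (subrACA (b - c) (q - p)) subrr sub0r opprB.
rewrite (le_trans (ler_normB _ _))// mulrDr lerD//.
  by rewrite (le_trans (lip q (dU _ qd') qk))// nqp mulrCA.
rewrite (le_trans (linm_norm _ _))//.
rewrite (le_trans (ler_wpM2l (normm_ge0 _) (fd q qd)))//.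
rewrite nqp; have -> : normm S * (eta / (normm S * `|h| + 1) * (t * `|h|)) =
  t * eta * ((normm S * `|h|) / (normm S * `|h| + 1)).
  by field; rewrite gt_eqF.
apply: ler_piMr; first by rewrite mulr_ge0 ?ltW.
rewrite ler_pdivrMr// mul1r.
by rewrite ltW// ltrDl.
Qed.

Lemma lip_points_bilip U f S (e : R) k z p q :
  lip_points U (fun q => linm S (f q) - q) e k z p ->
  lip_points U (fun q => linm S (f q) - q) e k z q ->
  `|linm S (f p) - linm S (f q)| <= (1 + e) * `|p - q| /\
  (1 - e) * `|p - q| <= `|linm S (f p) - linm S (f q)|.
Proof.
move=> hp hq; have := lip_pointsP hp hq.
rewrite subrACA.
set a := linm S (f p) - _; set b := p - q => h.
have hb : b = a - (a - b) by rewrite opprB addrC subrK.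
have ha : a = (a - b) + b by rewrite subrK.
have h1 : `|b| <= `|a| + `|a - b| by rewrite {1}hb ler_normB.
have h2 : `|a| <= `|a - b| + `|b| by rewrite {1}ha ler_normD.
by split; lra.
Qed.

End area_pieces.

(** * Area on nearly linear pieces *)

Section area_estimate.
Context {R : realType}.
Implicit Types (B E U : set (plane R)) (p q z h : plane R) (f u : plane R -> plane R).
Implicit Types S : @mat R.

Lemma lam_linm S E : S.1.1 != 0 -> detm S != 0 -> measurable (linm S @` E) ->
  lam R (linm S @` E) = (`|detm S|%:E * lam R E)%E.
Proof.
move=> a0 D0 mSE; rewrite (lam_lin a0 D0 mSE); congr (_ * lam R _)%E.
apply/seteqP; split=> [p [q Eq /(linm_inj D0) <-]//|p Ep]; by exists p.
Qed.

Lemma lip_points_det U f S A (e : R) k z p : open U -> has_diff f p A ->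
  0 <= e <= 8^-1 -> lip_points U (fun q => linm S (f q) - q) e k z p ->
  `| `|detm S| * `|detm A| - 1| <= 3 * e.
Proof.
move=> oU fA e8 lip; rewrite -normrM -detm_mul.
have := det_near_id e8 (lip_points_diff oU fA lip).
rewrite !ler_norml => /andP[h1 h2].
rewrite ger0_norm ?h1//; lra.
Qed.

(** On [lip_points] the map [linm S \o f] is bi-Lipschitz with constants [1 - e] and
[1 + e], so it almost preserves area, while [linm S] multiplies areas by
[`|detm S|], which is almost the inverse of the Jacobian determinant of [f]. *)
Lemma piece_area U f (A : plane R -> mat) S (e : R) k z E : open U ->
  (forall z, U z -> has_diff f z (A z)) -> 0 < e <= 8^-1 ->
  S.1.1 != 0 -> detm S != 0 -> sigma_compact E ->
  E `<=` lip_points U (fun q => linm S (f q) - q) e k z ->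
  measurable_fun E (fun z => `|detm (A z)|) ->
  (\int[lam R]_(z in E) `|detm (A z)|%:E <= (1 + 10 * e)%:E * lam R (f @` E))%E /\
  (lam R (f @` E) <= (1 + 10 * e)%:E * \int[lam R]_(z in E) `|detm (A z)|%:E)%E.
Proof.
move=> oU fA /andP[e0 e8] a0 D0 cE El mJ.
have EU : E `<=` U by move=> p /El[].
have cf := has_diff_cont fA.
have cfE := cont_on_within EU cf.
have cSfE : {within E, continuous (fun p => linm S (f p))}.
  by apply: cont_on_within EU _; exact: cont_on_lin.
have cid : {within E, continuous (fun p : plane R => p)}.
  by apply: cont_on_within EU _; exact: cont_on_id.
have mE := sigma_compact_measurable cE.
have mfE := sigma_compact_measurable (sigma_compact_image cfE cE).
have SfE : linm S @` (f @` E) = (fun p => linm S (f p)) @` E.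
  by rewrite image_comp.
have mSfE : measurable (linm S @` (f @` E)).
  by rewrite SfE; exact: sigma_compact_measurable (sigma_compact_image cSfE cE).
pose D := `|detm S|; have Dgt0 : 0 < D by rewrite normr_gt0.
have lSf : lam R (linm S @` (f @` E)) = (D%:E * lam R (f @` E))%E by exact: lam_linm.
have up : (D%:E * lam R (f @` E) <= ((1 + e) ^+ 2)%:E * lam R E)%E.
  rewrite -lSf SfE.
  have -> : lam R E = lam R ((fun p => p) @` E) by rewrite image_id.
  apply: lam_lipschitz cE cSfE cid _; first by lra.
  by move=> p q Ep Eq; have [] := lip_points_bilip (El _ Ep) (El _ Eq).
have e1 : 0 < 1 - e by lra.
have lo : (lam R E <= (((1 - e)^-1) ^+ 2)%:E * (D%:E * lam R (f @` E)))%E.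
  rewrite -lSf SfE.
  have -> : lam R E = lam R ((fun p => p) @` E) by rewrite image_id.
  apply: lam_lipschitz cE cid cSfE _; first by rewrite invr_ge0 ltW.
  move=> p q Ep Eq; have [_ h] := lip_points_bilip (El _ Ep) (El _ Eq).
  by rewrite mulrC ler_pdivlMr// mulrC.
have Jb p : E p -> (1 - 3 * e) / D <= `|detm (A p)| <= (1 + 3 * e) / D.
  move=> Ep; have ee : 0 <= e <= 8^-1 by rewrite ltW.
  have := lip_points_det oU (fA _ (EU _ Ep)) ee (El _ Ep).
  rewrite ler_norml ler_pdivrMr// ler_pdivlMr// -/D [_ * D]mulrC.
  by move: (D * _) => w; lra.
have Iup : (\int[lam R]_(z in E) `|detm (A z)|%:E <= ((1 + 3 * e) / D)%:E * lam R E)%E.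
  rewrite -integral_cst//; apply: ge0_le_integral => //.
  - exact/measurable_EFinP.
  - by move=> p Ep; rewrite lee_fin; have /andP[] := Jb p Ep.
have Ilo : (((1 - 3 * e) / D)%:E * lam R E <= \int[lam R]_(z in E) `|detm (A z)|%:E)%E.
  rewrite -integral_cst//; apply: ge0_le_integral => //.
  - by move=> p _; rewrite lee_fin divr_ge0 ?ltW//; lra.
  - exact/measurable_EFinP.
  - by move=> p Ep; rewrite lee_fin; have /andP[] := Jb p Ep.
(* [10] makes [(1 + 3 * e) / (1 - e) ^ 2] at most [1 + 10 * e], and [(1 + e) ^ 2]
   at most [(1 + 10 * e) * (1 - 3 * e)], for [e] up to [8^-1]. *)
split.
  apply: le_trans Iup _; apply: le_trans (lee_wpmul2l _ lo) _.
    by rewrite lee_fin divr_ge0 ?ltW//; lra.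
  rewrite !muleA -!EFinM lee_wpmul2r// lee_fin.
  have -> : (1 + 3 * e) / D * (1 - e)^-1 ^+ 2 * D = (1 + 3 * e) / (1 - e) ^+ 2.
    by field; rewrite !gt_eqF.
  by rewrite ler_pdivrMr ?exprn_gt0//; nra.
have -> : lam R (f @` E) = (D^-1%:E * (D%:E * lam R (f @` E)))%E.
  by rewrite muleA -EFinM mulVf ?gt_eqF// mul1e.
apply: le_trans (lee_wpmul2l _ up) _; first by rewrite lee_fin invr_ge0 ltW.
apply: le_trans (lee_wpmul2l _ Ilo); last by rewrite lee_fin; lra.
rewrite !muleA -!EFinM lee_wpmul2r// lee_fin.
have -> : (1 + 10 * e) * ((1 - 3 * e) / D) = D^-1 * ((1 + 10 * e) * (1 - 3 * e)).
  by field; rewrite gt_eqF.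
by rewrite ler_pM2l ?invr_gt0//; nra.
Qed.

(** The rational matrices used below need a nonzero corner entry for
[lam_lin]. *)
Lemma ratr_near_neq0 (a e : R) : 0 < e ->
  exists q : rat, `|ratr q - a| < e /\ ratr q != 0 :> R.
Proof.
move=> e0; have [a0|a0] := leP 0 a.
  have [|q] := @rat_in_itvoo R a (a + e); first by lra.
  rewrite in_itv/= => /andP[h1 h2]; exists q; split.
    by rewrite ltr_norml; lra.
  by rewrite gt_eqF// (le_lt_trans a0).
have [|q] := @rat_in_itvoo R (Num.max a (a - e)) (Num.min 0 (a + e)).
  rewrite gt_max !lt_min; lra.
rewrite in_itv/= gt_max lt_min => /andP[/andP[h1 h1'] /andP[h2 h3]]; exists q; split.
  by rewrite ltr_norml; lra.
by rewrite lt_eqF.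
Qed.

Definition ratm (s : (rat * rat) * (rat * rat)) : @mat R :=
  ((ratr s.1.1, ratr s.1.2), (ratr s.2.1, ratr s.2.2)).

Lemma ratm_near S (e : R) : 0 < e -> exists s, (ratm s).1.1 != 0 /\
  forall p, `|linm (ratm s) p - linm S p| <= e * `|p|.
Proof.
move=> e0; have e2 : 0 < e / 2 by rewrite divr_gt0.
have [a [ha a0]] := ratr_near_neq0 S.1.1 e2; have [b hb] := ratr_near S.1.2 e2.
have [c hc] := ratr_near S.2.1 e2; have [d hd] := ratr_near S.2.2 e2.
exists ((a, b), (c, d)); split=> // p.
have h (x y x' y' : R) : `|x - x'| < e / 2 -> `|y - y'| < e / 2 ->
    `|x * p.1 + y * p.2 - (x' * p.1 + y' * p.2)| <= e * `|p|.
  move=> hx hy.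
  have -> : x * p.1 + y * p.2 - (x' * p.1 + y' * p.2) = (x - x') * p.1 + (y - y') * p.2.
    by ring.
  have eh : e * `|p| = e / 2 * `|p| + e / 2 * `|p| by rewrite -mulrDl -splitr.
  rewrite (le_trans (ler_normD _ _))// eh !normrM lerD//.
    by rewrite ler_pM// ?plane_norm1// ltW.
  by rewrite ler_pM// ?plane_norm2// ltW.
by rewrite plane_norm_le /linm /lin/= !h.
Qed.

(** If [S] is close enough to the inverse of [A], then [linm S \o f - id] has a
small differential at [z].  Taking [S] and the centre rational leaves countably
many pieces. *)
Lemma lip_points_cover U f A (e : R) z : U z -> has_diff f z A -> detm A != 0 ->
  0 < e <= 8^-1 -> open U -> exists s k t, [/\ (ratm s).1.1 != 0, detm (ratm s) != 0 &
    lip_points U (fun q => linm (ratm s) (f q) - q) e k (ratpt t) z].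
Proof.
move=> Uz fA D0 /andP[e0 e8] oU.
pose B : @mat R := ((A.2.2 / detm A, - A.1.2 / detm A), (- A.2.1 / detm A, A.1.1 / detm A)).
have BA p : linm B (linm A p) = p.
  move: D0; rewrite /B /linm /lin /detm/= => D0; rewrite [RHS]surjective_pairing.
  by congr pair; field.
have M0 : 0 < normm A + 1 by rewrite ltr_wpDl// normm_ge0.
have [s [s0 hs]] := ratm_near B (divr_gt0 (divr_gt0 e0 (ltr0n _ 2)) M0).
have N0 : 0 < normm (ratm s) + 1 by rewrite ltr_wpDl// normm_ge0.
have [d d0 fd] := fA _ (divr_gt0 (divr_gt0 e0 (ltr0n _ 2)) N0).
have [k [t lip]] : exists k t,
    lip_points U (fun q => linm (ratm s) (f q) - q) e k (ratpt t) z.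
  apply: (lip_points_mem Uz d0) => q qd.
  rewrite subrACA -linmB.
  have -> : linm (ratm s) (f q - f z) - (q - z) =
      linm (ratm s) (f q - f z - linm A (q - z)) +
      (linm (ratm s) (linm A (q - z)) - linm B (linm A (q - z))).
    by rewrite BA [X in _ = X + _]linmB addrA subrK.
  have eh : e * `|q - z| = e / 2 * `|q - z| + e / 2 * `|q - z|.
    by rewrite -mulrDl -splitr.
  rewrite (le_trans (ler_normD _ _))// eh lerD//.
    rewrite (le_trans (linm_norm _ _))//.
    rewrite (le_trans (ler_wpM2l (normm_ge0 _) (fd q qd)))// mulrA ler_wpM2r//.
    rewrite mulrA ler_pdivrMr// mulrC ler_pM2l ?divr_gt0//.
    by rewrite lerDl.
  rewrite (le_trans (hs _))//.
  rewrite (le_trans (ler_wpM2l _ (linm_norm _ _)))//.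
    by rewrite !divr_ge0// ltW.
  rewrite mulrA ler_wpM2r// mulrAC ler_pdivrMr// ler_pM2l ?divr_gt0//.
  by rewrite lerDl.
exists s, k, t; split => //.
have ee : 0 <= e <= 8^-1 by rewrite ltW.
have := lip_points_det oU fA ee lip.
apply: contraTneq => ->; rewrite normr0 mul0r sub0r normrN normr1 -ltNge; lra.
Qed.

Lemma area_pieces U f (A : plane R -> mat) (e : R) : open U ->
  (forall z, U z -> has_diff f z (A z)) -> 0 < e <= 8^-1 ->
  measurable_fun U (fun z => `|detm (A z)|) ->
  exists F : nat -> set (plane R), [/\ forall n, rel_closed U (F n),
    \bigcup_n F n = [set z | U z /\ detm (A z) != 0],
    forall n p q, F n p -> F n q -> f p = f q -> p = q &
    forall n E, sigma_compact E -> E `<=` F n ->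
    (\int[lam R]_(z in E) `|detm (A z)|%:E <= (1 + 10 * e)%:E * lam R (f @` E))%E /\
    (lam R (f @` E) <= (1 + 10 * e)%:E * \int[lam R]_(z in E) `|detm (A z)|%:E)%E].
Proof.
move=> oU fA e8 mJ; have /andP[e0 _] := e8.
pose G (s : rat * rat * (rat * rat)) k t :=
  lip_points U (fun q => linm (ratm s) (f q) - q) e k (ratpt t).
pose ok s := ((ratm s).1.1 != 0) && (detm (ratm s) != 0).
pose F n := if pickle_inv n is Some (s, k, t) then
  (if ok s then G s k t else set0) else set0.
have rF n : rel_closed U (F n).
  rewrite /F; case: pickle_inv => [[[s k] t]|]; last exact: rel_closed0.
  case: ifP => _; last exact: rel_closed0.
  apply: rel_closed_lip_points => //; first exact: ltW.
  apply: cont_onB; last exact: cont_on_id.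
  by apply: cont_on_lin; exact: has_diff_cont fA.
exists F; split => //.
- apply/seteqP; split => [p [n _]|p [Up D0]].
    rewrite /F; case: pickle_inv => [[[s k] t]|//]; case: ifP => // _ Gp.
    have Up : U p by case: Gp.
    split => //; have ee : 0 <= e <= 8^-1 by lra.
    have := lip_points_det oU (fA p Up) ee Gp.
    by apply: contraTneq => ->; rewrite normr0 mulr0 sub0r normrN normr1 -ltNge; lra.
  have [s [k [t [s0 sD Gp]]]] := lip_points_cover Up (fA p Up) D0 e8 oU.
  exists (pickle (s, k, t)); first exact: I.
  by rewrite /F pickleK_inv /ok s0 sD.
- move=> n p q; rewrite /F; case: pickle_inv => [[[s k] t]|//]; case: ifP => // _ Gp Gq fpq.
  have [_] := lip_points_bilip Gp Gq; rewrite fpq subrr normr0 pmulr_rle0; last by lra.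
  by rewrite normr_le0 subr_eq0 => /eqP.
- move=> n E cE; rewrite /F; case: pickle_inv => [[[s k] t]|]; last first.
    by rewrite subset0 => ->; rewrite image_set0 integral_set0 measure0 mule0.
  case: ifP => [/andP[s0 sD]|_]; last first.
    by rewrite subset0 => ->; rewrite image_set0 integral_set0 measure0 mule0.
  move=> EG; apply: (piece_area oU fA e8 s0 sD cE EG).
  by apply: measurable_funS mJ => [|p /EG[]//]; exact: open_measurable2.
Qed.

End area_estimate.

(** * Counting preimages over closed sets, and critical values *)

Section area_formula.
Context {R : realType}.
Implicit Types (B E U : set (plane R)) (p q z w : plane R) (f u : plane R -> plane R).

Lemma plane_measurable_set1 w : measurable [set w].
Proof.
apply: closed_measurable2; apply: accessible_closed_set1.
by apply: hausdorff_accessible; exact: plane_hausdorff.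
Qed.

(** Each disjoint piece contains at most one point of the fibre. *)
Lemma counting_fiber (F : nat -> set (plane R)) f w :
  (forall n p q, F n p -> F n q -> f p = f q -> p = q) ->
  counting ([set p | (\bigcup_n F n) p /\ f p = w]) =
  (\sum_(0 <= n <oo) (\1_(f @` seqDU F n) w)%:E)%E :> \bar R.
Proof.
move=> injF; pose D := seqDU F; pose G n := [set p | D n p /\ f p = w].
have DF n : D n `<=` F n by apply: subDsetl.
have -> : [set p | (\bigcup_n F n) p /\ f p = w] = \bigcup_n G n.
  rewrite seqDU_bigcup_eq; apply/seteqP; split => [p [[n _ Dp] pw]|p [n _ [Dp pw]]].
    by exists n.
  by split => //; exists n.
have G1 n : G n = set0 \/ exists p, G n = [set p].
  have [->|/set0P[p [Dp pw]]] := eqVneq (G n) set0; first by left.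
  right; exists p; apply/seteqP; split => [q [Dq qw]|_ ->//].
  by apply: (injF n); [exact: DF|exact: DF|rewrite pw].
have mG n : measurable (G n).
  have [->|[p ->]] := G1 n; [exact: measurable0|exact: plane_measurable_set1].
have tG : trivIset setT G by apply: trivIset_setIr; exact: trivIset_seqDU.
rewrite (measure_bigcup (@counting (plane R) R))//.
rewrite (eq_eseriesl (Q := xpredT)); last by move=> n; rewrite in_setT.
apply: eq_eseriesr => n _; rewrite indicE.
have [G0|[p Gp]] := G1 n.
  rewrite G0 measure0 memNset// => -[p Dp pw].
  by have : G n p by []; rewrite G0.
rewrite Gp -[LHS]/(counting [set p]) /counting asboolT ?finite_set1//.
rewrite fset_set1 finmap.cardfs1 mem_set//.
have [Dp pw] : G n p by rewrite Gp.
by exists p.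
Qed.

Lemma sigma_compact_seqDU U (F : nat -> set (plane R)) n : open U ->
  (forall i, rel_closed U (F i)) -> sigma_compact (seqDU F n).
Proof.
move=> oU rF; have FU : seqDU F n `<=` U.
  by have [FU _] := rF n; apply: subset_trans FU; exact: subDsetl.
rewrite -(setIidl FU); apply: (sigma_compact_rel n oU rF); split => //.
by rewrite setDv; exact: open0.
Qed.

(** The estimates on the pieces add up, because a disjoint family of pieces on
which [f] is injective makes [N] the sum of the indicators of their images.  The
set [B] is closed so that cutting a piece by the preimage of [B] leaves it
sigma-compact. *)
Lemma area_formula_approx U f (A : plane R -> mat) (e : R) : open U ->
  (forall z, U z -> has_diff f z (A z)) -> 0 < e <= 8^-1 ->
  measurable_fun U (fun z => `|detm (A z)|) ->
  let V := [set z | U z /\ detm (A z) != 0] in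
  let N w := counting [set z | V z /\ f z = w] : \bar R in
  [/\ measurable V, measurable_fun setT N &
  forall B, closed B ->
    (\int[lam R]_(z in V `&` f @^-1` B) `|detm (A z)|%:E
      <= (1 + 10 * e)%:E * \int[lam R]_(w in B) N w)%E /\
    (\int[lam R]_(w in B) N w
      <= (1 + 10 * e)%:E * \int[lam R]_(z in V `&` f @^-1` B) `|detm (A z)|%:E)%E].
Proof.
move=> oU fA e8 mJ V N; have cf := has_diff_cont fA.
have [F [rF FV injF areaF]] := area_pieces oU fA e8 mJ.
have e0 : 0 <= 1 + 10 * e by have /andP[] := e8; lra.
pose D := seqDU F.
have DF n : D n `<=` F n by exact: subDsetl.
have FU n : F n `<=` U by have [] := rF n.
have cD n : sigma_compact (D n) by exact: (sigma_compact_seqDU n oU rF).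
have VD : V = \bigcup_n D n by rewrite -seqDU_bigcup_eq FV.
have cfD n : sigma_compact (f @` D n).
  by apply: sigma_compact_image => //; apply: cont_on_within cf => p /DF/FU.
have NE w : N w = (\sum_(0 <= n <oo) (\1_(f @` D n) w)%:E)%E.
  by rewrite -counting_fiber// FV.
have mfD n : measurable (f @` D n) by exact: sigma_compact_measurable.
have mI n (B : set (plane R)) : measurable_fun B (fun w => (\1_(f @` D n) w)%:E : \bar R).
  by apply/measurable_EFinP; exact: measurable_indic.
have mN : measurable_fun setT N.
  rewrite (_ : N = fun w => (\sum_(0 <= n <oo) (\1_(f @` D n) w)%:E)%E); last exact/funext.
  under eq_fun do rewrite eseries_mkcond.
  by apply: ge0_emeasurable_sum => // n w _ _; rewrite lee_fin.
split => //.
  by rewrite VD; apply: bigcupT_measurable => n; exact: sigma_compact_measurable.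
move=> B cB; have mB := closed_measurable2 cB.
pose E n := D n `&` (U `&` f @^-1` B).
have cE n : sigma_compact (E n).
  by apply: (sigma_compact_rel n oU rF); exact: rel_closed_preimage.
have mE n : measurable (E n) by exact: sigma_compact_measurable.
have VE : V `&` f @^-1` B = \bigcup_n E n.
  rewrite VD setI_bigcupl; apply: eq_bigcupr => n _; rewrite /E setIA.
  by congr (_ `&` _); apply/esym/setIidl => p /DF/FU.
have fE n : f @` E n = f @` D n `&` B.
  apply/seteqP; split => [_ [p [Dp [_ Bp]] <-]|_ [[p Dp <-] Bp]].
    by split => //; exists p.
  by exists p => //; split => //; split => //; exact: (FU n _ (DF n _ Dp)).
have intN : (\int[lam R]_(w in B) N w = \sum_(0 <= n <oo) lam R (f @` E n))%E.
  under eq_integral do rewrite NE.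
  rewrite integral_nneseries//.
  by apply: eq_eseriesr => n _; rewrite fE -integral_indic.
have intJ : (\int[lam R]_(z in V `&` f @^-1` B) `|detm (A z)|%:E =
    \sum_(0 <= n <oo) \int[lam R]_(z in E n) `|detm (A z)|%:E)%E.
  rewrite VE ge0_integral_bigcup//.
    apply/measurable_EFinP; apply: measurable_funS mJ => //.
      exact: open_measurable2.
    by move=> p [n _ [_ []]].
  by apply: trivIset_setIr; exact: trivIset_seqDU.
have EF n : E n `<=` F n by move=> p [/DF].
rewrite intN intJ; split.
  rewrite -nneseriesZl//; apply: lee_nneseries => n _.
    by move=> _; exact: integral_ge0.
  exact: (areaF n _ (cE n) (EF n)).1.
rewrite -nneseriesZl//; last by move=> n _; exact: integral_ge0.
apply: lee_nneseries => // n _; exact: (areaF n _ (cE n) (EF n)).2.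
Qed.

Lemma le_of_approx (x y : \bar R) : (0 <= y)%E ->
  (forall e : R, 0 < e <= 8^-1 -> (x <= (1 + 10 * e)%:E * y)%E) -> (x <= y)%E.
Proof.
case: y => [y|_ _|//]; last exact: leey.
rewrite lee_fin => y0 h; apply/lee_addgt0Pr => eta eta0.
have d0 : 0 < 10 * (y + 1) by lra.
apply: le_trans (h (Num.min 8^-1 (eta / (10 * (y + 1)))) _) _.
  by rewrite lt_min ge_min lexx/= divr_gt0//; lra.
rewrite -EFinM -EFinD lee_fin mulrDl mul1r lerD2l.
apply: (@le_trans _ _ (10 * (eta / (10 * (y + 1))) * y)).
  by rewrite ler_wpM2r// ler_wpM2l// ge_min lexx orbT.
have -> : 10 * (eta / (10 * (y + 1))) * y = eta * (y / (y + 1)).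
  by field; rewrite gt_eqF//; lra.
apply: ler_piMr; first exact: ltW.
by rewrite ler_pdivrMr ?mul1r; lra.
Qed.

Lemma area_formula_closed U f (A : plane R -> mat) : open U ->
  (forall z, U z -> has_diff f z (A z)) ->
  measurable_fun U (fun z => `|detm (A z)|) ->
  let V := [set z | U z /\ detm (A z) != 0] in
  let N w := counting [set z | V z /\ f z = w] : \bar R in
  [/\ measurable V, measurable_fun setT N &
  forall B, closed B -> (\int[lam R]_(z in V `&` f @^-1` B) `|detm (A z)|%:E =
    \int[lam R]_(w in B) N w)%E].
Proof.
move=> oU fA mJ V N.
have e8 : (0 < 8^-1 :> R) && (8^-1 <= 8^-1 :> R) by apply/andP; split; rewrite ?invr_gt0.
have [mV mN _] := area_formula_approx oU fA e8 mJ.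
split => // B cB; apply/eqP; rewrite eq_le; apply/andP; split.
  apply: le_of_approx => [|e he]; first by apply: integral_ge0.
  by have [_ _ /(_ B cB)[]] := area_formula_approx oU fA he mJ.
apply: le_of_approx => [|e he]; first by apply: integral_ge0.
by have [_ _ /(_ B cB)[]] := area_formula_approx oU fA he mJ.
Qed.

(** Where the differential vanishes the map has arbitrarily small local
Lipschitz constant, so it shrinks areas by an arbitrarily large factor. *)
Lemma sard_zero U f (A : plane R -> mat) : open U -> (lam R U < +oo)%E ->
  (forall z, U z -> has_diff f z (A z)) ->
  (lam R).-negligible (f @` [set z | U z /\ A z = ((0, 0), (0, 0))]).
Proof.
move=> oU Ufin fA; have cf := has_diff_cont fA.
have mU := open_measurable2 oU.
have [u u0 uU] : exists2 u : R, 0 <= u & lam R U = u%:E.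
  exists (fine (lam R U)); first exact: fine_ge0.
  by rewrite fineK// ge0_fin_numE.
have h (m : nat) : exists M, [/\ measurable M,
    f @` [set z | U z /\ A z = ((0, 0), (0, 0))] `<=` M &
    (lam R M <= ((m.+1%:R^-1) ^+ 2 * u)%:E)%E].
  pose e := m.+1%:R^-1 : R; have e0 : 0 < e by exact: natinv_gt0.
  pose F n := if pickle_inv n is Some (k, t) then lip_points U f e k (ratpt t) else set0.
  have rF n : rel_closed U (F n).
    rewrite /F; case: pickle_inv => [[k t]|]; last exact: rel_closed0.
    by apply: rel_closed_lip_points => //; exact: ltW.
  pose D := seqDU F.
  have DF n : D n `<=` F n by exact: subDsetl.
  have FU n : F n `<=` U by have [] := rF n.
  have cD n : sigma_compact (D n) by exact: (sigma_compact_seqDU n oU rF).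
  have cfD n : {within D n, continuous f} by apply: cont_on_within cf => p /DF/FU.
  have mfD n : measurable (f @` D n).
    by apply: sigma_compact_measurable; exact: sigma_compact_image.
  exists (\bigcup_n f @` D n); split; first exact: bigcupT_measurable.
    move=> _ [z [Uz Az] <-]; have [d d0 fd] := fA _ Uz e e0.
    have [|k [t kt]] := @lip_points_mem R U f e d z Uz d0.
      move=> q /fd; rewrite Az /linm /lin/= !mul0r addr0.
      by rewrite (_ : (0, 0) = 0)// subr0.
    have : (\bigcup_n D n) z.
      rewrite -seqDU_bigcup_eq; exists (pickle (k, t)); first exact: I.
      by rewrite /F pickleK_inv.
    by move=> [n _ Dz]; exists n => //; exists z.
  apply: (@le_trans _ _ (\sum_(0 <= n <oo) lam R (f @` D n))%E).
    by apply: measure_sigma_subadditive => //; exact: bigcupT_measurable.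
  apply: (@le_trans _ _ (\sum_(0 <= n <oo) (e ^+ 2)%:E * lam R (D n))%E).
    apply: lee_nneseries => // n _.
    rewrite -[X in (_ * lam R X)%E](image_id (D n)).
    apply: lam_lipschitz => //; first exact: ltW.
      by apply: (@cont_on_within _ U); [move=> p /DF/FU|exact: cont_on_id].
    move=> p q /DF + /DF; rewrite /F; case: pickle_inv => [[k t]|//].
    exact: lip_pointsP.
  rewrite nneseriesZl// -/e (EFinM (e ^+ 2)) lee_wpmul2l ?lee_fin ?sqr_ge0// -uU.
  have -> : (\sum_(0 <= n <oo) lam R (D n) = lam R (\bigcup_n D n))%E.
    rewrite measure_bigcup//; last exact: trivIset_seqDU.
      by apply: eq_eseriesl => n; rewrite in_setT.
    by move=> n _; exact: sigma_compact_measurable.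
  apply: le_measure; rewrite ?inE//.
    by apply: bigcupT_measurable => n; exact: sigma_compact_measurable.
  by move=> p [n _ /DF/FU].
have /choice[M hM] := h.
exists (\bigcap_m M m); split.
- by apply: bigcapT_measurable => m; have [] := hM m.
- apply/eqP; rewrite eq_le measure_ge0 andbT; apply/lee_addgt0Pr => e e0.
  rewrite add0e; have u1 : 0 < u + 1 by rewrite ltr_wpDl.
  have [m me] := natinv_lt (divr_gt0 e0 u1).
  have [mM _ lM] := hM m.
  apply: le_trans (le_measure _ _ _ (bigcap_inf I : _ `<=` M m)) (le_trans lM _).
  + by rewrite inE; apply: bigcapT_measurable => m'; have [] := hM m'.
  + by rewrite inE.
  rewrite lee_fin expr2 -mulrA (le_trans (ler_piMl _ _))//.
  + by rewrite mulr_ge0// ltW// natinv_gt0.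
  + by rewrite invf_le1 ?ltr0n// ler1n.
  move: me; rewrite ltr_pdivlMr// => /ltW; apply: le_trans.
  by rewrite ler_wpM2l ?lerDl// ltW// natinv_gt0.
- by move=> w hw m _; have [_ + _] := hM m; apply.
Qed.

End area_formula.

(** * Measures with a density, measures determined by quadrants *)

Section density.
Local Open Scope ereal_scope.
Context d (T : measurableType d) (R : realType) (mu : {measure set T -> \bar R}).
Variable f : T -> \bar R.
Hypotheses (mf : measurable_fun setT f) (f0 : forall x, 0 <= f x).

Definition density (A : set T) := \int[mu]_(x in A) f x.

Let density0 : density set0 = 0. Proof. exact: integral_set0. Qed.
Let density_ge0 A : 0 <= density A. Proof. exact: integral_ge0. Qed.
Let density_sigma_additive : semi_sigma_additive density.
Proof. exact: semi_sigma_additive_nng_induced. Qed.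

HB.instance Definition _ := isMeasure.Build _ _ _ density
  density0 density_ge0 density_sigma_additive.

Definition density_measure : {measure set T -> \bar R} := density.

Import HBNNSimple.

(** True for simple functions, and preserved by increasing limits. *)
Lemma ge0_integral_density (g : T -> \bar R) : measurable_fun setT g ->
  (forall x, 0 <= g x) -> \int[density_measure]_x g x = \int[mu]_x (g x * f x).
Proof.
move=> mg g0; pose h := nnsfun_approx measurableT mg.
have mh n r : measurable (h n @^-1` [set r]) by [].
have dE A : density A = \int[mu]_x ((\1_A x)%:E * f x).
  by rewrite /density integral_mkcond; apply: eq_integral => x _; rewrite epatch_indic muleC.
have hE n : \int[density_measure]_x (h n x)%:E = \int[mu]_x ((h n x)%:E * f x).
  rewrite integralT_nnsfun sintegralE.
  transitivity (\int[mu]_x (\sum_(r \in range (h n))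
      (r%:E * (\1_(h n @^-1` [set r]) x)%:E) * f x)); last first.
    apply: eq_integral => x _; rewrite [in RHS]fimfunE -fsumEFin//.
    rewrite ge0_mule_fsuml => [|r]; first by apply: eq_fsbigr => r _; rewrite EFinM.
    exact: nnfun_muleindic_ge0.
  rewrite ge0_integral_fsum//; last 2 first.
  - move=> r; apply: emeasurable_funM => //; apply: emeasurable_funM => //.
    by apply/measurable_EFinP; exact: measurable_indic.
  - by move=> r x _; rewrite mule_ge0//; exact: nnfun_muleindic_ge0.
  apply: eq_fsbigr => r; rewrite inE => -[x _ <-].
  under eq_integral do rewrite -muleA.
  rewrite ge0_integralZl//; last 3 first.
  - apply: emeasurable_funM => //.
    by apply/measurable_EFinP; exact: measurable_indic.
  - by move=> y _; rewrite mule_ge0// lee_fin.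
  - by rewrite lee_fin.
  by congr (_ * _); exact: dE.
have hg x : (h n x)%:E @[n --> \oo] --> g x by exact: cvg_nnsfun_approx.
have hnd x n m : (n <= m)%N -> (h n x)%:E <= (h m x)%:E.
  by move=> nm; rewrite lee_fin; exact/lefP/nd_nnsfun_approx.
have h0 n x : 0 <= (h n x)%:E by rewrite lee_fin.
have hgf x : (h n x)%:E * f x @[n --> \oo] --> g x * f x.
  have [gx0|gx0] := eqVneq (g x) 0.
    have hx0 n : (h n x)%:E = 0.
      apply/eqP; rewrite eq_le h0 andbT -gx0.
      have <- : ereal_sup (range (fun n => (h n x)%:E)) = g x.
        rewrite -(cvg_lim _ (hg x))//; apply/esym/cvg_lim => //.
        by apply: ereal_nondecreasing_cvgn => k m; exact: hnd.
      by apply: ereal_sup_ubound; exists n.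
    by rewrite gx0 mul0e; under eq_fun do rewrite hx0 mul0e; exact: cvg_cst.
  have [fx0|fx0] := eqVneq (f x) 0.
    by rewrite fx0 mule0; under eq_fun do rewrite mule0; exact: cvg_cst.
  apply: cvgeM => //; last exact: cvg_cst.
  by apply: neq0_mule_def; rewrite mule_eq0 negb_or gx0.
transitivity (limn (fun n => \int[density_measure]_x (h n x)%:E)).
  rewrite -monotone_convergence//.
  - by apply: eq_integral => x _; apply/esym/cvg_lim.
  - by move=> n; exact/measurable_EFinP.
  - by move=> x _ n m; exact: hnd.
under eq_fun do rewrite hE.
rewrite -monotone_convergence//.
- by apply: eq_integral => x _; apply/cvg_lim.
- by move=> n; apply: emeasurable_funM => //; exact/measurable_EFinP.
- by move=> n x _; rewrite mule_ge0.
- by move=> x _ n m nm; rewrite lee_wpmul2r// hnd.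
Qed.

End density.

Section quadrants.
Context {R : realType}.

Definition quadrant (a b : R) : set (plane R) := `[a, +oo[ `*` `[b, +oo[.

Definition quadrants : set (set (plane R)) :=
  [set X | exists a b, X = quadrant a b].

Lemma closed_quadrant a b : closed (quadrant a b).
Proof.
rewrite -openC; apply/plane_openP => p Qp.
have [p1|p1] := ltP p.1 a.
  exists (a - p.1); first by rewrite subr_gt0.
  move=> q; rewrite plane_norm_lt/= ltr_norml => /andP[/andP[_ qp] _] [/=].
  by rewrite in_itv/= andbT; lra.
have [p2|p2] := ltP p.2 b.
  exists (b - p.2); first by rewrite subr_gt0.
  move=> q; rewrite plane_norm_lt/= [X in _ && X]ltr_norml => /andP[_ /andP[_ qp]] [/= _].
  by rewrite in_itv/= andbT; lra.
by exfalso; apply: Qp; split; rewrite /= in_itv/= andbT.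
Qed.

Lemma neg_natr_le (a : R) : exists n, - n%:R <= a.
Proof.
exists (Num.truncn (- a)).+1; rewrite lerNl ltW//; exact: truncnS_gt.
Qed.

Lemma measurable_quadrants : measurable = <<s quadrants >> :> set (set (plane R)).
Proof.
apply/seteqP; split => X; last first.
  apply: smallest_sub; first exact: sigma_algebra_measurable.
  move=> _ [a [b ->]]; apply: closed_measurable2; exact: closed_quadrant.
rewrite measurable_prod_measurableType; apply: smallest_sub.
  exact: smallest_sigma_algebra.
pose Q := g_sigma_algebraType quadrants.
have mfst : measurable_fun setT (fst : Q -> measurableTypeR R).
  apply: (measurability (@RGenCInfty.G R)); first exact: RGenCInfty.measurableE.
  move=> _ [_ [a ->] <-]; rewrite setTI.
  rewrite (_ : _ @^-1` _ = \bigcup_n quadrant a (- n%:R)).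
    apply: bigcupT_measurable => n; apply: sub_sigma_algebra.
    by exists a, (- n%:R).
  apply/seteqP; split => [p /= pa|p [n _ []]//].
  have [n hn] := neg_natr_le p.2; exists n => //; split => //=.
  by rewrite in_itv/= hn.
have msnd : measurable_fun setT (snd : Q -> measurableTypeR R).
  apply: (measurability (@RGenCInfty.G R)); first exact: RGenCInfty.measurableE.
  move=> _ [_ [b ->] <-]; rewrite setTI.
  rewrite (_ : _ @^-1` _ = \bigcup_n quadrant (- n%:R) b).
    apply: bigcupT_measurable => n; apply: sub_sigma_algebra.
    by exists (- n%:R), b.
  apply/seteqP; split => [p /= pa|p [n _ []]//].
  have [n hn] := neg_natr_le p.1; exists n => //; split => //=.
  by rewrite in_itv/= hn.
move=> _ [A mA [B mB <-]].
have -> : A `*` B = (fst : Q -> _) @^-1` A `&` (snd : Q -> _) @^-1` B by [].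
apply: (@measurableI _ Q).
  by rewrite -[X in measurable X]setTI; exact: mfst.
by rewrite -[X in measurable X]setTI; exact: msnd.
Qed.

Lemma measure_eq_quadrants (m1 m2 : {measure set (plane R) -> \bar R}) :
  (forall a b, m1 (quadrant a b) = m2 (quadrant a b)) -> (m1 setT < +oo)%E ->
  forall X, measurable X -> m1 X = m2 X.
Proof.
move=> m12 m1T X mX.
apply: (measure_unique quadrants (fun n => quadrant (- n%:R) (- n%:R))) => //.
- exact: measurable_quadrants.
- move=> _ _ [a [b ->]] [a' [b' ->]]; exists (Num.max a a'), (Num.max b b').
  apply/seteqP; split => p; rewrite /quadrant/= !in_itv/= !andbT !ge_max.
    by move=> [[-> ->] [-> ->]].
  by move=> [/andP[-> ->] /andP[-> ->]].
- by move=> n; exists (- n%:R), (- n%:R).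
- apply/seteqP; split => // p _.
  have [n hn] := neg_natr_le (Num.min p.1 p.2).
  by exists n => //; move: hn; rewrite le_min => /andP[h1 h2]; split; rewrite /= in_itv/= andbT.
- by move=> _ [a [b ->]].
- move=> n; apply: le_lt_trans m1T; apply: le_measure; rewrite ?inE//.
  by apply: closed_measurable2; exact: closed_quadrant.
Qed.

End quadrants.

(** * The area formula *)

Section area_change.
Context {R : realType}.
Implicit Types (B E U : set (plane R)) (p q z w : plane R) (f : plane R -> plane R).

(** Quadrants generate the Borel sets, and their preimages are closed in [U]. *)
Lemma cont_on_measurable U f : open U -> cont_on U f -> measurable_fun U f.
Proof.
move=> oU cf; apply: (measurability (@quadrants R)); first exact: measurable_quadrants.
move=> _ [_ [a [b ->]] <-]; apply: sigma_compact_measurable.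
have [_ oQ] := rel_closed_preimage oU cf (@closed_quadrant R a b).
rewrite (_ : U `&` _ = U `&` ~` (U `\` (U `&` f @^-1` quadrant a b))).
  apply: sigma_compactI; first exact: open_sigma_compact.
  by apply: closed_sigma_compact; exact: open_closedC.
apply/seteqP; split => p [Up Qp]; split => //; first by move=> [_]; apply.
by apply: contrapT => nQ; apply: Qp; split => // -[].
Qed.

Variables (U : set (plane R)) (f : plane R -> plane R) (A : plane R -> @mat R).
Hypotheses (oU : open U) (fA : forall z, U z -> has_diff f z (A z)).
Hypothesis mJ : measurable_fun U (fun z => `|detm (A z)|).

Let V := [set z | U z /\ detm (A z) != 0].
Let N w := counting [set z | V z /\ f z = w] : \bar R.

Hypothesis Nfin : (\int[lam R]_w N w < +oo)%E.

(** The image under [f] of the measure with density [|det A|] and the measure with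
density [N] are finite and agree on closed quadrants, so they are equal; the
formula is the integral of [G] against both. *)
Lemma ge0_area_formula (G : plane R -> \bar R) : measurable_fun setT G ->
  (forall w, 0 <= G w)%E ->
  (\int[lam R]_(z in V) (G (f z) * `|detm (A z)|%:E) = \int[lam R]_w (G w * N w))%E.
Proof.
move=> mG G0; have [mV mN areaB] := area_formula_closed oU fA mJ.
have VU : V `<=` U by move=> z [].
have mU : measurable U by exact: open_measurable2.
have N0 w : (0 <= N w)%E by [].
pose J := (fun z => `|detm (A z)|%:E : \bar R) \_ V.
have mJV : measurable_fun V (fun z => `|detm (A z)|%:E : \bar R).
  by apply/measurable_EFinP; exact: measurable_funS mJ.
have mJ' : measurable_fun setT J by apply/(measurable_restrictT _ mV).
have J0 z : (0 <= J z)%E by rewrite /J patchE; case: ifP.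
pose f' := f \_ V.
have mf' : measurable_fun setT f'.
  apply/(measurable_restrictT _ mV); apply: (measurable_funS mU VU).
  by apply: cont_on_measurable => //; exact: has_diff_cont fA.
pose m0 : {measure set (plane R) -> \bar R} :=
  density_measure (lam R) mJ' J0.
pose m1 : {measure set (plane R) -> \bar R} :=
  measure_function_pushforward__canonical__measure_function_Measure m0 mf'.
pose m2 : {measure set (plane R) -> \bar R} :=
  density_measure (lam R) mN N0.
have m12 X : measurable X -> m2 X = m1 X.
  apply: measure_eq_quadrants => // a b.
  have := areaB _ (@closed_quadrant R a b).
  rewrite -[X in _ = X]/(m2 (quadrant a b)) => <-.
  rewrite -[RHS]/(\int[lam R]_(z in f' @^-1` quadrant a b) J z)%E.
  rewrite /J -integral_mkcondr; congr (integral _ _ _).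
  apply/seteqP; split => z [h1 h2]; split => //=.
    by move: h2; rewrite /f' /= patchE mem_set.
  by move: h1; rewrite /f' /= patchE mem_set.
transitivity (\int[m1]_w G w)%E.
  rewrite ge0_integral_pushforward//= preimage_setT.
  have mGf : measurable_fun setT (G \o f') by exact: measurableT_comp.
  rewrite (ge0_integral_density (lam R) mJ' J0 mGf)//; last by move=> z; exact: G0.
  rewrite [LHS]integral_mkcond.
  apply: eq_integral => z _.
  by rewrite /J /f' /= !patchE; case: ifP => //; rewrite mule0.
rewrite -(ge0_integral_density (lam R) mN N0 mG G0).
by apply: eq_measure_integral => X mX _; rewrite -m12.
Qed.

Lemma maxe_mull (x : R) (y : \bar R) : (0 <= y)%E ->
  maxe (x%:E * y)%E 0%E = (maxe x%:E 0 * y)%E.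
Proof.
move=> y0; have [x0|x0] := leP 0 x.
  by rewrite !max_l ?lee_fin// mule_ge0.
have xy : (x%:E * y <= 0)%E by apply: mule_le0_ge0 => //; rewrite lee_fin ltW.
by rewrite max_r// max_r ?mul0e// lee_fin ltW.
Qed.

Lemma area_formula (G : plane R -> R) : measurable_fun setT G ->
  (\int[lam R]_(z in V) (G (f z) * `|detm (A z)|)%:E =
   \int[lam R]_w ((G w)%:E * N w))%E.
Proof.
move=> mG; rewrite integralE [RHS]integralE.
have N0 w : (0 <= N w)%E by [].
have h (g : plane R -> R) : measurable_fun setT g ->
  (\int[lam R]_(z in V) maxe (g (f z) * `|detm (A z)|)%:E 0 =
   \int[lam R]_w maxe ((g w)%:E * N w) 0)%E.
  move=> mg; under eq_integral do rewrite EFinM maxe_mull//.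
  under [RHS]eq_integral do rewrite maxe_mull//.
  apply: (ge0_area_formula (G := fun w => maxe (g w)%:E 0%E)).
    by apply: measurable_maxe => //; exact/measurable_EFinP.
  by move=> w; rewrite le_max lexx orbT.
congr (_ - _)%E.
  under eq_integral do rewrite funeposE; under [RHS]eq_integral do rewrite funeposE.
  exact: h.
under eq_integral do rewrite funenegE; under [RHS]eq_integral do rewrite funenegE.
transitivity (\int[lam R]_(z in V) maxe ((- G (f z)) * `|detm (A z)|)%:E 0)%E.
  by apply: eq_integral => z _; rewrite mulNr EFinN.
rewrite (h (fun z => - G z)); last exact: measurable_funN.
by apply: eq_integral => w _; rewrite EFinN mulNe.
Qed.

End area_change.

(** * Polar coordinates *)

Lemma derivable_approx (K : numFieldType) (f : K -> K) (x : K) :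
  derivable (f : K^o -> K^o) x 1 -> forall e : K, 0 < e ->
  exists2 d : K, 0 < d & forall h : K, `|h| < d ->
    `|f (h + x) - f x - h * 'D_1 (f : K^o -> K^o) x| <= e * `|h|.
Proof.
move=> /cvgrPdist_lt df e e0; have /nbhs_ballP[d d0 dh] := df e e0.
exists d => // h hd; have [->|h0] := eqVneq h 0.
  by rewrite add0r subrr mul0r subrr !normr0 mulr0.
have := dh h; rewrite /= -ball_normE /ball_/= sub0r normrN => /(_ hd h0).
rewrite /= /GRing.scale/= mulr1 => /ltW.
rewrite -(ler_pM2r (_ : 0 < `|h|)) ?normr_gt0// -normrM; congr (_ <= _).
rewrite -normrN; congr (`|_|); rewrite -mulNr opprB mulrBl mulrAC mulVf// mul1r.
by rewrite [h * _]mulrC.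
Qed.

Section polar.
Context {R : realType}.
Implicit Types (p q w : plane R).

Definition polar p : plane R := (p.1 * cos p.2, p.1 * sin p.2).

Definition polar_mat p : @mat R :=
  ((cos p.2, - (p.1 * sin p.2)), (sin p.2, p.1 * cos p.2)).

Lemma detm_polar p : detm (polar_mat p) = p.1.
Proof.
rewrite /detm /polar_mat/= -[RHS]mulr1 -(cos2Dsin2 p.2); ring.
Qed.

Lemma real_derive_approx (g : R -> R) (l x : R) : is_derive x 1 g l ->
  forall e, 0 < e -> exists2 d, 0 < d & forall h, `|h| < d ->
    `|g (h + x) - g x - h * l| <= e * `|h|.
Proof.
move=> [dg <-] e e0; have [d d0 hd] := derivable_approx dg e0.
by exists d.
Qed.

(** Both coordinates of the polar map have the form [r * g t]. *)
Lemma mul_derive_approx (g : R -> R) (l : R) p : is_derive p.2 1 g l ->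
  forall e, 0 < e -> exists2 d, 0 < d & forall q, `|q - p| < d ->
    `|q.1 * g q.2 - p.1 * g p.2 - ((q - p).1 * g p.2 + p.1 * l * (q - p).2)|
      <= e * `|q - p|.
Proof.
move=> dg e e0; pose e1 := e / (2 * (`|p.1| + 1)).
have p1 : 0 < 2 * (`|p.1| + 1) by rewrite mulr_gt0// ltr_wpDl.
have e10 : 0 < e1 by rewrite divr_gt0.
have [d d0 hd] := real_derive_approx dg e10.
have s0 : 0 < 2 * (e1 + `|l|) by rewrite mulr_gt0// ltr_pwDl.
exists (Num.min d (e / (2 * (e1 + `|l|)))); first by rewrite lt_min d0 divr_gt0.
move=> q; rewrite lt_min => /andP[qd qe].
set h := q - p in qd qe *.
have h1 : `|h.1| <= `|h| := plane_norm1 h.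
have h2 : `|h.2| <= `|h| := plane_norm2 h.
have q1 : q.1 = h.1 + p.1 by rewrite /h/= subrK.
have q2 : q.2 = h.2 + p.2 by rewrite /h/= subrK.
have := hd h.2 (le_lt_trans h2 qd); rewrite q1 q2.
set D := g _ - g _ - _ => Dh.
have -> : (h.1 + p.1) * g (h.2 + p.2) - p.1 * g p.2 - (h.1 * g p.2 + p.1 * l * h.2) =
  p.1 * D + h.1 * (D + h.2 * l) by rewrite /D; ring.
have D1 : `|D| <= e1 * `|h| by rewrite (le_trans Dh)// ler_wpM2l// ltW.
have D2 : `|D + h.2 * l| <= (e1 + `|l|) * `|h|.
  rewrite (le_trans (ler_normD _ _))// [leRHS]mulrDl lerD// normrM mulrC.
  by rewrite ler_wpM2l.
have A1 : `|p.1 * D| <= e / 2 * `|h|.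
  rewrite normrM (le_trans (ler_wpM2l _ D1))// mulrA ler_wpM2r//.
  rewrite /e1 mulrA ler_pdivrMr// mulrC.
  have -> : e / 2 * (2 * (`|p.1| + 1)) = e * (`|p.1| + 1) by field.
  by rewrite ler_wpM2l ?lerDl// ltW.
have A2 : `|h.1 * (D + h.2 * l)| <= e / 2 * `|h|.
  rewrite normrM (le_trans (ler_pM _ _ h1 D2))// mulrA ler_wpM2r//.
  move: qe; rewrite ltr_pdivlMr// => qe.
  by have := normr_ge0 h; nra.
rewrite (le_trans (ler_normD _ _))// (le_trans (lerD A1 A2))//.
by rewrite -mulrDl -splitr.
Qed.

Lemma has_diff_polar p : has_diff polar p (polar_mat p).
Proof.
move=> e e0.
have [d1 d10 h1] := mul_derive_approx (is_derive_cos p.2) e0.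
have [d2 d20 h2] := mul_derive_approx (is_derive_sin p.2) e0.
exists (Num.min d1 d2); first by rewrite lt_min d10.
move=> q; rewrite lt_min => /andP[q1 q2]; rewrite plane_norm_le; apply/andP; split.
  apply: le_trans (h1 q q1); rewrite le_eqVlt; apply/orP; left; apply/eqP.
  by congr (`|_|); rewrite /polar /linm /lin /polar_mat/=; ring.
apply: le_trans (h2 q q2); rewrite le_eqVlt; apply/orP; left; apply/eqP.
by congr (`|_|); rewrite /polar /linm /lin /polar_mat/=; ring.
Qed.

Definition udisk : set (plane R) := [set w | w.1 ^+ 2 + w.2 ^+ 2 < 1].

Definition polar_dom : set (plane R) := `]0, 1[ `*` `]0, 2 * pi[.

Lemma open_polar_dom : open polar_dom.
Proof.
apply/plane_openP => p [/=]; rewrite !in_itv/= => /andP[p0 p1] /andP[p2 p3].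
exists (Num.min (Num.min p.1 (1 - p.1)) (Num.min p.2 (2 * pi - p.2))).
  by rewrite !lt_min p0 p2 !subr_gt0 p1 p3.
move=> q; rewrite !lt_min plane_norm_lt => /andP[/andP[q1 q2] /andP[q3 q4]].
move: q1 q2 q3 q4; rewrite !plane_norm_lt/= !ltr_norml.
move=> /andP[/andP[a1 a2] _] /andP[/andP[a3 a4] _] /andP[_ /andP[a5 a6]] /andP[_ /andP[a7 a8]].
by split; rewrite /= in_itv/=; lra.
Qed.

Lemma cos_sin_inj (s t : R) : 0 < s < 2 * pi -> 0 < t < 2 * pi ->
  cos s = cos t -> sin s = sin t -> s = t.
Proof.
move=> hs ht cst sst; wlog st : s t hs ht cst sst / s <= t.
  by move=> h; have [/h->//|/ltW/h->//] := leP s t.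
have c1 : cos (t - s) = 1 by rewrite cosB cst sst -[in RHS](cos2Dsin2 t) !expr2.
have [tp|tp] := leP (t - s) pi.
  have : t - s = 0.
    apply: cos_inj; rewrite ?c1 ?cos0// in_itv/= ?lexx ?pi_ge0//.
    by rewrite subr_ge0 st.
  by move=> /eqP; rewrite subr_eq0 => /eqP.
have : 2 * pi - (t - s) = 0.
  apply: cos_inj; rewrite ?cos0 ?in_itv/= ?lexx ?pi_ge0//; first lra.
  by rewrite mulr_natl addrC cosD2pi cosN.
by lra.
Qed.

Lemma polar_inj p q : polar_dom p -> polar_dom q -> polar p = polar q -> p = q.
Proof.
move=> [/= p1 p2] [/= q1 q2] [e1 e2]; move: p1 p2 q1 q2; rewrite !in_itv/=.
move=> /andP[p0 p1] p2 /andP[q0 q1] q2.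
have pq : p.1 = q.1.
  have : p.1 ^+ 2 = q.1 ^+ 2.
    have pyth (a b : R) : a ^+ 2 = (a * cos b) ^+ 2 + (a * sin b) ^+ 2.
      by rewrite !exprMn -mulrDr cos2Dsin2 mulr1.
    by rewrite (pyth p.1 p.2) (pyth q.1 q.2) e1 e2.
  move=> /eqP; rewrite eqrXn2 ?ltW// => /eqP//.
move: e1 e2; rewrite pq => /(mulfI (lt0r_neq0 q0)) e1 /(mulfI (lt0r_neq0 q0)) e2.
by rewrite [p]surjective_pairing [q]surjective_pairing pq (cos_sin_inj p2 q2 e1 e2).
Qed.

Lemma polar_surj w : udisk w -> w.2 != 0 -> exists2 p, polar_dom p & polar p = w.
Proof.
rewrite /udisk/= => w1 w2.
have w20 : 0 < w.2 ^+ 2 by rewrite exprn_even_gt0.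
pose r := Num.sqrt (w.1 ^+ 2 + w.2 ^+ 2).
have r2 : r ^+ 2 = w.1 ^+ 2 + w.2 ^+ 2 by rewrite sqr_sqrtr// addr_ge0// sqr_ge0.
have r0 : 0 < r by rewrite sqrtr_gt0 ltr_wpDl// sqr_ge0.
have r1 : r < 1 by rewrite -(@ltr_pXn2r _ 2) ?nnegrE ?ltW// r2 expr1n.
pose c := w.1 / r.
have c2 : c ^+ 2 < 1 by rewrite expr_div_n r2 ltr_pdivrMr -?r2 ?exprn_gt0// mul1r r2 ltrDl.
have c1 : -1 < c < 1 by rewrite -ltr_norml -(@ltr_pXn2r _ 2) ?nnegrE// expr1n real_normK ?num_real.
have [c11 c12] : -1 <= c < 1 /\ -1 < c <= 1.
  by have /andP[h1 h2] := c1; rewrite (ltW h1) (ltW h2) h1 h2.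
have c13 : -1 <= c <= 1 by have /andP[-> h2] := c11; exact: ltW.
pose a := acos c; have a0 : 0 < a := acos_gt0 c11; have api : a < pi := acos_ltpi c12.
have ca : r * cos a = w.1.
  by rewrite /a acosK ?in_itv//= /c mulrC divfK// gt_eqF.
have sa : r * sin a = `|w.2|.
  have s0 : 0 <= r * sin a by rewrite mulr_ge0 ?(ltW r0)// sin_ge0_pi// !ltW.
  apply/eqP; rewrite -(@eqrXn2 _ 2)// real_normK ?num_real// exprMn sin2cos2 mulrBr mulr1.
  by rewrite -exprMn ca r2 addrC addKr.
have [wpos|wneg] := ltP 0 w.2.
  exists (r, a); first by split; rewrite /= in_itv/= ?r0 ?a0//; lra.
  by rewrite /polar/= ca sa gtr0_norm// -surjective_pairing.
exists (r, 2 * pi - a); first by split; rewrite /= in_itv/= ?r0 ?a0//; lra.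
rewrite /polar/= mulr_natl [_ - a]addrC cosD2pi sinD2pi cosN sinN mulrN ca sa.
by rewrite ler0_norm// opprK -surjective_pairing.
Qed.

Lemma polar_disk p : polar_dom p -> udisk (polar p).
Proof.
move=> [/=]; rewrite !in_itv/= => /andP[p0 p1] _.
rewrite /udisk/= !exprMn -mulrDr cos2Dsin2 mulr1.
by rewrite exprn_ilt1// ltW.
Qed.

Lemma open_udisk : open udisk.
Proof.
apply/plane_openP => p; rewrite /udisk/= => p1.
pose e := (1 - (p.1 ^+ 2 + p.2 ^+ 2)) / (4 * (`|p.1| + `|p.2| + 1)).
have s0 : 0 < 4 * (`|p.1| + `|p.2| + 1) by rewrite mulr_gt0// ltr_wpDl// addr_ge0.
exists (Num.min 1 e); first by rewrite lt_min ltr01 divr_gt0// subr_gt0.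
move=> q; rewrite lt_min => /andP[q1].
set m := `|q - p| in q1 *; rewrite ltr_pdivlMr// => qe.
have h1 : `|q.1 - p.1| <= m := plane_norm1 (q - p).
have h2 : `|q.2 - p.2| <= m := plane_norm2 (q - p).
have sq (a b : R) : `|b - a| <= m -> b ^+ 2 <= a ^+ 2 + m * (2 * `|a| + m).
  move=> ab; have -> : b ^+ 2 = a ^+ 2 + (b - a) * (2 * a + (b - a)) by ring.
  rewrite lerD2l (le_trans (ler_norm _))// normrM ler_pM//.
  by rewrite (le_trans (ler_normD _ _))// normrM ger0_norm// lerD.
have := sq _ _ h1; have := sq _ _ h2; have := normr_ge0 (q - p); rewrite -/m.
have := normr_ge0 p.1; have := normr_ge0 p.2; nra.
Qed.

Lemma measurable_udisk : measurable udisk.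
Proof. apply: open_measurable2; exact: open_udisk. Qed.

Lemma lam_udisk_fin : (lam R udisk < +oo)%E.
Proof.
apply: (@le_lt_trans _ _ (lam R (`[-1, -1 + 2] `*` `[-1, -1 + 2]))); last first.
  by rewrite lam_square// ltry.
apply: le_measure; rewrite ?inE; [exact: measurable_udisk|exact: measurableX|].
move=> p; rewrite /udisk/= => p1.
have h (a b : R) : a ^+ 2 + b ^+ 2 < 1 -> -1 <= a <= 1.
  move=> ab; rewrite -ler_norml -(@ler_pXn2r _ 2) ?nnegrE// expr1n real_normK ?num_real//.
  by rewrite (le_trans _ (ltW ab))// lerDl sqr_ge0.
split; rewrite /= in_itv/=.
  by have := h _ _ p1; lra.
by rewrite addrC in p1; have := h _ _ p1; lra.
Qed.

Let V := [set z | polar_dom z /\ detm (polar_mat z) != 0].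
Let N w := counting [set z | V z /\ polar z = w] : \bar R.

Let VE : V = polar_dom.
Proof.
apply/seteqP; split => [p []//|p Dp]; split => //; rewrite detm_polar.
by case: Dp => /=; rewrite in_itv/= => /andP[/lt0r_neq0].
Qed.

(** Each point of the disk off the horizontal axis has exactly one pair of polar
coordinates in [polar_dom]. *)
Let NE w : w.2 != 0 -> N w = (\1_udisk w)%:E.
Proof.
move=> w2; rewrite indicE /N VE; have [wD|wD] := pselect (udisk w).
  have [p Dp pw] := polar_surj wD w2.
  rewrite (_ : [set _ | _] = [set p]); last first.
    apply/seteqP; split => [q [Dq qw]|_ ->//].
    by apply: polar_inj => //; rewrite pw.
  by rewrite /counting asboolT ?finite_set1// fset_set1 finmap.cardfs1 mem_set.
rewrite (_ : [set _ | _] = set0); last first.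
  by apply/seteqP; split => // q [Dq qw]; apply: wD; rewrite -qw; exact: polar_disk.
by rewrite /counting asboolT// fset_set0 finmap.cardfs0 memNset.
Qed.

Let aeN : {ae lam R, forall w, N w = (\1_udisk w)%:E}.
Proof. by apply: ae_imply (ae_snd_neq 0) => w; exact: NE. Qed.

Let mJ : measurable_fun polar_dom (fun z => `|detm (polar_mat z)| : R).
Proof.
under eq_fun do rewrite detm_polar; apply: measurableT_comp => //.
exact: measurable_funTS.
Qed.

Let mN : measurable_fun setT N.
Proof. by have [] := area_formula_closed open_polar_dom (fun z _ => has_diff_polar z) mJ. Qed.

Let Nfin : (\int[lam R]_w N w < +oo)%E.
Proof.
rewrite (ge0_ae_eq_integral (g := fun w => (\1_udisk w)%:E))//.
- rewrite integral_indic//; last exact: measurable_udisk.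
  by rewrite setIT; exact: lam_udisk_fin.
- by apply/measurable_EFinP; apply: measurable_indic; exact: measurable_udisk.
- by apply: filterS aeN => w + _.
Qed.

Lemma ge0_polar_integral (G : plane R -> \bar R) : measurable_fun setT G ->
  (forall w, 0 <= G w)%E ->
  (\int[lam R]_(p in polar_dom) (G (polar p) * p.1%:E) = \int[lam R]_(w in udisk) G w)%E.
Proof.
move=> mG G0.
have eqG : (\int[lam R]_(z in V) (G (polar z) * `|detm (polar_mat z)|%:E) =
    \int[lam R]_w (G w * N w))%E.
  exact: (ge0_area_formula open_polar_dom (fun z _ => has_diff_polar z) mJ Nfin mG G0).
transitivity (\int[lam R]_(z in V) (G (polar z) * `|detm (polar_mat z)|%:E))%E.
  rewrite VE; apply: eq_integral => p; rewrite inE => -[/=]; rewrite in_itv/= => /andP[p0 _] _.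
  by rewrite detm_polar gtr0_norm.
rewrite eqG [RHS]integral_mkcond epatch_indic; apply: ge0_ae_eq_integral => //.
- exact: emeasurable_funM.
- apply: emeasurable_funM => //.
  by apply/measurable_EFinP; apply: measurable_indic; exact: measurable_udisk.
- by move=> w _; rewrite mule_ge0.
- by move=> w _; rewrite mule_ge0// lee_fin.
- by apply: filterS aeN => w + _ => /= ->.
Qed.

Lemma polar_integral (G : plane R -> R) : measurable_fun setT G ->
  (\int[lam R]_(p in polar_dom) (G (polar p) * p.1)%:E = \int[lam R]_(w in udisk) (G w)%:E)%E.
Proof.
move=> mG.
have eqG : (\int[lam R]_(z in V) (G (polar z) * `|detm (polar_mat z)|)%:E =
    \int[lam R]_w ((G w)%:E * N w))%E.
  exact: (area_formula open_polar_dom (fun z _ => has_diff_polar z) mJ Nfin mG).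
transitivity (\int[lam R]_(z in V) (G (polar z) * `|detm (polar_mat z)|)%:E)%E.
  rewrite VE; apply: eq_integral => p; rewrite inE => -[/=]; rewrite in_itv/= => /andP[p0 _] _.
  by rewrite detm_polar gtr0_norm.
rewrite eqG [RHS]integral_mkcond epatch_indic; apply: ae_eq_integral => //.
- by apply: emeasurable_funM => //; exact/measurable_EFinP.
- apply: emeasurable_funM; first exact/measurable_EFinP.
  by apply/measurable_EFinP; apply: measurable_indic; exact: measurable_udisk.
- by apply: filterS aeN => w + _ => /= ->.
Qed.

End polar.

(** * Iterated integrals in polar coordinates *)

Section polar_fubini.
Context {R : realType}.
Local Notation leb := (@lebesgue_measure R).
Implicit Types (p q w : plane R).

Lemma measurable_polar : measurable_fun setT (@polar R).
Proof.
apply/measurable_fun_pairP; split => /=; apply: measurable_funM => //;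
  apply: measurableT_comp => //; apply: continuous_measurable_fun.
  exact: continuous_cos.
exact: continuous_sin.
Qed.

Lemma measurable_polar_dom : measurable (@polar_dom R).
Proof. by apply: open_measurable2; exact: open_polar_dom. Qed.

Lemma ae_neq (a : R) : {ae leb, forall x, x != a}.
Proof.
exists [set a]; split; [exact: measurable_set1|exact: lebesgue_measure_set1|].
by move=> x /= /negP; rewrite negbK => /eqP.
Qed.

(** The indicator of a null set has integral zero in polar coordinates, where its
weight [r] is positive; by Tonelli almost every angular integral is zero. *)
Lemma ae_polar (Z : set (plane R)) : (lam R).-negligible (Z `&` @udisk R) ->
  {ae leb, forall r, 0 <= r < 1 ->
    {ae leb, forall t, 0 <= t <= 2 * pi -> ~ Z (polar (r, t))}}.
Proof.
move=> [M [mM M0 ZM]].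
pose F p : \bar R := ((\1_M (polar p))%:E * p.1%:E * (\1_polar_dom p)%:E)%E.
have mF : measurable_fun setT F.
  apply: emeasurable_funM; last first.
    by apply/measurable_EFinP; apply: measurable_indic; exact: measurable_polar_dom.
  apply: emeasurable_funM; last exact/measurable_EFinP.
  apply/measurable_EFinP; apply: measurableT_comp; last exact: measurable_polar.
  exact: measurable_indic.
have F0 p : (0 <= F p)%E.
  rewrite /F indicE [\1_polar_dom p]indicE; case: (boolP (p \in polar_dom)) => [|_].
    rewrite inE => -[/=]; rewrite in_itv/= => /andP[p0 _] _.
    by rewrite !mule_ge0// lee_fin// ltW.
  by rewrite mule0.
have intF : (\int[lam R]_p F p = 0)%E.
  transitivity (\int[lam R]_(p in polar_dom) ((\1_M (polar p))%:E * p.1%:E))%E.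
    by rewrite [RHS]integral_mkcond epatch_indic.
  rewrite (@ge0_polar_integral _ (fun w => (\1_M w)%:E))//; last first.
    by apply/measurable_EFinP; exact: measurable_indic.
  rewrite integral_indic//; last exact: measurable_udisk.
  apply: subset_measure0 M0 => //; apply: measurableI => //; exact: measurable_udisk.
have mH := measurable_fun_fubini_tonelli_F (m2 := leb) F mF F0.
have H0 r : (0 <= fubini_F leb F r)%E by apply: integral_ge0.
have := fubini_tonelli1 (m1 := leb) (m2 := leb) F mF F0.
rewrite [LHS]intF => /esym intH.
have aeH : ae_eq leb setT (fubini_F leb F) (cst 0%E).
  apply/(ae_eq_integral_abs leb measurableT mH).
  by rewrite -[RHS]intH; apply: eq_integral => r _; rewrite gee0_abs.
apply: filterS2 aeH (ae_neq 0) => r /= + r0 /andP[r0' r1] => /(_ I) Hr.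
have mFr : measurable_fun setT (fun t => F (r, t)).
  by apply: measurableT_comp mF _; exact: pair1_measurable.
have aeF : ae_eq leb setT (fun t => F (r, t)) (cst 0%E).
  apply/(ae_eq_integral_abs leb measurableT mFr).
  by rewrite -[RHS]Hr; apply: eq_integral => t _; rewrite gee0_abs.
apply: filterS3 aeF (ae_neq 0) (ae_neq (2 * pi)) => t /(_ I) Ft t0 t2 /andP[ht0 ht2] Zp.
have rpos : 0 < r by rewrite lt_neqAle eq_sym r0.
have Dp : polar_dom (r, t).
  split; rewrite /= in_itv/= ?rpos//.
  by rewrite !lt_neqAle ht0 ht2 t2 eq_sym t0.
have Mp : M (polar (r, t)) by apply: ZM; split=> //; exact: polar_disk.
move: Ft; rewrite /F !indicE !mem_set//= mule1 mul1e => -[] r00.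
by rewrite r00 eqxx in r0.
Qed.

Lemma polar_fubini (F : plane R -> R) (K : R) : measurable_fun setT F ->
  (forall p, polar_dom p -> `|F p| <= K) ->
  measurable_fun (`]0%R, 1%R[%classic : set (measurableTypeR R))
    (fun r => \int[leb]_(t in `]0%R, (2 * pi)%R[) (F (r, t))%:E)%E /\
  (\int[lam R]_(p in @polar_dom R) (F p)%:E =
   \int[leb]_(r in `]0%R, 1%R[) \int[leb]_(t in `]0%R, (2 * pi)%R[) (F (r, t))%:E)%E.
Proof.
move=> mF FK; pose f : plane R -> \bar R := (EFin \o F) \_ polar_dom.
have mf : measurable_fun setT f.
  apply/(measurable_restrictT _ measurable_polar_dom); apply: measurable_funTS.
  exact/measurable_EFinP.
have lamD : (lam R polar_dom < +oo)%E.
  have lI (x : R) : (leb `]0%R, x[%classic < +oo)%E.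
    by rewrite lebesgue_measure_itv/=; case: ifP => // _; rewrite -EFinD ltry.
  rewrite product_measure1E//; apply: lte_mul_pinfty => //; last exact: lI.
  by rewrite ge0_fin_numE//; exact: lI.
have intf : (lam R).-integrable setT f.
  apply/integrableP; split => //.
  apply: (@le_lt_trans _ _ (\int[lam R]_(p in polar_dom) `|K|%:E)%E).
    rewrite [leRHS]integral_mkcond; apply: ge0_le_integral => //.
    - exact: measurableT_comp.
    - apply/(measurable_restrictT _ measurable_polar_dom); exact: measurable_cst.
    - move=> p _; rewrite /f !patchE; case: ifP; last by rewrite abse0.
      by rewrite inE => Dp; rewrite /= lee_fin (le_trans (FK p Dp))// ler_norm.
  by rewrite integral_cst ?lte_mul_pinfty//; exact: measurable_polar_dom.
have fF r : `]0, 1[%classic r ->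
    fubini_F leb f r = (\int[leb]_(t in `]0%R, (2 * pi)%R[) (F (r, t))%:E)%E.
  move=> hr; rewrite /fubini_F [RHS]integral_mkcond; apply: eq_integral => t _.
  rewrite /f !patchE; congr (if _ then _ else _).
  by apply/idP/idP; rewrite !inE; [case|split].
split.
  apply: (eq_measurable_fun (fubini_F leb f)) => [r|]; first by rewrite inE; exact: fF.
  by apply: measurable_funTS; exact: measurable_fubini_F intf.
rewrite integral_mkcond -[LHS]/(\int[lam R]_p f p)%E.
rewrite -(integral12_prod_meas1 intf) [RHS]integral_mkcond; apply: eq_integral => r _.
rewrite [RHS]patchE; case: ifP => [|/negP]; rewrite inE => hr; first exact: fF.
by apply: integral0_eq => t _; rewrite /f patchE memNset//; case.
Qed.

End polar_fubini.

(** * Polynomials approximating a step; moments on the disk *)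

Lemma bernoulli_ge (R : realFieldType) (x : R) n : -1 <= x ->
  1 + n%:R * x <= (1 + x) ^+ n.
Proof.
move=> x1; elim: n => [|n IHn]; first by rewrite mul0r addr0 expr0.
rewrite exprS; apply: (@le_trans _ _ ((1 + x) * (1 + n%:R * x))).
  have -> : (1 + x) * (1 + n%:R * x) = 1 + n.+1%:R * x + n%:R * x ^+ 2.
    by rewrite -natr1; ring.
  by rewrite lerDl mulr_ge0 ?sqr_ge0.
by rewrite ler_wpM2l//; lra.
Qed.

Section step.
Context {R : realType}.

(** These polynomials of [v] converge to the indicator of [v < 2^-1] on [0, 1],
except at [2^-1]. *)
Definition step_approx (v : R) (n : nat) : R := (1 - v ^+ n) ^+ (2 ^ n).

Lemma step_approx_itv v n : 0 <= v <= 1 -> 0 <= step_approx v n <= 1.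
Proof.
move=> /andP[v0 v1]; have vn : 0 <= v ^+ n <= 1 by rewrite exprn_ge0// exprn_ile1.
by rewrite exprn_ge0 ?exprn_ile1//; lra.
Qed.

(** Bernoulli's inequality bounds the value below by [1 - (2 * v) ^+ n]. *)
Lemma step_approx_lt v : 0 <= v < 2^-1 -> step_approx v n @[n --> \oo] --> (1 : R).
Proof.
move=> /andP[v0 v1]; have v01 : 0 <= v <= 1 by lra.
have c0 : (2 * v) ^+ n @[n --> \oo] --> (0 : R).
  by apply: cvg_expr; rewrite ger0_norm; lra.
apply: (@squeeze_cvgr _ _ _ _ (fun n => 1 - (2 * v) ^+ n) (fun=> 1)).
- apply: nearW => n; have /andP[_ ->] := step_approx_itv n v01; rewrite andbT.
  have := @bernoulli_ge R (- v ^+ n) (2 ^ n).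
  rewrite natrX mulrN -exprMn; apply.
  by rewrite lerN2 exprn_ile1//; lra.
- by rewrite -[X in _ --> X]subr0; apply: cvgB => //; exact: cvg_cst.
- exact: cvg_cst.
Qed.

(** The factor [(1 - v ^+ n) * (1 + v ^+ n)] is at most [1], and Bernoulli's
inequality bounds the power of [1 + v ^+ n] below by [(2 * v) ^+ n]. *)
Lemma step_approx_gt v : 2^-1 < v <= 1 -> step_approx v n @[n --> \oo] --> (0 : R).
Proof.
move=> /andP[v0 v1]; have v01 : 0 <= v <= 1 by lra.
have v2 : 0 < 2 * v by lra.
have c0 : (2 * v)^-1 ^+ n @[n --> \oo] --> (0 : R).
  apply: cvg_expr; rewrite ger0_norm ?invr_ge0 ?ltW//.
  by rewrite invf_lt1//; lra.
apply: (@squeeze_cvgr _ _ _ _ (fun=> 0) (fun n => (2 * v)^-1 ^+ n)).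
- apply: nearW => n; have /andP[-> _] := step_approx_itv n v01 => /=.
  have vn : 0 <= v ^+ n <= 1 by rewrite exprn_ge0 ?exprn_ile1//; lra.
  rewrite exprVn -[leRHS]mul1r ler_pdivlMr ?exprn_gt0//.
  apply: (@le_trans _ _ (step_approx v n * (1 + v ^+ n) ^+ (2 ^ n))).
    rewrite ler_wpM2l//; first by have /andP[] := step_approx_itv n v01.
    apply: le_trans (@bernoulli_ge R (v ^+ n) (2 ^ n) _); last by lra.
    by rewrite natrX -exprMn lerDr.
  rewrite /step_approx -exprMn exprn_ile1//; first by nra.
  have -> : (1 - v ^+ n) * (1 + v ^+ n) = 1 - (v ^+ n) ^+ 2 by ring.
  by rewrite gerBl sqr_ge0.
- exact: cvg_cst.
- exact: c0.
Qed.

End step.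

Section moments.
Context {R : realType}.
Implicit Types (p q w : plane R) (a b : nat).

Definition moment a b w : R[i] := cplx w ^+ a * (Num.conj (cplx w)) ^+ b.

Lemma complexRe_mul (u v : R[i]) :
  complex.Re (u * v) = complex.Re u * complex.Re v - complex.Im u * complex.Im v.
Proof. by case: u; case: v. Qed.

Lemma complexIm_mul (u v : R[i]) :
  complex.Im (u * v) = complex.Re u * complex.Im v + complex.Im u * complex.Re v.
Proof. by case: u; case: v. Qed.

Lemma complexRe_conj (u : R[i]) : complex.Re (Num.conj u) = complex.Re u.
Proof. by case: u. Qed.

Lemma complexIm_conj (u : R[i]) : complex.Im (Num.conj u) = - complex.Im u.
Proof. by case: u. Qed.

Lemma momentSl a b w : moment a.+1 b w = cplx w * moment a b w.
Proof. by rewrite /moment exprS mulrA. Qed.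

Lemma momentSr a b w : moment a b.+1 w = Num.conj (cplx w) * moment a b w.
Proof. by rewrite /moment exprS mulrCA. Qed.

Lemma moment_mulx a b w :
  w.1 * complex.Re (moment a b w) =
    2^-1 * (complex.Re (moment a.+1 b w) + complex.Re (moment a b.+1 w)) /\
  w.1 * complex.Im (moment a b w) =
    2^-1 * (complex.Im (moment a.+1 b w) + complex.Im (moment a b.+1 w)).
Proof.
rewrite momentSl momentSr; move: (moment a b w) => W.
by rewrite !complexRe_mul !complexIm_mul complexRe_conj complexIm_conj /=; split; field.
Qed.

Lemma moment_muly a b w :
  w.2 * complex.Re (moment a b w) =
    2^-1 * (complex.Im (moment a.+1 b w) - complex.Im (moment a b.+1 w)) /\
  w.2 * complex.Im (moment a b w) =
    2^-1 * (complex.Re (moment a b.+1 w) - complex.Re (moment a.+1 b w)).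
Proof.
rewrite momentSl momentSr; move: (moment a b w) => W.
by rewrite !complexRe_mul !complexIm_mul complexRe_conj complexIm_conj /=; split; field.
Qed.

Lemma measurable_moment a b :
  measurable_fun setT (fun w : plane R => complex.Re (moment a b w)) /\
  measurable_fun setT (fun w : plane R => complex.Im (moment a b w)).
Proof.
elim: b => [|b [IH1 IH2]]; last first.
  split.
    rewrite (_ : (fun _ => _) = fun w => w.1 * complex.Re (moment a b w) +
        w.2 * complex.Im (moment a b w)).
      by apply: measurable_funD; apply: measurable_funM.
    apply/funext => w; rewrite momentSr; move: (moment a b w) => W.
    by rewrite complexRe_mul complexRe_conj complexIm_conj /=; ring.
  rewrite (_ : (fun _ => _) = fun w => w.1 * complex.Im (moment a b w) -
      w.2 * complex.Re (moment a b w)).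
    by apply: measurable_funB; apply: measurable_funM.
  apply/funext => w; rewrite momentSr; move: (moment a b w) => W.
  by rewrite complexIm_mul complexRe_conj complexIm_conj /=; ring.
elim: a => [|a [IH1 IH2]].
  split.
    rewrite (_ : (fun _ => _) = cst 1); first exact: measurable_cst.
    by apply/funext => w; rewrite /moment !expr0 mul1r.
  rewrite (_ : (fun _ => _) = cst 0); first exact: measurable_cst.
  by apply/funext => w; rewrite /moment !expr0 mul1r.
split.
  rewrite (_ : (fun _ => _) = fun w => w.1 * complex.Re (moment a 0 w) -
      w.2 * complex.Im (moment a 0 w)).
    by apply: measurable_funB; apply: measurable_funM.
  by apply/funext => w; rewrite momentSl complexRe_mul.
rewrite (_ : (fun _ => _) = fun w => w.1 * complex.Im (moment a 0 w) +
    w.2 * complex.Re (moment a 0 w)).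
  by apply: measurable_funD; apply: measurable_funM.
by apply/funext => w; rewrite momentSl complexIm_mul.
Qed.

Lemma moment_bound a b w : udisk w ->
  complex.Re (moment a b w) ^+ 2 + complex.Im (moment a b w) ^+ 2 <= 1.
Proof.
move=> w1; have h (u v s t : R) : s ^+ 2 + t ^+ 2 < 1 -> u ^+ 2 + v ^+ 2 <= 1 ->
    (s * u - t * v) ^+ 2 + (s * v + t * u) ^+ 2 <= 1.
  move=> st uv; have -> : (s * u - t * v) ^+ 2 + (s * v + t * u) ^+ 2 =
    (s ^+ 2 + t ^+ 2) * (u ^+ 2 + v ^+ 2) by ring.
  by rewrite mulr_ile1 ?addr_ge0 ?sqr_ge0// ltW.
elim: b => [|b IH]; last first.
  rewrite momentSr; move: (moment a b w) IH => W IH.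
  by rewrite complexRe_mul complexIm_mul complexRe_conj complexIm_conj /=; apply: h; rewrite ?sqrrN.
elim: a => [|a IH].
  by rewrite /moment !expr0 mul1r /= expr1n expr0n addr0.
rewrite momentSl; move: (moment a 0 w) IH => W IH.
by rewrite complexRe_mul complexIm_mul /=; apply: h.
Qed.

Lemma moment_bounds a b w : udisk w ->
  `|complex.Re (moment a b w)| <= 1 /\ `|complex.Im (moment a b w)| <= 1.
Proof.
move=> /(moment_bound a b) h; have sq (u v : R) : u ^+ 2 + v ^+ 2 <= 1 -> `|u| <= 1.
  move=> uv; rewrite -(@ler_pXn2r _ 2) ?nnegrE// expr1n real_normK ?num_real//.
  by rewrite (le_trans _ uv)// lerDl sqr_ge0.
by split; [exact: sq h|apply: sq; rewrite addrC; exact: h].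
Qed.

(** Closed under products, unlike integrability, and sufficient for it on the
disk. *)
Definition dbounded (F : plane R -> R) := exists K, forall w, udisk w -> `|F w| <= K.

Lemma dboundedM F G : dbounded F -> dbounded G -> dbounded (fun w => F w * G w).
Proof.
move=> [K FK] [L GL]; exists (K * L) => w w1.
by rewrite normrM ler_pM// ?FK ?GL.
Qed.

Lemma dboundedD F G : dbounded F -> dbounded G -> dbounded (fun w => F w + G w).
Proof.
move=> [K FK] [L GL]; exists (K + L) => w w1.
by rewrite (le_trans (ler_normD _ _))// lerD ?FK ?GL.
Qed.

Lemma dbounded_cst c : dbounded (fun=> c).
Proof. by exists `|c|. Qed.

Lemma dbounded_fst : dbounded fst.
Proof. by exists 1 => w /(moment_bounds 1 0)[]; rewrite /moment expr0 mulr1. Qed.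

Lemma dbounded_snd : dbounded snd.
Proof. by exists 1 => w /(moment_bounds 1 0)[]; rewrite /moment expr0 mulr1. Qed.

Lemma dbounded_integrable F : measurable_fun setT F -> dbounded F ->
  (lam R).-integrable udisk (EFin \o F).
Proof.
move=> mF [K FK]; apply: measurable_bounded_integrable.
- exact: measurable_udisk.
- exact: lam_udisk_fin.
- exact: measurable_funTS.
- exists K; split; first exact: num_real.
  by move=> x Kx w w1 /=; rewrite (le_trans (FK w w1))// ltW.
Qed.

End moments.

(** * Bounded functions on the disk are determined by their moments *)

Section determinacy.
Context {R : realType}.
Implicit Types (w : plane R) (G u : plane R -> R).

Variable h : plane R -> R.
Hypotheses (mh : measurable_fun setT h) (bh : dbounded h).

Let I G : R := \int[lam R]_(w in udisk) (G w * h w).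

Hypothesis moment0 : forall a b,
  I (fun w => complex.Re (moment a b w)) = 0 /\
  I (fun w => complex.Im (moment a b w)) = 0.

Let nice G := measurable_fun setT G /\ dbounded G.

Let nice_int G : nice G -> (lam R).-integrable udisk (EFin \o (fun w => G w * h w)).
Proof.
move=> [mG bG]; apply: dbounded_integrable; first exact: measurable_funM.
exact: dboundedM.
Qed.

Let niceM G u : nice G -> nice u -> nice (fun w => G w * u w).
Proof.
by move=> [? ?] [? ?]; split; [exact: measurable_funM|exact: dboundedM].
Qed.

Let niceD G u : nice G -> nice u -> nice (fun w => G w + u w).
Proof.
by move=> [? ?] [? ?]; split; [exact: measurable_funD|exact: dboundedD].
Qed.

Let nice_cst c : nice (fun=> c).
Proof. by split; [exact: measurable_cst|exact: dbounded_cst]. Qed.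

Let nice_moment a b : nice (fun w => complex.Re (moment a b w)) /\
  nice (fun w => complex.Im (moment a b w)).
Proof.
have [m1 m2] := @measurable_moment R a b.
by split; split => //; exists 1 => w /(moment_bounds a b)[].
Qed.

Let ID G u : nice G -> nice u -> I (fun w => G w + u w) = I G + I u.
Proof.
move=> nG nu; rewrite /I -RintegralD//; last exact: nice_int.
- by apply: eq_Rintegral => w _; rewrite mulrDl.
- exact: measurable_udisk.
- exact: nice_int.
Qed.

Let IZ c G : nice G -> I (fun w => c * G w) = c * I G.
Proof.
move=> nG; rewrite /I -RintegralZl//; last exact: nice_int.
- by apply: eq_Rintegral => w _; rewrite mulrA.
- exact: measurable_udisk.
Qed.

(** The bounded functions whose products with all moment functions are
orthogonal to [h].  As multiplication by a coordinate turns a moment function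
into a combination of two others, this class is closed under multiplication by
polynomials. *)
Let good G := nice G /\ forall a b,
  I (fun w => complex.Re (moment a b w) * G w) = 0 /\
  I (fun w => complex.Im (moment a b w) * G w) = 0.

Let good1 : good (fun=> 1).
Proof.
split; first exact: nice_cst.
move=> a b; have [h1 h2] := moment0 a b; rewrite -[X in _ = X /\ _]h1 -[X in _ /\ _ = X]h2.
by split; apply: eq_Rintegral => w _; rewrite mulr1.
Qed.

Let goodD G u : good G -> good u -> good (fun w => G w + u w).
Proof.
move=> [nG gG] [nu gu]; split; first exact: niceD.
move=> a b; have [m1 m2] := nice_moment a b.
have [G1 G2] := gG a b; have [u1 u2] := gu a b.
have E (F : plane R -> R) : nice F -> I (fun w => F w * (G w + u w)) =
    I (fun w => F w * G w) + I (fun w => F w * u w).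
  move=> nF; rewrite -ID; [|exact: niceM|exact: niceM].
  by apply: eq_Rintegral => w _; rewrite mulrDr.
by rewrite !E// G1 G2 u1 u2 addr0.
Qed.

Let goodZ c G : good G -> good (fun w => c * G w).
Proof.
move=> [nG gG]; split; first exact: niceM.
move=> a b; have [m1 m2] := nice_moment a b; have [G1 G2] := gG a b.
have E (F : plane R -> R) : nice F -> I (fun w => F w * (c * G w)) = c * I (fun w => F w * G w).
  move=> nF; rewrite -IZ; last exact: niceM.
  by apply: eq_Rintegral => w _; rewrite mulrCA.
by rewrite !E// G1 G2 mulr0.
Qed.

Let I_half G u F : nice G -> nice u -> nice F ->
  I (fun w => G w * F w) = 0 -> I (fun w => u w * F w) = 0 ->
  forall c, I (fun w => 2^-1 * (G w + c * u w) * F w) = 0.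
Proof.
move=> nG nu nF G0 u0 c.
transitivity (I (fun w => 2^-1 * (G w * F w + c * (u w * F w)))).
  by apply: eq_Rintegral => w _; congr (_ * _); ring.
rewrite IZ; last by apply: niceD; [exact: niceM|apply: niceM => //; exact: niceM].
rewrite ID; [|exact: niceM|by apply: niceM => //; exact: niceM].
by rewrite IZ ?G0 ?u0 ?mulr0 ?addr0 ?mulr0//; exact: niceM.
Qed.

Let good_fst G : good G -> good (fun w => w.1 * G w).
Proof.
move=> [nG gG]; split.
  by apply: niceM => //; split; [exact: measurable_fst|exact: dbounded_fst].
move=> a b; have [m1 m2] := nice_moment a.+1 b; have [m3 m4] := nice_moment a b.+1.
have [G1 G2] := gG a.+1 b; have [G3 G4] := gG a b.+1.
split.
  rewrite -[RHS](I_half m1 m3 nG G1 G3 1); apply: eq_Rintegral => w _.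
  by have [e _] := moment_mulx a b w; rewrite mulrA [_ * w.1]mulrC e mul1r.
rewrite -[RHS](I_half m2 m4 nG G2 G4 1); apply: eq_Rintegral => w _.
by have [_ e] := moment_mulx a b w; rewrite mulrA [_ * w.1]mulrC e mul1r.
Qed.

Let good_snd G : good G -> good (fun w => w.2 * G w).
Proof.
move=> [nG gG]; split.
  by apply: niceM => //; split; [exact: measurable_snd|exact: dbounded_snd].
move=> a b; have [m1 m2] := nice_moment a.+1 b; have [m3 m4] := nice_moment a b.+1.
have [G1 G2] := gG a.+1 b; have [G3 G4] := gG a b.+1.
split.
  rewrite -[RHS](I_half m2 m4 nG G2 G4 (-1)); apply: eq_Rintegral => w _.
  by have [e _] := moment_muly a b w; rewrite mulrA [_ * w.2]mulrC e mulN1r.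
rewrite -[RHS](I_half m3 m1 nG G3 G1 (-1)); apply: eq_Rintegral => w _.
by have [_ e] := moment_muly a b w; rewrite mulrA [_ * w.2]mulrC e mulN1r.
Qed.

Let multiplier u := forall G, good G -> good (fun w => u w * G w).

Let multiplier_eq u u' : u =1 u' -> multiplier u -> multiplier u'.
Proof. by move=> /funext ->. Qed.

Let multiplier_affine (u : plane R -> R) c d : multiplier u ->
  multiplier (fun w => c + d * u w).
Proof.
move=> mu G gG; rewrite (_ : (fun _ => _) = fun w => c * G w + d * (u w * G w)).
  by apply: goodD; [exact: goodZ|apply: goodZ; exact: mu].
by apply/funext => w; rewrite mulrDl mulrA.
Qed.

Let multiplierX u n : multiplier u -> multiplier (fun w => u w ^+ n).
Proof.
move=> mu; elim: n => [|n IHn] G gG.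
  rewrite (_ : (fun _ => _) = G)//.
  by apply/funext => w; rewrite expr0 mul1r.
rewrite (_ : (fun _ => _) = fun w => u w * (u w ^+ n * G w)).
  by apply: mu; exact: IHn.
by apply/funext => w; rewrite exprS mulrA.
Qed.

(** An affine function of [x] that maps [[-1, 1]] into [[0, 1]] and [s] to [2^-1],
the point where the step polynomials jump. *)
Let scaled (s x : R) := 2^-1 + (s - x) / (2 * (1 + `|s|)).

Let multiplier_step u s n : multiplier u ->
  multiplier (fun w => step_approx (scaled s (u w)) n).
Proof.
move=> mu; apply: multiplierX.
apply: (@multiplier_eq (fun w => 1 + (-1) * scaled s (u w) ^+ n)).
  by move=> w; rewrite mulN1r.
apply: multiplier_affine; apply: multiplierX.
pose k := (2 * (1 + `|s|))^-1.
apply: (@multiplier_eq (fun w => (2^-1 + s * k) + (- k) * u w)).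
  by move=> w; rewrite /scaled -/k; ring.
exact: multiplier_affine.
Qed.

Let scaled_itv s x : `|x| <= 1 -> 0 <= scaled s x <= 1.
Proof.
move=> x1; have s0 : 0 < 1 + `|s| by rewrite ltr_pwDl.
have : `|(s - x) / (2 * (1 + `|s|))| <= 2^-1.
  rewrite normrM normfV (@gtr0_norm _ (2 * (1 + `|s|))) ?mulr_gt0//.
  rewrite ler_pdivrMr ?mulr_gt0// mulKf//.
  by rewrite (le_trans (ler_normB _ _))// addrC lerD2r.
by rewrite /scaled ler_norml => /andP[? ?]; lra.
Qed.

Let scaled_cvg s x : `|x| <= 1 -> x != s ->
  step_approx (scaled s x) n @[n --> \oo] --> ((s < x)%R%:R : R).
Proof.
move=> x1 xs; have /andP[v0 v1] := scaled_itv s x1.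
have s0 : 0 < 2 * (1 + `|s|) by rewrite mulr_gt0// ltr_pwDl.
have [sx|] := ltP s x.
  apply: step_approx_lt; rewrite v0/= /scaled gtrDl pmulr_llt0 ?invr_gt0//.
  by rewrite subr_lt0.
rewrite le_eqVlt (negbTE xs)/= => sx.
apply: step_approx_gt; rewrite v1 andbT /scaled ltrDl divr_gt0// subr_gt0//.
Qed.

Let quadrant0 s t :
  (\int[lam R]_(w in udisk) (\1_(quadrant s t) w * h w)%:E = 0)%E.
Proof.
have [K hK] := bh.
pose G n w := step_approx (scaled s w.1) n * step_approx (scaled t w.2) n.
have gG n : good (G n).
  have mfst : multiplier fst by exact: good_fst.
  have msnd : multiplier snd by exact: good_snd.
  apply: (multiplier_step _ _ mfst).
  have := multiplier_step t n msnd good1.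
  by congr good; apply/funext => w; rewrite mulr1.
have IG n : (\int[lam R]_(w in udisk) (G n w * h w)%:E = 0)%E.
  have [nG /(_ 0%N 0%N)[IG0 _]] := gG n.
  have fin : (\int[lam R]_(w in udisk) (G n w * h w)%:E)%E \is a fin_num.
    by apply: integrable_fin_num; [exact: measurable_udisk|exact: nice_int].
  rewrite -(fineK fin); congr EFin; rewrite -[RHS]IG0.
  by apply: eq_Rintegral => w _; rewrite /moment !expr0 mul1r /= mul1r.
have mD := @measurable_udisk R.
have [] := @dominated_convergence _ _ _ (lam R) udisk mD
    (fun n w => (G n w * h w)%:E) (fun w => (\1_(quadrant s t) w * h w)%:E)
    (fun=> `|K|%:E).
- move=> n; apply/measurable_EFinP; apply: measurable_funTS.
  by apply: measurable_funM => //; have [[]] := gG n.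
- apply/measurable_EFinP; apply: measurable_funTS.
  apply: measurable_funM => //; apply: measurable_indic.
  by apply: closed_measurable2; exact: closed_quadrant.
- apply: ae_imply2 (ae_fst_neq s) (ae_snd_neq t) => w w1 w2 wD.
  apply: cvg_EFin; first exact: nearW.
  apply: cvgM; last exact: cvg_cst.
  have [b1 _] := moment_bounds 1 0 wD.
  have [_ b2] := moment_bounds 1 0 wD.
  rewrite /moment expr0 mulr1 /= in b1 b2.
  have <- : (s < w.1)%R%:R * (t < w.2)%R%:R = \1_(quadrant s t) w :> R.
    rewrite -natrM mulnb indicE; congr (_ %:R); congr nat_of_bool.
    apply/idP/idP => [/andP[h1 h2]|].
      by rewrite inE; split; rewrite /= in_itv/= andbT ltW.
    rewrite inE => -[/=]; rewrite !in_itv/= !andbT !le_eqVlt.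
    by rewrite ![_ == w.1]eq_sym ![_ == w.2]eq_sym (negbTE w1) (negbTE w2)/= => -> ->.
  exact: cvgM (scaled_cvg b1 w1) (scaled_cvg b2 w2).
- apply/integrableP; split; first exact: measurable_cst.
  rewrite integral_cst//; apply: lte_mul_pinfty => //.
  exact: lam_udisk_fin.
- apply: nearW => w n wD; rewrite abse_EFin lee_fin normrM /G.
  have [b1 _] := moment_bounds 1 0 wD.
  have [_ b2] := moment_bounds 1 0 wD.
  rewrite /moment expr0 mulr1 /= in b1 b2.
  have /andP[s0 s1] := step_approx_itv n (scaled_itv s b1).
  have /andP[t0 t1] := step_approx_itv n (scaled_itv t b2).
  rewrite ger0_norm ?mulr_ge0// -[leRHS]mul1r ler_pM ?mulr_ge0 ?mulr_ile1//.
  by rewrite (le_trans (hK w wD))// ler_norm.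
move=> _ _; rewrite (_ : [sequence _]_n = fun=> 0%E); last first.
  by apply/funext => n; exact: IG.
by move=> /cvg_lim <-//; rewrite lim_cst.
Qed.

(** The positive and negative parts of [h] are densities of two finite measures.
They agree on quadrants, by approximating the indicator of a quadrant by
polynomials, and hence on all Borel sets. *)
Lemma moments_determine : ae_eq (lam R) udisk (EFin \o h) (cst 0%E).
Proof.
have mD := @measurable_udisk R.
have mI : measurable_fun setT (\1_udisk : plane R -> R) by exact: measurable_indic.
pose pos (f : plane R -> R) w : \bar R := (Num.max (f w) 0 * \1_udisk w)%:E.
have mpos f : measurable_fun setT f -> measurable_fun setT (pos f).
  move=> mf; apply/measurable_EFinP; apply: measurable_funM => //.
  exact: measurable_maxr.
have pos0 f w : (0 <= pos f w)%E by rewrite lee_fin mulr_ge0// le_max lexx orbT.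
have mhN : measurable_fun setT (fun w => - h w) by exact: measurable_funN.
pose m1 := density_measure (lam R) (mpos _ mh) (pos0 h).
pose m2 := density_measure (lam R) (mpos _ mhN) (pos0 (fun w => - h w)).
have posE f E : (density (lam R) (pos f) E =
    \int[lam R]_(w in udisk) (Num.max (\1_E w * f w) 0)%:E)%E.
  rewrite /density integral_mkcond [RHS]integral_mkcond; apply: eq_integral => w _.
  rewrite !epatch_indic /pos /= -!EFinM; congr EFin.
  rewrite [\1_E w]indicE; case: (w \in E); first by rewrite mul1r mulr1.
  by rewrite !mul0r mulr0 maxxx mul0r.
have key E : measurable E -> [/\ m1 E \is a fin_num, m2 E \is a fin_num &
    (\int[lam R]_(w in udisk) (\1_E w * h w)%:E = m1 E - m2 E)%E].
  move=> mE; have nE : nice (\1_E).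
    split; first exact: measurable_indic.
    by exists 1 => w _; rewrite indicE; case: (_ \in _); rewrite ?normr1 ?normr0.
  have intE := nice_int nE.
  have e1 : m1 E = (\int[lam R]_(w in udisk) (EFin \o (fun w => (\1_E w * h w)%R))^\+ w)%E.
    rewrite -[LHS]/(density (lam R) (pos h) E) posE.
    by apply: eq_integral => w _; rewrite funeposE /= EFin_max.
  have e2 : m2 E = (\int[lam R]_(w in udisk) (EFin \o (fun w => (\1_E w * h w)%R))^\- w)%E.
    rewrite -[LHS]/(density (lam R) (pos (fun w => - h w)) E) posE.
    by apply: eq_integral => w _; rewrite funenegE /= EFin_max mulrN.
  split; last by rewrite integralE -e1 -e2.
    by rewrite e1; exact: integrable_pos_fin_num.
  by rewrite e2; exact: integrable_neg_fin_num.
have m12 E : measurable E -> m1 E = m2 E.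
  apply: measure_eq_quadrants; last first.
    by have [+ _ _] := key _ measurableT; rewrite ge0_fin_numE.
  move=> s t; have mQ : measurable (quadrant s t).
    by apply: closed_measurable2; exact: closed_quadrant.
  have [f1 f2] := key _ mQ; rewrite quadrant0.
  rewrite -(fineK f1) -(fineK f2) -EFinB => -[] /esym/eqP.
  by rewrite subr_eq0 => /eqP ->.
apply: integral_ae_eq => //.
  exact: dbounded_integrable.
move=> E ED mE; have [f1 f2] := key _ mE.
rewrite m12// subee// => intE.
rewrite [RHS]integral0_eq// -[RHS]intE.
rewrite integral_mkcond [RHS]integral_mkcond; apply: eq_integral => w _.
rewrite !epatch_indic /= -!EFinM; congr EFin; rewrite !indicE.
have [wE|wE] := boolP (w \in E); last by rewrite mulr0 !mul0r.
by rewrite mem_set ?mul1r//; apply: ED; rewrite inE in wE.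
Qed.

End determinacy.

(** * Trigonometric integrals *)

Section trigonometric_integrals.
Context {R : realType}.
Local Notation leb := (@lebesgue_measure R).

Lemma cos_sin_nat2pi n : cos (n%:R * (2 * pi) : R) = 1 /\ sin (n%:R * (2 * pi) : R) = 0.
Proof.
elim: n => [|n [IH1 IH2]]; first by rewrite mul0r cos0 sin0.
rewrite -natr1 mulrDl mul1r [2 * pi in X in _ + X]mulr_natl cosD2pi sinD2pi.
by rewrite IH1 IH2.
Qed.

Lemma is_derive_mull (f : R -> R) (k t l : R) : is_derive t 1 f l ->
  is_derive t 1 (fun t => k * f t) (k * l).
Proof. by move=> df; exact: (is_deriveZ k df). Qed.

Lemma is_derive_scale (f : R -> R) (k t l : R) : is_derive (k * t) 1 f l ->
  is_derive t 1 (fun t => f (k * t)) (k * l).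
Proof.
move=> df; rewrite mulrC; apply: (@is_derive1_comp R f (fun t => k * t)) => //.
by have := is_derive_mull k (is_derive_id t (1 : R)); rewrite mulr1.
Qed.

Lemma periodic_primitive_integral (F f : R -> R) : F 0 = F (2 * pi) ->
  (forall t : R, is_derive t 1 F (f t)) -> continuous f ->
  (\int[leb]_(t in `]0%R, (2 * pi)%R[) (f t)%:E = 0)%E.
Proof.
move=> F02 dF cf; have pi2 : 0 < 2 * pi :> R by rewrite mulr_gt0// pi_gt0.
rewrite -(@integral_itv_bndoo _ _ _ _ true false); last first.
  by apply/measurable_EFinP; apply: measurable_funTS; exact: continuous_measurable_fun.
have cF : continuous F.
  by move=> t; apply/differentiable_continuous/derivable1_diffP; exact: ex_derive.
rewrite (continuous_FTC2 pi2 (F := F)).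
- by rewrite F02 subee.
- exact: continuous_subspaceT.
- split.
  + by move=> t _; exact: ex_derive.
  + by apply: cvg_at_right_filter; exact: cF.
  + by apply: cvg_at_left_filter; exact: cF.
- by move=> t _; rewrite derive1E; exact: derive_val.
Qed.

Lemma continuous_scale (f : R -> R) (k : R) : continuous f ->
  continuous (fun t : R => f (k * t)).
Proof. by move=> cf t; apply: continuous_comp; [apply: cvgMr|exact: cf]. Qed.

Lemma trig_integral (a b : nat) : a <> b ->
  (\int[leb]_(t in `]0%R, (2 * pi)%R[) (cos ((a%:R - b%:R) * t))%:E = 0)%E /\
  (\int[leb]_(t in `]0%R, (2 * pi)%R[) (sin ((a%:R - b%:R) * t))%:E = 0)%E.
Proof.
move=> ab; set k : R := a%:R - b%:R.
have k0 : k != 0 by rewrite subr_eq0 eqr_nat; apply/eqP.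
have [ca sa] := cos_sin_nat2pi a; have [cb sb] := cos_sin_nat2pi b.
have s2 : sin (k * (2 * pi)) = 0 by rewrite mulrBl sinB sa sb mul0r mulr0 subrr.
have c2 : cos (k * (2 * pi)) = 1 by rewrite mulrBl cosB ca cb sa sb mulr1 mulr0 addr0.
split.
  apply: (periodic_primitive_integral (F := fun t => k^-1 * sin (k * t))).
  - by rewrite mulr0 sin0 s2.
  - move=> t; have := is_derive_mull k^-1 (is_derive_scale (is_derive_sin (k * t))).
    by rewrite mulKf.
  - by apply: continuous_scale; exact: continuous_cos.
apply: (periodic_primitive_integral (F := fun t => - k^-1 * cos (k * t))).
- by rewrite mulr0 cos0 c2.
- move=> t; have := is_derive_mull (- k^-1) (is_derive_scale (is_derive_cos (k * t))).
  by rewrite mulrN mulrNN mulKf.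
- by apply: continuous_scale; exact: continuous_sin.
Qed.

End trigonometric_integrals.

(** * Moments of radial functions *)

Section radial.
Context {R : realType}.
Local Notation leb := (@lebesgue_measure R).
Implicit Types (w : plane R) (m : plane R -> R).

Lemma cplx_polarX (r t : R) n :
  cplx (polar (r, t)) ^+ n = Complex (r ^+ n * cos (n%:R * t)) (r ^+ n * sin (n%:R * t)).
Proof.
elim: n => [|n IHn]; first by rewrite !expr0 mul0r cos0 sin0 mulr1 mulr0.
rewrite !exprS IHn -natr1 mulrDl mul1r cosD sinD /cplx /polar/=.
by apply/eqP; rewrite eq_complex/=; apply/andP; split; apply/eqP; ring.
Qed.

Lemma moment_polar a b (r t : R) :
  complex.Re (moment a b (polar (r, t))) = r ^+ (a + b) * cos ((a%:R - b%:R) * t) /\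
  complex.Im (moment a b (polar (r, t))) = r ^+ (a + b) * sin ((a%:R - b%:R) * t).
Proof.
have conjX (z : R[i]) : Num.conj z ^+ b = Num.conj (z ^+ b) by rewrite rmorphXn.
rewrite /moment conjX !cplx_polarX complexRe_mul complexIm_mul.
rewrite complexRe_conj complexIm_conj /=.
by rewrite exprD mulrBl cosB sinB; split; ring.
Qed.

Lemma measurable_polar_slice m (r : R) : measurable_fun setT m ->
  measurable_fun setT (fun t : measurableTypeR R => m (polar (r, t))).
Proof.
move=> mm; apply: (measurableT_comp mm); apply: (measurableT_comp measurable_polar).
exact: pair1_measurable.
Qed.

Lemma polar_integral0 (F m : plane R -> R) (K L : R) :
  measurable_fun setT F -> measurable_fun setT m ->
  (forall w, udisk w -> `|F w| <= K) -> (forall w, udisk w -> `|m w| <= L) ->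
  {ae leb, forall r, 0 < r < 1 ->
    (\int[leb]_(t in `]0%R, (2 * pi)%R[)
      (F (polar (r, t)) * m (polar (r, t)) * r)%:E = 0)%E} ->
  (\int[lam R]_(w in udisk) (F w * m w)%:E = 0)%E.
Proof.
move=> mF mm FK mL ae0.
have mFm : measurable_fun setT (fun w => F w * m w) by exact: measurable_funM.
rewrite -(polar_integral mFm).
have [|p Dp|mI ->] := @polar_fubini R (fun p => F (polar p) * m (polar p) * p.1) (K * L).
- apply: measurable_funM => //.
  exact: (measurableT_comp mFm measurable_polar).
- have pD := polar_disk Dp; case: Dp => /=; rewrite in_itv/= => /andP[p0 p1] _.
  rewrite !normrM -[leRHS]mulr1 ler_pM ?mulr_ge0//; last by rewrite gtr0_norm// ltW.
  by rewrite ler_pM ?FK ?mL.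
rewrite (ae_eq_integral (cst 0%E)) ?integral0//.
Qed.

Lemma angular_integral0 (f : R -> R) m (r g : R) : measurable_fun setT m ->
  continuous f -> (\int[leb]_(t in `]0%R, (2 * pi)%R[) (f t)%:E = 0)%E ->
  {ae leb, forall t, 0 <= t <= 2 * pi -> m (polar (r, t)) = g} ->
  forall c : R,
  (\int[leb]_(t in `]0%R, (2 * pi)%R[) (c * f t * m (polar (r, t)) * r)%:E = 0)%E.
Proof.
move=> mm cf f0 aeg c; have mf := continuous_measurable_fun cf.
transitivity (\int[leb]_(t in `]0%R, (2 * pi)%R[) ((c * g * r)%:E * (f t)%:E))%E.
  apply: ae_eq_integral => //.
  - apply/measurable_EFinP; apply: measurable_funTS; apply: measurable_funM => //.
    apply: measurable_funM; last exact: measurable_polar_slice.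
    exact: measurable_funM.
  - apply/measurable_EFinP; apply: measurable_funTS.
    by apply: measurable_funM => //; exact: mf.
  - apply: ae_imply aeg => t tg; rewrite /= in_itv/= => /andP[t0 t1].
    by rewrite tg ?ltW// -EFinM; congr EFin; ring.
rewrite integralZl ?f0 ?mule0//.
apply: (@integrableS _ _ _ leb `[0, 2 * pi]) => //.
  exact: subset_itv_oo_cc.
apply: continuous_compact_integrable; first exact: segment_compact.
exact: continuous_subspaceT.
Qed.

(** On the circle of radius [r] the moment function of orders [a] and [b] is
[r ^ (a + b)] times the exponential of [i (a - b) t], which has mean zero, and
[m] is constant. *)
Lemma radial_moment0 m (L : R) (g : R -> R) a b :
  measurable_fun setT m -> (forall w, udisk w -> `|m w| <= L) ->
  {ae leb, forall r, 0 <= r < 1 ->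
    {ae leb, forall t, 0 <= t <= 2 * pi -> m (polar (r, t)) = g r}} ->
  a <> b ->
  (\int[lam R]_(w in udisk) (complex.Re (moment a b w) * m w)%:E = 0)%E /\
  (\int[lam R]_(w in udisk) (complex.Im (moment a b w) * m w)%:E = 0)%E.
Proof.
move=> mm mL aeg ab.
have [mRe mIm] := @measurable_moment R a b.
have [int_cos int_sin] := @trig_integral R a b ab.
split; apply: (@polar_integral0 _ _ 1 L) => //.
- by move=> w /(moment_bounds a b)[].
- apply: ae_imply aeg => r rg /andP[r0 r1].
  under eq_integral do rewrite (moment_polar a b _ _).1.
  apply: angular_integral0 => //; first by apply: continuous_scale; exact: continuous_cos.
  by apply: rg; rewrite r1 ltW.
- by move=> w /(moment_bounds a b)[].
- apply: ae_imply aeg => r rg /andP[r0 r1].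
  under eq_integral do rewrite (moment_polar a b _ _).2.
  apply: angular_integral0 => //; first by apply: continuous_scale; exact: continuous_sin.
  by apply: rg; rewrite r1 ltW.
Qed.

Definition circle_mean m (r : R) : R :=
  fine (\int[leb]_(t in `]0%R, (2 * pi)%R[) (m (polar (r, t)))%:E)%E / (2 * pi).

Let leb_circle : (leb `]0%R, (2 * pi)%R[%classic = (2 * pi)%:E)%E.
Proof.
rewrite lebesgue_measure_itv/= lte_fin mulr_gt0 ?pi_gt0//.
by rewrite -EFinD subr0.
Qed.

Let circle_int m (L : R) r : measurable_fun setT m -> (forall w, 0 <= m w <= L) ->
  (\int[leb]_(t in `]0%R, (2 * pi)%R[) (m (polar (r, t)))%:E = (2 * pi * circle_mean m r)%:E)%E
  /\ 0 <= circle_mean m r <= L.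
Proof.
move=> mm mL; have pi2 : 0 < 2 * pi :> R by rewrite mulr_gt0// pi_gt0.
have le : (\int[leb]_(t in `]0%R, (2 * pi)%R[) (m (polar (r, t)))%:E <= (L * (2 * pi))%:E)%E.
  rewrite EFinM -leb_circle -integral_cst//; apply: ge0_le_integral => //.
  - by move=> t _; rewrite lee_fin; have /andP[] := mL (polar (r, t)).
  - apply/measurable_EFinP; apply: measurable_funTS; exact: measurable_polar_slice.
  - by move=> t _; rewrite lee_fin; have /andP[] := mL (polar (r, t)).
have ge : (0 <= \int[leb]_(t in `]0%R, (2 * pi)%R[) (m (polar (r, t)))%:E)%E.
  by apply: integral_ge0 => t _; rewrite lee_fin; have /andP[] := mL (polar (r, t)).
rewrite /circle_mean; move: le ge; case: (\int[leb]_(t in _) _)%E => [x||]//=.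
rewrite !lee_fin => le ge; rewrite [_ * (x / _)]mulrC divfK ?gt_eqF//.
by split => //; rewrite divr_ge0 ?(ltW pi2)//= ler_pdivrMr.
Qed.

Let measurable_circle_mean m (L : R) : measurable_fun setT m -> (forall w, 0 <= m w <= L) ->
  measurable_fun setT (circle_mean m : measurableTypeR R -> R).
Proof.
move=> mm mL; apply: measurable_funM => //.
pose F (p : plane R) : \bar R := ((m (polar p))%:E * (\1_(setT `*` `]0%R, (2 * pi)%R[) p)%:E)%E.
have mF : measurable_fun setT F.
  apply: emeasurable_funM.
    by apply/measurable_EFinP; exact: (measurableT_comp mm measurable_polar).
  by apply/measurable_EFinP; apply: measurable_indic; exact: measurableX.
have F0 p : (0 <= F p)%E.
  by rewrite mule_ge0// lee_fin; have /andP[] := mL (polar p).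
have := measurable_fun_fubini_tonelli_F (m2 := leb) F mF F0.
rewrite (_ : fubini_F leb F =
    fun r => (\int[leb]_(t in `]0%R, (2 * pi)%R[) (m (polar (r, t)))%:E)%E) => [mH|].
  exact: (measurableT_comp (fine_measurable measurableT) mH).
apply/funext => r; rewrite /fubini_F [RHS]integral_mkcond epatch_indic.
apply: eq_integral => t _; rewrite /F /=; congr (_ * _%:E)%E.
rewrite !indicE; congr (nat_of_bool _)%:R.
by apply/idP/idP; rewrite !inE; [case|split].
Qed.

(** Let [g] be the radial function given by the circle means of [m].  The moments
of [m - g] with [a = b] vanish because [m - g] has mean zero on each circle, the
others because both [m] and [g] have none; so [m - g] is zero almost
everywhere. *)
Lemma moments0_radial m (L : R) : measurable_fun setT m -> (forall w, 0 <= m w <= L) ->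
  (forall a b, a <> b ->
    (\int[lam R]_(w in udisk) (complex.Re (moment a b w) * m w)%:E = 0)%E /\
    (\int[lam R]_(w in udisk) (complex.Im (moment a b w) * m w)%:E = 0)%E) ->
  (forall r, 0 <= circle_mean m r) /\
  {ae leb, forall r, 0 <= r < 1 ->
    {ae leb, forall t, 0 <= t <= 2 * pi -> m (polar (r, t)) = circle_mean m r}}.
Proof.
move=> mm mL mom; split=> [r|]; first by have [_ /andP[]] := circle_int r mm mL.
pose rad (w : plane R) : R := Num.sqrt (w.1 ^+ 2 + w.2 ^+ 2).
have mrad : measurable_fun setT rad.
  apply: (measurableT_comp (continuous_measurable_fun (@sqrt_continuous R))).
  by apply: measurable_funD; apply: measurable_funX.
have rad_polar r t : 0 <= r -> rad (polar (r, t)) = r.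
  move=> r0; rewrite /rad /polar/= !exprMn -mulrDr cos2Dsin2 mulr1.
  by rewrite sqrtr_sqr ger0_norm.
pose g w := circle_mean m (rad w).
have mg : measurable_fun setT g.
  exact: (measurableT_comp (measurable_circle_mean mm mL) mrad).
have gL w : 0 <= g w <= L by have [] := circle_int (rad w) mm mL.
have norm_le (f : plane R -> R) : (forall w, 0 <= f w <= L) -> forall w, udisk w -> `|f w| <= L.
  by move=> fL w _; have /andP[f0 fL'] := fL w; rewrite ger0_norm.
pose h w := m w - g w.
have mh : measurable_fun setT h by exact: measurable_funB.
have hL w : udisk w -> `|h w| <= L + L.
  by move=> wD; rewrite (le_trans (ler_normB _ _))// lerD ?norm_le.
have bh : dbounded h by exists (L + L).
have gpol : {ae leb, forall r, 0 <= r < 1 ->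
    {ae leb, forall t, 0 <= t <= 2 * pi -> g (polar (r, t)) = circle_mean m r}}.
  apply: aeW => r /andP[r0 _]; apply: aeW => t _.
  by rewrite /g rad_polar.
have hmom a b :
    (\int[lam R]_(w in udisk) (complex.Re (moment a b w) * h w)%:E = 0)%E /\
    (\int[lam R]_(w in udisk) (complex.Im (moment a b w) * h w)%:E = 0)%E.
  have [mRe mIm] := @measurable_moment R a b.
  have Reb w : udisk w -> `|complex.Re (moment a b w)| <= 1 by case/(moment_bounds a b).
  have Imb w : udisk w -> `|complex.Im (moment a b w)| <= 1 by case/(moment_bounds a b).
  have [ab|/eqP ab] := eqVneq a b.
    subst b; split.
      apply: (@polar_integral0 _ _ 1 (L + L)) => //.
      apply: aeW => r /andP[r0 r1].
      have [intm _] := circle_int r mm mL.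
      have mslice : measurable_fun setT (fun t : measurableTypeR R => m (polar (r, t))).
        exact: measurable_polar_slice.
      transitivity (\int[leb]_(t in `]0%R, (2 * pi)%R[)
          ((r ^+ (a + a) * r)%:E * (m (polar (r, t)) - circle_mean m r)%:E))%E.
        apply: eq_integral => t _; rewrite (moment_polar a a r t).1 subrr mul0r cos0 /h /g.
        by rewrite rad_polar ?(ltW r0)// -EFinM; congr EFin; ring.
      have intb (f : R -> R) K : measurable_fun setT (f : measurableTypeR R -> R) ->
          (forall t, `|f t| <= K) -> leb.-integrable `]0, 2 * pi[ (EFin \o f).
        move=> mf fK; apply: measurable_bounded_integrable => //.
        - by rewrite /= leb_circle ltry.
        - exact: measurable_funTS.
        - exists K; split; first exact: num_real.
          by move=> x Kx t _ /=; rewrite (le_trans (fK t))// ltW.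
      have mb t : `|m (polar (r, t))| <= L.
        by have /andP[f0 fL'] := mL (polar (r, t)); rewrite ger0_norm.
      have im := intb (fun t => m (polar (r, t))) L mslice mb.
      have ic := intb (fun=> circle_mean m r) `|circle_mean m r|
        (measurable_cst _) (fun=> lexx _).
      rewrite integralZl//; last exact: (integrableB _ im ic).
      rewrite (_ : (\int[leb]_(t in _) _ = 0)%E) ?mule0//.
      rewrite (integralB_EFin _ im ic)// intm integral_cst//= leb_circle.
      by rewrite -EFinM -EFinB mulrC subrr.
    apply: (@polar_integral0 _ _ 1 (L + L)) => //.
    apply: aeW => r _; apply: integral0_eq => t _.
    by rewrite (moment_polar a a r t).2 subrr mul0r sin0 mulr0 !mul0r.
  have [m1 m2] := mom a b ab.
  have [g1 g2] := radial_moment0 mg (norm_le _ gL) gpol ab.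
  have intM (F f : plane R -> R) : measurable_fun setT F -> measurable_fun setT f ->
      (forall w, udisk w -> `|F w| <= 1) -> (forall w, 0 <= f w <= L) ->
      (lam R).-integrable udisk (EFin \o (fun w => F w * f w)).
    move=> mF mf Fb fL; apply: dbounded_integrable; first exact: measurable_funM.
    exists (1 * L) => w wD; rewrite normrM ler_pM ?Fb//.
    exact: norm_le.
  have E (F : plane R -> R) : measurable_fun setT F -> (forall w, udisk w -> `|F w| <= 1) ->
      (\int[lam R]_(w in udisk) (F w * m w)%:E = 0)%E ->
      (\int[lam R]_(w in udisk) (F w * g w)%:E = 0)%E ->
      (\int[lam R]_(w in udisk) (F w * h w)%:E = 0)%E.
    move=> mF Fb Fm Fg.
    transitivity (\int[lam R]_(w in udisk) (F w * m w - F w * g w)%:E)%E.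
      by apply: eq_integral => w _; rewrite mulrBr.
    rewrite (integralB_EFin _ (intM _ _ mF mm Fb mL) (intM _ _ mF mg Fb gL)).
      by rewrite Fm Fg subee.
    exact: measurable_udisk.
  by split; exact: E.
have moment0 a b :
    (\int[lam R]_(w in udisk) (complex.Re (moment a b w) * h w)) = 0 /\
    (\int[lam R]_(w in udisk) (complex.Im (moment a b w) * h w)) = 0.
  by have [h1 h2] := hmom a b; rewrite /Rintegral h1 h2.
have [Z [mZ Z0 hZ]] := moments_determine mh bh moment0.
have : (lam R).-negligible ([set w | h w <> 0] `&` udisk).
  exists Z; split => // w [hw wD]; apply: hZ => /= hw0.
  apply: hw; by have [] := hw0 wD.
move=> /ae_polar; apply: ae_imply => r hr /[dup] r01 /hr; apply: ae_imply => t ht /ht.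
move=> /= /contrapT; rewrite /h /g => /eqP; rewrite subr_eq0 => /eqP ->.
by rewrite rad_polar//; case/andP: r01.
Qed.

End radial.

(** * Complex derivatives as real differentials *)

Section complex_plane.
Context {R : realType}.
Implicit Types (p q w : plane R) (z : R[i]).

Definition uncplx z : plane R := (complex.Re z, complex.Im z).

Lemma cplxK : cancel (@cplx R) uncplx.
Proof. by case. Qed.

Lemma uncplxK : cancel uncplx (@cplx R).
Proof. by case. Qed.

Lemma normcE z : `|z| = (Normc.normc z)%:C%C.
Proof. by []. Qed.

Lemma normc_sqr z : Normc.normc z ^+ 2 = complex.Re z ^+ 2 + complex.Im z ^+ 2.
Proof. by case: z => a b /=; rewrite sqr_sqrtr// addr_ge0 ?sqr_ge0. Qed.

Lemma normc_ge0 z : 0 <= Normc.normc z.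
Proof. by case: z => a b; exact: sqrtr_ge0. Qed.

Lemma unit_diskE z : unit_disk z <-> udisk (uncplx z).
Proof.
rewrite /unit_disk /udisk/= normcE (ltcR (Normc.normc z) 1) -normc_sqr.
split => h; first by rewrite exprn_ilt1 ?normc_ge0.
by rewrite -(@ltr_pXn2r _ 2) ?nnegrE ?normc_ge0// expr1n.
Qed.

Lemma plane_disk_udisk : @plane_disk R = udisk.
Proof.
apply/seteqP; split => p; first by move=> /unit_diskE; rewrite cplxK.
by move=> pD; apply/unit_diskE; rewrite cplxK.
Qed.

Lemma normc_le_plane p : Normc.normc (cplx p) <= 2 * `|p|.
Proof.
rewrite -(@ler_pXn2r _ 2) ?nnegrE ?normc_ge0 ?mulr_ge0// normc_sqr /=.
have sq (a : R) : `|a| <= `|p| -> a ^+ 2 <= `|p| ^+ 2.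
  by move=> ap; rewrite -[a ^+ 2]real_normK ?num_real// ler_pXn2r ?nnegrE.
have := sq _ (plane_norm1 p); have := sq _ (plane_norm2 p).
have := sqr_ge0 `|p|; rewrite exprMn; nra.
Qed.

Lemma plane_le_normc z : `|uncplx z| <= Normc.normc z.
Proof.
have h (a b : R) : a ^+ 2 + b ^+ 2 = Normc.normc z ^+ 2 -> `|a| <= Normc.normc z.
  move=> ab; rewrite -(@ler_pXn2r _ 2) ?nnegrE ?normc_ge0// real_normK ?num_real//.
  by rewrite -ab lerDl sqr_ge0.
rewrite plane_norm_le; apply/andP; split.
  by apply: (h _ (complex.Im z)); rewrite normc_sqr.
by apply: (h _ (complex.Re z)); rewrite normc_sqr addrC.
Qed.

(** The real 2 x 2 matrix of multiplication by a complex number. *)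
Definition cmat z : @mat R :=
  ((complex.Re z, - complex.Im z), (complex.Im z, complex.Re z)).

Lemma detm_cmat z : detm (cmat z) = Normc.normc z ^+ 2.
Proof. by rewrite normc_sqr /detm /cmat /=; ring. Qed.

Lemma linm_cmat z p : linm (cmat z) p = uncplx (cplx p * z).
Proof. by case: z => a b; rewrite /linm /lin /cmat /uncplx/=; congr pair; ring. Qed.

Lemma detm_cmat_eq0 z : detm (cmat z) = 0 -> cmat z = ((0, 0), (0, 0)).
Proof.
rewrite detm_cmat => /eqP; rewrite sqrf_eq0 => /eqP /Normc.eq0_normc ->.
by rewrite /cmat /= oppr0.
Qed.

Definition plane_map (phi : R[i] -> R[i]) p : plane R := uncplx (phi (cplx p)).

Lemma cderiveE (phi : R[i] -> R[i]) z : cderive phi z = 'D_1 (phi : R[i]^o -> R[i]^o) z.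
Proof. by rewrite /cderive derive1E. Qed.

(** The differential of a complex differentiable function is the multiplication by
its derivative. *)
Lemma has_diff_complex (phi : R[i] -> R[i]) p :
  derivable (phi : R[i]^o -> R[i]^o) (cplx p) 1 ->
  has_diff (plane_map phi) p (cmat (cderive phi (cplx p))).
Proof.
move=> dphi e e0.
have e20 : 0 < (e / 2)%:C%C by rewrite ltcR divr_gt0.
have [d d0 hd] := derivable_approx dphi e20.
have [dr dr0 dE] : exists2 dr : R, 0 < dr & d = dr%:C%C.
  by move: d0; case: (d) => a b; rewrite ltcE/= => /andP[/eqP -> a0]; exists a.
exists (dr / 2); first by rewrite divr_gt0.
move=> q qd; pose h := cplx (q - p).
have hq : h + cplx p = cplx q.
  by rewrite /h /cplx /=; apply/eqP; rewrite eq_complex/= !subrK !eqxx.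
have hn : Normc.normc h <= 2 * `|q - p| := normc_le_plane (q - p).
have := hd h; rewrite -cderiveE hq !normcE dE ltcR -rmorphM lecR => hd'.
have {}hd' := hd' _.
rewrite linm_cmat -/h.
have -> : plane_map phi q - plane_map phi p - uncplx (h * cderive phi (cplx p)) =
    uncplx (phi (cplx q) - phi (cplx p) - h * cderive phi (cplx p)).
  by rewrite /plane_map /uncplx; apply/pair_equal_spec; split; rewrite !raddfB.
rewrite (le_trans (plane_le_normc _))// (le_trans (hd' _))//.
  by rewrite (le_lt_trans hn)// mulrC -ltr_pdivlMr.
rewrite (le_trans (ler_wpM2l _ hn)) ?divr_ge0 ?(ltW e0)//.
by rewrite mulrA divfK.
Qed.

(** A partial derivative is the limit of measurable difference quotients. *)
Lemma measurable_partial (U : set (plane R)) (g l : plane R -> R) : open U ->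
  measurable_fun U g ->
  (forall p, U p -> forall e, 0 < e -> exists2 d, 0 < d & forall s, 0 < s < d ->
     `|g (p + (s, 0)) - g p - s * l p| <= e * s) ->
  measurable_fun U l.
Proof.
move=> oU mg gl; have mU := open_measurable2 oU.
have mg' : measurable_fun setT (g \_ U) by apply/(measurable_restrictT _ mU).
pose s n : R := n.+1%:R^-1.
have s0 n : 0 < s n by exact: natinv_gt0.
apply: (@measurable_fun_cvg _ _ _ _
  (fun n p => (s n)^-1 * ((g \_ U) (p + (s n, 0)) - (g \_ U) p))) => [n|p Up].
  apply: measurable_funTS; apply: measurable_funM => //.
  apply: measurable_funB => //; apply: (measurableT_comp mg').
  apply/measurable_fun_pairP; split => /=; first exact: measurable_funD.
  by apply: measurable_funD.
apply/cvgrPdist_le => e e0; have [d d0 hd] := gl p Up e e0.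
have /plane_openP/(_ p Up)[d' d'0 dU] := oU.
have dd0 : 0 < Num.min d d' by rewrite lt_min d0.
have [N Nd] := natinv_lt dd0.
exists N => // n /= Nn.
have snd : s n < Num.min d d'.
  by apply: le_lt_trans Nd; rewrite lef_pV2 ?posrE ?ltr0n// ler_nat ltnS.
move: snd; rewrite lt_min => /andP[sd sd'].
have Uq : U (p + (s n, 0)).
  apply: dU; rewrite addrC addKr plane_norm_lt/= normr0 gtr0_norm// sd'.
  exact: d'0.
rewrite !patchE !mem_set//.
have := hd (s n); rewrite s0 sd => /(_ isT) h.
rewrite -(ler_pM2l (s0 n)) [leRHS]mulrC; apply: le_trans h.
rewrite -[X in X * _](gtr0_norm (s0 n)) -normrM -normrN le_eqVlt; apply/orP; left.
apply/eqP; congr (`|_|); rewrite mulrBr opprB mulVKf ?gt_eqF//.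
Qed.

Lemma counting_uncplx (S : set R[i]) :
  counting S = counting (@cplx R @^-1` S : set (plane R)) :> \bar R.
Proof.
have SE : S = @cplx R @` (@cplx R @^-1` S).
  by apply/seteqP; split => [z Sz|_ [p Sp <-]//]; exists (uncplx z); rewrite /= uncplxK.
have finE : finite_set S <-> finite_set (@cplx R @^-1` S : set (plane R)).
  split => [fS|fP]; last by rewrite SE; exact: finite_image.
  rewrite (_ : @cplx R @^-1` S = uncplx @` S); first exact: finite_image.
  apply/seteqP; split => [p Sp|_ [z Sz <-]]; last by rewrite /= uncplxK.
  by exists (cplx p) => //; exact: cplxK.
rewrite /counting; case: asboolP => [fS|nfS]; last first.
  by rewrite asboolF// => fP; apply: nfS; apply/finE.
have fP : finite_set (@cplx R @^-1` S : set (plane R)) by apply/finE.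
rewrite asboolT//; congr (_%:R%:E).
rewrite {1}SE fset_set_image// finmap.card_imfset//.
exact: can_inj cplxK.
Qed.

End complex_plane.

(** * The counting function as a density *)

(** The Jacobian determinant of [phi] as a map of the real plane. *)
Definition jac_det {R : realType} (phi : R[i] -> R[i]) (p : plane R) : R :=
  Normc.normc (cderive phi (cplx p)) ^+ 2.

Section self_map.
Context {R : realType}.
Variable phi : R[i] -> R[i].
Hypothesis phiD : forall z, unit_disk z -> unit_disk (phi z).
Hypothesis dphi : analytic_on_disk phi.
Implicit Types (p w : plane R).

Local Notation f := (plane_map phi).
Let A p := cmat (cderive phi (cplx p)).
Local Notation J := (jac_det phi).

Let fA p : udisk p -> has_diff f p (A p).
Proof.
move=> pD; apply: has_diff_complex; apply: dphi; apply/unit_diskE.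
by rewrite cplxK.
Qed.

Lemma measurable_plane_map : measurable_fun udisk f.
Proof. by apply: cont_on_measurable; [exact: open_udisk|exact: has_diff_cont fA]. Qed.

Let detA p : `|detm (A p)| = J p.
Proof. by rewrite detm_cmat ger0_norm// sqr_ge0. Qed.

Lemma measurable_jac_det : measurable_fun udisk J.
Proof.
have part p : udisk p -> forall e, 0 < e -> exists2 d, 0 < d & forall s, 0 < s < d ->
    `|(f (p + (s, 0))).1 - (f p).1 - s * complex.Re (cderive phi (cplx p))| <= e * s /\
    `|(f (p + (s, 0))).2 - (f p).2 - s * complex.Im (cderive phi (cplx p))| <= e * s.
  move=> pD e e0; have [d d0 hd] := fA pD e0; exists d => // s /andP[s0 sd].
  have sE : p + (s, 0) - p = (s, 0) by rewrite addrC addKr.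
  have sn : `|(s, 0) : plane R| = s.
    by transitivity (Num.max `|s| `|0 : R|) => //; rewrite normr0 gtr0_norm// max_l// ltW.
  have := hd (p + (s, 0)); rewrite sE sn => /(_ sd).
  rewrite plane_norm_le /linm /lin /A /cmat/= !mulr0 !addr0 => /andP[h1 h2].
  by split; [move: h1; rewrite [complex.Re _ * s]mulrC|move: h2; rewrite [complex.Im _ * s]mulrC].
have mRe : measurable_fun udisk (fun p => complex.Re (cderive phi (cplx p))).
  apply: (measurable_partial open_udisk (g := fun p => (f p).1)).
    exact: (measurableT_comp measurable_fst measurable_plane_map).
  by move=> p pD e e0; have [d d0 h] := part p pD e e0; exists d => // s /h[].
have mIm : measurable_fun udisk (fun p => complex.Im (cderive phi (cplx p))).
  apply: (measurable_partial open_udisk (g := fun p => (f p).2)).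
    exact: (measurableT_comp measurable_snd measurable_plane_map).
  by move=> p pD e e0; have [d d0 h] := part p pD e e0; exists d => // s /h[].
rewrite (_ : J = fun p => complex.Re (cderive phi (cplx p)) ^+ 2 +
    complex.Im (cderive phi (cplx p)) ^+ 2).
  by apply: measurable_funD; apply: measurable_funX; [exact: mRe|exact: mIm].
by apply/funext => p; rewrite /jac_det normc_sqr.
Qed.

Let mJ' : measurable_fun udisk (fun p => `|detm (A p)|).
Proof. by under eq_fun do rewrite detA; exact: measurable_jac_det. Qed.

Let V := [set p | udisk p /\ detm (A p) != 0].
Let N w := counting [set p | V p /\ f p = w] : \bar R.

Let NE : {ae lam R, forall w, counting_fun phi (cplx w) = N w}.
Proof.
have [Z [mZ Z0 sZ]] := sard_zero open_udisk lam_udisk_fin fA.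
exists Z; split => // w /= Nw; apply: sZ; apply: contrapT => ncrit; apply: Nw.
rewrite /counting_fun counting_uncplx /N; congr counting.
apply/seteqP; split => [p /= [/unit_diskE + pw]|p /= [[pD _] pw]].
  rewrite cplxK => pD; have fpw : f p = w by rewrite /plane_map pw cplxK.
  split => //; split => //; apply/eqP => D0; apply: ncrit.
  by exists p => //; split => //; exact: detm_cmat_eq0.
split; first by apply/unit_diskE; rewrite cplxK.
by rewrite -pw /plane_map uncplxK.
Qed.

Lemma plane_map_disk p : udisk p -> udisk (f p).
Proof.
move=> pD; rewrite -/(udisk (uncplx _)); apply/unit_diskE; apply: phiD; apply/unit_diskE.
by rewrite cplxK.
Qed.

Let N0 w : ~ udisk w -> N w = 0%E.
Proof.
move=> wD; rewrite /N (_ : [set _ | _] = set0).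
  by rewrite /counting asboolT// fset_set0 finmap.cardfs0.
by apply/seteqP; split => // p [[pD _] pw]; apply: wD; rewrite -pw; exact: plane_map_disk.
Qed.

Lemma area_negligible (Z : set (plane R)) : (@area R).-negligible Z -> (lam R).-negligible Z.
Proof.
move=> [Y [mY Y0 ZY]]; exists Y; split => //.
move: Y0; rewrite /area /mscale/= => /eqP; rewrite mule_eq0 => /orP[|/eqP//].
by rewrite eqe invr_eq0 gt_eqF// pi_gt0.
Qed.

(** This is the area formula for [phi].  The values taken at critical points form
a null set, so almost everywhere it makes no difference to count only the
non-critical preimages, as the area formula does.  Essential boundedness then
makes the integral of the number of preimages finite, and lets a bounded real
function [m] take its place. *)
Lemma counting_density : ess_bounded_on_disk (counting_fun phi) ->
  exists m : plane R -> R, exists L : R, [/\ measurable_fun setT m,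
    forall w, 0 <= m w <= L,
    {ae lam R, forall w, counting_fun phi (cplx w) = (m w)%:E} &
    forall F : plane R -> R, measurable_fun setT F ->
      (\int[lam R]_(p in udisk) (F (f p) * J p)%:E =
       \int[lam R]_(w in udisk) (F w * m w)%:E)%E].
Proof.
move=> [C aeC].
have [mV mN _] := area_formula_closed open_udisk fA mJ'.
pose L := Num.max C 0.
pose m w : R := if (N w <= L%:E)%E then fine (N w) else 0.
have L0 : 0 <= L by rewrite le_max lexx orbT.
have mm : measurable_fun setT m.
  apply: measurable_fun_ifT => //.
    exact: measurable_fun_lee.
  exact: (measurableT_comp (fine_measurable measurableT) mN).
have mL w : 0 <= m w <= L.
  rewrite /m; case: ifPn => [NL|_]; last by rewrite lexx.
  have Nfin : N w \is a fin_num.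
    by rewrite ge0_fin_numE//; exact: le_lt_trans NL (ltry _).
  by rewrite fine_ge0//= -lee_fin fineK.
have aeL : {ae lam R, forall w, N w = (m w)%:E}.
  have : {ae lam R, forall w, plane_disk w -> (counting_fun phi (cplx w) <= C%:E)%E}.
    exact: area_negligible.
  apply: ae_imply2 NE => w -> NC.
  have NL : (N w <= L%:E)%E.
    have [wD|wD] := pselect (udisk w); last by rewrite N0// lee_fin.
    apply: le_trans (NC _) _; first by rewrite plane_disk_udisk.
    by rewrite lee_fin le_max lexx.
  rewrite /m NL fineK// ge0_fin_numE//; exact: le_lt_trans NL (ltry _).
have mE : measurable_fun setT (fun w => (m w)%:E) by exact/measurable_EFinP.
have aeD : {ae lam R, forall w, N w = ((m w)%:E * (\1_udisk w)%:E)%E}.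
  apply: ae_imply aeL => w Nw; rewrite indicE.
  have [wD|wD] := pselect (udisk w); first by rewrite mem_set// mule1.
  by rewrite memNset// mule0 N0.
have mI : measurable_fun setT (fun w : plane R => (\1_udisk w)%:E : \bar R).
  by apply/measurable_EFinP; apply: measurable_indic; exact: measurable_udisk.
have Nfin : (\int[lam R]_w N w < +oo)%E.
  rewrite (ge0_ae_eq_integral (g := fun w => (m w)%:E * (\1_udisk w)%:E)%E)//.
  - have := @integral_mkcond _ _ R (lam R) udisk (fun w => (m w)%:E).
    rewrite epatch_indic => <-; apply: integrable_lty; first exact: measurable_udisk.
    apply: dbounded_integrable => //; exists L => w _.
    by have /andP[m0 m1] := mL w; rewrite ger0_norm.
  - exact: emeasurable_funM.
  - by move=> w _; rewrite mule_ge0// lee_fin//; have /andP[] := mL w.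
  - by apply: ae_imply aeD => w + _.
exists m, L; split => //.
  by apply: ae_imply2 NE aeL => w -> ->.
move=> F mF; have := area_formula open_udisk fA mJ' Nfin mF; rewrite -/V -/N => areaF.
transitivity (\int[lam R]_(p in V) (F (f p) * `|detm (A p)|)%:E)%E.
  rewrite integral_mkcond [RHS]integral_mkcond; apply: eq_integral => p _.
  rewrite !patchE detA; have [pD|pD] := pselect (udisk p); last first.
    by rewrite !memNset// => -[].
  rewrite (mem_set pD); have [D0|D0] := eqVneq (detm (A p)) 0; last by rewrite mem_set.
  rewrite -detA D0 normr0 mulr0 memNset//= => -[_].
  by rewrite D0 eqxx.
rewrite areaF [RHS]integral_mkcond epatch_indic; apply: ae_eq_integral => //.
- by apply: emeasurable_funM => //; exact/measurable_EFinP.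
- apply: emeasurable_funM => //; apply/measurable_EFinP; exact: measurable_funM.
- by apply: ae_imply aeD => w Nw _; rewrite -[LHS]/((F w)%:E * N w)%E Nw muleA -EFinM.
Qed.

End self_map.

(** * Powers in the Dirichlet space *)

Lemma integral_area {R : realType} (g : plane R -> R) :
  (lam R).-integrable udisk (EFin \o g) ->
  (\int[@area R]_(p in @plane_disk R) (g p)%:E =
   (pi^-1)%:E * \int[lam R]_(p in udisk) (g p)%:E)%E.
Proof.
move=> ig; rewrite plane_disk_udisk /area.
have mD := @measurable_udisk R; have mg := measurable_int _ ig.
rewrite integralE [in RHS]integralE.
rewrite !ge0_integral_mscale//; [|exact: measurable_funeneg|exact: measurable_funepos].
rewrite -muleBr//.
by rewrite fin_num_adde_defr// integrable_pos_fin_num.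
Qed.

Section powers.
Context {R : realType}.
Variable phi : R[i] -> R[i].
Hypothesis phiD : forall z, unit_disk z -> unit_disk (phi z).
Hypothesis dphi : analytic_on_disk phi.
Implicit Types (p w : plane R) (n k : nat).
Local Notation f := (plane_map phi).
Local Notation J := (jac_det phi).
Local Notation pw n := (fun z : R[i] => phi z ^+ n).

Let powerE n : (pw n : R[i]^o -> R[i]^o) = (phi : R[i]^o -> R[i]^o) ^+ n.
Proof. by apply/funext => z; rewrite fctE. Qed.

Lemma analytic_power n : analytic_on_disk (pw n).
Proof. by move=> z zD; rewrite powerE; apply: derivableX; exact: dphi. Qed.

Lemma cderive_power n z : unit_disk z ->
  cderive (pw n) z = n%:R * phi z ^+ n.-1 * cderive phi z.
Proof.
by move=> zD; rewrite !cderiveE powerE deriveX//; exact: dphi.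
Qed.

Lemma cderive_power_mul n k p : udisk p ->
  cderive (pw n) (cplx p) * Num.conj (cderive (pw k) (cplx p)) =
  ((n * k)%:R * J p)%:C%C * moment n.-1 k.-1 (f p).
Proof.
move=> pD; have zD : unit_disk (cplx p) by apply/unit_diskE; rewrite cplxK.
rewrite !cderive_power// /moment /plane_map uncplxK -rmorphXn /=.
move: (phi _ ^+ n.-1) (phi _ ^+ k.-1) => u v.
have JE : (J p)%:C%C = cderive phi (cplx p) * Num.conj (cderive phi (cplx p)).
  by rewrite -normCK normcE -rmorphXn.
rewrite [in RHS]rmorphM /= JE rmorph_nat natrM !rmorphM /= rmorph_nat.
by ring.
Qed.

Lemma jac_det_integrable : ess_bounded_on_disk (counting_fun phi) ->
  (lam R).-integrable udisk (EFin \o J).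
Proof.
move=> /(counting_density phiD dphi)[m [L [mm mL _ mE]]].
have J0 p : 0 <= J p by exact: sqr_ge0.
have int1 := mE (fun=> 1) (measurable_cst _).
apply/integrableP; split.
  by apply/measurable_EFinP; exact: measurable_jac_det.
under eq_integral do rewrite /= ger0_norm//.
under [X in (X < _)%E]eq_integral do rewrite -[J _]mul1r.
rewrite int1; apply: integrable_lty; first exact: measurable_udisk.
apply: dbounded_integrable; first exact: measurable_funM.
by exists L => w _; rewrite mul1r; have /andP[m0 m1] := mL w; rewrite ger0_norm.
Qed.

(** [phi] maps the disk into itself, so [F \o phi] is bounded by [1] there. *)
Lemma pullback_integrable (F : plane R -> R) (c : R) :
  ess_bounded_on_disk (counting_fun phi) -> measurable_fun setT F ->
  (forall w, udisk w -> `|F w| <= 1) ->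
  (lam R).-integrable udisk (fun p => (c * (F (f p) * J p))%:E).
Proof.
move=> /jac_det_integrable iJ mF F1; have mD := @measurable_udisk R.
have mf : measurable_fun udisk f := measurable_plane_map dphi.
have mJ : measurable_fun udisk J := measurable_jac_det dphi.
have mFJ : measurable_fun udisk (fun p => F (f p) * J p).
  by apply: measurable_funM => //; exact: (measurableT_comp mF mf).
under eq_fun do rewrite EFinM; apply: integrableZl => //.
apply: (le_integrable mD _ _ iJ); first exact/measurable_EFinP.
move=> p pD /=; rewrite lee_fin normrM ler_piMl// F1//.
exact: plane_map_disk.
Qed.

Section density.
Variables (m : plane R -> R) (L : R).
Hypotheses (mm : measurable_fun setT m) (mL : forall w, 0 <= m w <= L).
Hypothesis bphi : ess_bounded_on_disk (counting_fun phi).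
Hypothesis mE : forall F : plane R -> R, measurable_fun setT F ->
  (\int[lam R]_(p in udisk) (F (f p) * J p)%:E =
   \int[lam R]_(w in udisk) (F w * m w)%:E)%E.

Lemma density_dbounded : dbounded m.
Proof. by exists L => w _; have /andP[m0 m1] := mL w; rewrite ger0_norm. Qed.

Lemma pullback_integral (F : plane R -> R) (c : R) : measurable_fun setT F ->
  (forall w, udisk w -> `|F w| <= 1) ->
  (\int[@area R]_(p in @plane_disk R) (c * (F (f p) * J p))%:E =
   (pi^-1 * c * \int[lam R]_(w in udisk) (F w * m w))%:E)%E.
Proof.
move=> mF F1; rewrite integral_area; last exact: pullback_integrable.
under eq_integral do rewrite EFinM.
rewrite integralZl//; [|exact: measurable_udisk|]; last first.
  by have := pullback_integrable 1 bphi mF F1; under eq_fun do rewrite mul1r.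
rewrite mE// /Rintegral 2!EFinM muleA fineK//.
apply: integrable_fin_num; first exact: measurable_udisk.
apply: dbounded_integrable; first exact: measurable_funM.
by apply: dboundedM density_dbounded; exists 1.
Qed.

(** The integrand is the moment function of orders [n - 1] and [k - 1] at
[phi z], times [n * k * |phi' z| ^ 2]; the area formula carries it over to an
integral against [m] on the image side. *)
Lemma disk_integral_power n k :
  disk_integral (fun z => cderive (pw n) z * Num.conj (cderive (pw k) z)) =
  Complex (pi^-1 * (n * k)%:R * \int[lam R]_(w in udisk)
             (complex.Re (moment n.-1 k.-1 w) * m w))
          (pi^-1 * (n * k)%:R * \int[lam R]_(w in udisk)
             (complex.Im (moment n.-1 k.-1 w) * m w)).
Proof.
have [mRe mIm] := @measurable_moment R n.-1 k.-1.
have split_mom p : plane_disk p ->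
    complex.Re (cderive (pw n) (cplx p) * Num.conj (cderive (pw k) (cplx p))) =
      (n * k)%:R * (complex.Re (moment n.-1 k.-1 (f p)) * J p) /\
    complex.Im (cderive (pw n) (cplx p) * Num.conj (cderive (pw k) (cplx p))) =
      (n * k)%:R * (complex.Im (moment n.-1 k.-1 (f p)) * J p).
  rewrite plane_disk_udisk => /(cderive_power_mul n k) ->.
  by rewrite complexRe_mul complexIm_mul /= !mul0r subr0 addr0; split; ring.
rewrite /disk_integral; congr Complex; rewrite {1}/Rintegral.
  under eq_integral => p /set_mem pD do rewrite (split_mom p pD).1.
  rewrite (@pullback_integral (fun w => complex.Re (moment n.-1 k.-1 w)))//=.
  by move=> w /(moment_bounds n.-1 k.-1)[].
under eq_integral => p /set_mem pD do rewrite (split_mom p pD).2.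
rewrite (@pullback_integral (fun w => complex.Im (moment n.-1 k.-1 w)))//=.
by move=> w /(moment_bounds n.-1 k.-1)[].
Qed.

Lemma dirichlet_power n : dirichlet_space (pw n).
Proof.
split; first exact: analytic_power.
have [mRe _] := @measurable_moment R n.-1 n.-1.
under eq_integral => p /set_mem pD.
  have -> : Normc.normc (cderive (pw n) (cplx p)) ^+ 2 =
      (n * n)%:R * (complex.Re (moment n.-1 n.-1 (f p)) * J p).
    transitivity (complex.Re
      (cderive (pw n) (cplx p) * Num.conj (cderive (pw n) (cplx p)))).
      by rewrite -normCK normcE -rmorphXn.
    rewrite cderive_power_mul; last by rewrite -plane_disk_udisk.
    by rewrite complexRe_mul /= mul0r subr0; ring.
  over.
rewrite (@pullback_integral (fun w => complex.Re (moment n.-1 n.-1 w))) ?ltry//.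
by move=> w /(moment_bounds n.-1 n.-1)[].
Qed.

(** The values at [0] contribute nothing, since one of them is a positive power of
[phi 0 = 0].  When [n * k = 0] one of the powers is constant. *)
Lemma dirichlet_inner_power n k : phi 0 = 0 -> n <> k ->
  dirichlet_inner (pw n) (pw k) = 0 <->
  (n * k)%N = 0%N \/
  (\int[lam R]_(w in udisk) (complex.Re (moment n.-1 k.-1 w) * m w)%:E = 0)%E /\
  (\int[lam R]_(w in udisk) (complex.Im (moment n.-1 k.-1 w) * m w)%:E = 0)%E.
Proof.
move=> phi0 nk.
have innerE : dirichlet_inner (pw n) (pw k) =
    disk_integral (fun z => cderive (pw n) z * Num.conj (cderive (pw k) z)).
  rewrite /dirichlet_inner phi0; case: n k nk => [|n] [|k] // _.
  - by rewrite (expr0n _ k.+1) rmorph0 mulr0 add0r.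
  - by rewrite (expr0n _ n.+1) mul0r add0r.
  - by rewrite (expr0n _ n.+1) mul0r add0r.
have [mRe mIm] := @measurable_moment R n.-1 k.-1.
have Rint0 (F : plane R -> R) : measurable_fun setT F ->
    (forall w, udisk w -> `|F w| <= 1) ->
    ((\int[lam R]_(w in udisk) (F w * m w)%:E)%E = 0%E) =
    ((\int[lam R]_(w in udisk) (F w * m w))%R = 0).
  move=> mF F1; apply/propext; rewrite /Rintegral; split=> [->//|h]; rewrite -[LHS]fineK ?h//.
  apply: integrable_fin_num; first exact: measurable_udisk.
  apply: dbounded_integrable; first exact: measurable_funM.
  by apply: dboundedM density_dbounded; exists 1.
rewrite (Rint0 _ mRe); last by move=> w /(moment_bounds n.-1 k.-1)[].
rewrite (Rint0 _ mIm); last by move=> w /(moment_bounds n.-1 k.-1)[].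
rewrite innerE disk_integral_power.
set X := (X in Complex (_ * X) _); set Y := (Y in Complex _ (_ * Y)).
have pi0 : (pi : R)^-1 != 0 by rewrite invr_eq0 gt_eqF// pi_gt0.
rewrite -/X -/Y.
split=> [[] /eqP + /eqP|[->|[-> ->]]]; last 2 first.
- by rewrite mulr0 !mul0r.
- by rewrite !mulr0.
rewrite !mulf_eq0 (negPf pi0) pnatr_eq0 /= => /orP[/eqP ->|/eqP X0]; first by left.
by move=> /orP[/eqP ->|/eqP Y0]; [left|right].
Qed.

End density.

End powers.

Local Open Scope complex_scope.
Local Open Scope ring_scope.

Theorem theorem1p1 (R : realType) (phi : R[i] -> R[i]) :
  (forall z, unit_disk z -> unit_disk (phi z)) ->
  analytic_on_disk phi ->
  phi 0 = 0 ->
  ess_bounded_on_disk (counting_fun phi) ->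
  (dirichlet_orthogonal (fun (n : nat) (z : R[i]) => phi z ^+ n) <->
   ess_radial (counting_fun phi)).
Proof.
move=> phiD dphi phi0 bphi.
have [m [L [mm mL aem mE]]] := counting_density phiD dphi bphi.
have aeZ : {ae @lebesgue_measure R, forall r, 0 <= r < 1 ->
    {ae @lebesgue_measure R, forall t, 0 <= t <= 2 * pi ->
      counting_fun phi ((r * cos t) +i* (r * sin t)) = (m (polar (r, t)))%:E}}.
  have : (lam R).-negligible
      ([set w | counting_fun phi (cplx w) <> (m w)%:E] `&` @udisk R).
    by apply: negligibleS aem => w [].
  move=> /ae_polar; apply: ae_imply => r aer r01; apply: ae_imply (aer r01) => t aet t2.
  by apply: contrapT; exact: aet.
split=> [[_ orth]|[g [g0 rad]]].
  have [mean0 rad] : (forall r, 0 <= circle_mean m r) /\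
      {ae @lebesgue_measure R, forall r, 0 <= r < 1 -> {ae @lebesgue_measure R, forall t,
        0 <= t <= 2 * pi -> m (polar (r, t)) = circle_mean m r}}.
    apply: (moments0_radial mm mL) => a b ab.
    have ab1 : a.+1 <> b.+1 by case.
    have [inner0 _] := dirichlet_inner_power phiD dphi mm mL bphi mE phi0 ab1.
    by have [] := inner0 (orth _ _ ab1).
  exists (circle_mean m); split=> [r _|]; first exact: mean0.
  apply: ae_imply2 aeZ rad => r Zr mr r01; apply: ae_imply2 (Zr r01) (mr r01).
  by move=> t Zt mt t2; rewrite Zt// mt.
split=> [n|n k nk]; first exact: (dirichlet_power phiD dphi mm mL bphi mE).
apply/(dirichlet_inner_power phiD dphi mm mL bphi mE phi0 nk).
case: n nk => [|n] nk; first by left; rewrite mul0n.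
case: k nk => [|k] nk; first by left; rewrite muln0.
right; apply: (radial_moment0 (L := L) (g := g)) => //.
- by move=> w _; have /andP[m0 m1] := mL w; rewrite ger0_norm.
- apply: ae_imply2 aeZ rad => r Zr gr r01; apply: ae_imply2 (Zr r01) (gr r01).
  by move=> t Zt gt t2; have := gt t2; rewrite Zt// => -[].
- by move=> nk'; apply: nk; rewrite -[n]/(n.+1.-1) nk'.
Qed.
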